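(* Let $(K,W,A)$ be either $(K^+_{m,n},W^+_{m,n},A^+_{m,n})$ or $(K_{m,n},W_{m,n},A_{m,n})$, let $P$ be a simple $K$-module, $r\in\{0,\dots,m\}$ and $\lambda\in\mathbb{C}^n$ with $\lambda=\mathbf{0}$ if $r\neq m$. Then: (1) if $r\neq m$ or $\lambda\neq(-1,\dots,-1)$, then $\widetilde F(P,r,\lambda)=\ker\sigma_\lambda\cap F(P,L(V(r)\otimes N(\lambda)))$; (2) if $r\neq m$ or $\lambda\neq(-1,\dots,-1)$, then the $W$-module $F(P,L(V(r)\otimes N(\lambda)))/\widetilde F(P,r,\lambda)$ is simple; (3) if $r\neq0$ or $\lambda\neq\mathbf{0}$, then the $W$-module $F(P,r,\lambda)$ is simple; (4) the $W$-module $F(P,L(V(0)\otimes N(\mathbf{0})))$ (which is $P$ with $W\subset K$ acting naturally) is simple if and only if $P$ is not isomorphic to the natural $K$-module $A$ or to $\Pi(A)$; moreover the $W$-module $A/\mathbb{C}$ is simple; (5) if $r=m$ and $\lambda=(-1,\dots,-1)$, then $F(P,L(V(m)\otimes N(\lambda)))$ is simple if and only if $P=\sum_{s=1}^m\partial_{t_s}P+\sum_{l=1}^n\partial_{\xi_l}P$; and if $P\neq\sum_{s=1}^m\partial_{t_s}P+\sum_{l=1}^n\partial_{\xi_l}P$, then $F(P,L(V(m)\otimes N(\lambda)))/F(P,m,\lambda)$ is a trivial $W$-module.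
   Context: All vector spaces are over $\mathbb{C}$; modules are $\mathbb{Z}_2$-graded, simple means no graded submodules other than $0$ and itself; $\Pi$ denotes parity change; a trivial module is one on which $W$ acts by zero. Fix $m,n\in\mathbb{Z}_{\ge0}$, not both zero. $A^+_{m,n}=\mathbb{C}[t_1,\dots,t_m]\otimes\Lambda(\xi_1,\dots,\xi_n)$, $A_{m,n}=\mathbb{C}[t_1^{\pm1},\dots,t_m^{\pm1}]\otimes\Lambda(\xi_1,\dots,\xi_n)$ ($t_i$ even, $\xi_j$ odd); $t^\alpha=t_1^{\alpha_1}\cdots t_m^{\alpha_m}$, $\xi_I$ the increasing product of $\xi_l$, $l\in I$. $W^+_{m,n}$ (resp. $W_{m,n}$) is the Lie superalgebra of super-derivations of $A^+_{m,n}$ (resp. $A_{m,n}$), naturally acting on it; $K^+_{m,n}$ (resp. $K_{m,n}$) is the super Weyl algebra of operators on $A^+_{m,n}$ (resp. $A_{m,n}$) generated by multiplication by $t_i$ (resp. $t_i^{\pm1}$), $\xi_j$ and by $\partial_{t_i}=\partial/\partial t_i$, $\partial_{\xi_j}=\partial/\partial\xi_j$; $A$ with this action is the natural $K$-module, and $W\subset K$. $\mathfrak{gl}(m,n)$ has matrix units $E_{a,b}$, even part $\mathfrak{gl}(m,n)_0=\mathfrak{gl}_m\oplus\mathfrak{gl}_n$ ($\mathfrak{gl}_m=\mathrm{span}\{E_{i,k}:i,k\le m\}$, $\mathfrak{gl}_n\cong\mathrm{span}\{E_{m+l,m+j}\}$ via $E_{l,j}\mapsto E_{m+l,m+j}$),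 odd part spanned by $E_{i,m+j},E_{m+j,i}$. There is a Lie superalgebra homomorphism $\pi:W\to K\otimes U(\mathfrak{gl}(m,n))$ with $\pi(t^\alpha\xi_I\partial_{t_i})=t^\alpha\xi_I\partial_{t_i}\otimes1+\sum_{s=1}^m\partial_{t_s}(t^\alpha\xi_I)\otimes E_{s,i}+(-1)^{|I|-1}\sum_{l=1}^n\partial_{\xi_l}(t^\alpha\xi_I)\otimes E_{m+l,i}$, $\pi(t^\alpha\xi_I\partial_{\xi_j})=t^\alpha\xi_I\partial_{\xi_j}\otimes1+\sum_{s=1}^m\partial_{t_s}(t^\alpha\xi_I)\otimes E_{s,m+j}+(-1)^{|I|-1}\sum_{l=1}^n\partial_{\xi_l}(t^\alpha\xi_I)\otimes E_{m+l,m+j}$ (derivatives of $t^\alpha\xi_I$ regarded as multiplication operators), and for a $K$-module $P$ and a $\mathfrak{gl}(m,n)$-module $M$, $F(P,M)=P\otimes M$ is a $W$-module via $x\cdot(u\otimes v)=\pi(x)(u\otimes v)$, $(a\otimes b)(u\otimes v)=(-1)^{|b||u|}au\otimes bv$. For $\lambda\in\mathbb{C}^n$: $e_1,\dots,e_n$ standard basis of $\mathbb{Z}^n$, $|\mu|=\sum_j\mu_j$, $\mathbf{0}=(0,\dots,0)$; $S(\lambda)=X_1\times\dots\times X_n$ with $X_j=\lambda_j+\mathbb{Z}$ if $\lambda_j\notin\mathbb{Z}$, $X_j=\mathbb{Z}_{\ge0}$ if $\lambda_j\in\mathbb{Z}_{\ge0}$, $X_j=\{-1,-2,\dots\}$ if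 $\lambda_j\in\{-1,-2,\dots\}$; $W(\lambda)$ has basis $\{y(\lambda'):\lambda'\in S(\lambda)\}$, $y(\mu)=0$ for $\mu\notin S(\lambda)$, $\mathfrak{gl}_n$ acting by $E_{l,j}y(\lambda')=\lambda'_jy(\lambda'-e_j+e_l)$. $V(r)=\Lambda^r(\mathbb{C}^m)$ with natural $\mathfrak{gl}_m$-action ($e_1,\dots,e_m$ standard basis of $\mathbb{C}^m$). $M(\lambda)=\bigoplus_{r=0}^mV(r)\otimes W(\lambda)$, spanned by $e_{i_1}\wedge\dots\wedge e_{i_r}y(\lambda')$, with parity $|\lambda-\lambda'|\bmod2$; it is a $\mathfrak{gl}(m,n)$-module with $\mathfrak{gl}(m,n)_0$ acting by tensor product and $E_{i,m+j}\cdot e_{i_1}\wedge\dots\wedge e_{i_r}y(\lambda')=(-1)^r\lambda'_je_i\wedge e_{i_1}\wedge\dots\wedge e_{i_r}y(\lambda'-e_j)$, $E_{m+j,i}\cdot e_{i_1}\wedge\dots\wedge e_{i_r}y(\lambda')=0$ if $i\notin\{i_1,\dots,i_r\}$ and $=(-1)^{r-s}e_{i_1}\wedge\dots\wedge\widehat{e_{i_s}}\wedge\dots\wedge e_{i_r}y(\lambda'+e_j)$ if $i=i_s$. $L(V(m)\otimes N(\lambda))$ denotes the $\mathfrak{gl}(m,n)$-submodule $\mathrm{span}\{e_{i_1}\wedge\dots\wedge e_{i_r}y(\lambda'):0\le r\le m,\ \lambda'\in S(\lambda),\ m+|\lambda|=r+|\lambda'|\}$ of $M(\lambda)$; for $r\in\{0,\dots,m\}$,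 $L(V(r)\otimes N(\mathbf{0}))$ denotes the submodule $\mathrm{span}\{e_{i_1}\wedge\dots\wedge e_{i_{r'}}y(\alpha):0\le r'\le r,\ \alpha\in\mathbb{Z}_{\ge0}^n,\ r=r'+|\alpha|\}$ of $M(\mathbf{0})$ (these are simple $\mathfrak{gl}(m,n)$-modules; $L(V(0)\otimes N(\mathbf{0}))=\mathbb{C}y(\mathbf{0})$ is the trivial module). Operators on $M(\lambda)$: $e_i\wedge(e_{i_1}\wedge\dots\wedge e_{i_r}y(\lambda'))=e_i\wedge e_{i_1}\wedge\dots\wedge e_{i_r}y(\lambda')$, $\tau_j(e_{i_1}\wedge\dots\wedge e_{i_r}y(\lambda'))=(-1)^re_{i_1}\wedge\dots\wedge e_{i_r}y(\lambda'+e_j)$; $\sigma_\lambda:F(P,M(\lambda))\to F(P,M(\lambda))$, $\sigma_\lambda(u\otimes v)=\sum_{s=1}^m\partial_{t_s}u\otimes e_s\wedge v+(-1)^{|u|-1}\sum_{l=1}^n\partial_{\xi_l}u\otimes\tau_l(v)$ (a $W$-module homomorphism). $F(P,r,\lambda)=\sigma_\lambda(F(P,M(\lambda)))\cap F(P,L(V(r)\otimes N(\lambda)))$, and $\widetilde F(P,r,\lambda)=\{w\in F(P,L(V(r)\otimes N(\lambda))):W\cdot w\subset F(P,r,\lambda)\}$. *)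

(* Defs.v *)
From HB Require Import structures.
From mathcomp Require Import all_boot all_order all_algebra.
From mathcomp Require Import complex.
From mathcomp Require Import reals boolp.
Set Implicit Arguments. Unset Strict Implicit. Unset Printing Implicit Defensive.
Import Order.TTheory GRing.Theory Num.Theory.
Local Open Scope ring_scope.

(* The ground field C is modelled as R[i] for an arbitrary R : realType
   (every realType is a model of the real numbers, so R[i] is the field of
   complex numbers). *)

Section Defs.
Variable R : realType.
Local Notation C := (R[i]).
Variables m n : nat.

Section Pointwise.
Variables (X Y : Type) (W : lmodType C).
Definition fz : X -> Y -> W := fun _ _ => 0.
Definition fadd (f g : X -> Y -> W) : X -> Y -> W := fun x y => f x y + g x y.
Definition fscale (c : C) (f : X -> Y -> W) : X -> Y -> W := fun x y => c *: f x y.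

Definition is_subspace (D S : (X -> Y -> W) -> Prop) : Prop :=
  [/\ (forall f, S f -> D f), S fz,
      (forall f g, S f -> S g -> S (fadd f g)) &
      (forall c f, S f -> S (fscale c f))].
End Pointwise.
Arguments fz {X Y W}.

(* Spanning set of W: the elements t^a xi_I d_{t_i} and t^a xi_I d_{xi_j}.
   a ranges over Z^m; for W^+ only a in N^m is admissible (see Wadm).        *)
Inductive Wgen :=
| WT of {ffun 'I_m -> int} & {set 'I_n} & 'I_m   (* t^a xi_I d/dt_i  *)
| WX of {ffun 'I_m -> int} & {set 'I_n} & 'I_n.  (* t^a xi_I d/dxi_j *)

Definition nonneg_mon (a : {ffun 'I_m -> int}) : bool := [forall i, 0 <= a i].

(* laur = false : (K,W,A) = (K^+,W^+,A^+);  laur = true : (K,W,A) = (K,W,A) *)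
Definition Wadm (laur : bool) (x : Wgen) : bool :=
  laur || match x with WT a _ _ => nonneg_mon a | WX a _ _ => nonneg_mon a end.

(* Generic W-module notions for a W-module realised as the set D of
   functions X -> Y -> W, with parity operator par (the Z_2-grading,
   par = (-1)^{degree}) and W acting through act on the spanning set Wgen.  *)
Section WmodNotions.
Variables (X Y : Type) (W : lmodType C) (adm : Wgen -> bool)
  (par : (X -> Y -> W) -> (X -> Y -> W))
  (act : Wgen -> (X -> Y -> W) -> (X -> Y -> W)).

Definition Wsubmod (D S : (X -> Y -> W) -> Prop) : Prop :=
  [/\ is_subspace D S, (forall f, S f -> S (par f)) &
      (forall x f, adm x -> S f -> S (act x f))].

Definition Wsimple (D : (X -> Y -> W) -> Prop) : Prop :=
  (exists f, D f /\ f <> fz) /\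
  forall S, Wsubmod D S -> (forall f, S f -> f = fz) \/ (forall f, D f -> S f).

(* the quotient W-module D / N is simple (N a graded submodule of D);
   graded submodules of D/N are the graded submodules S, N <= S <= D *)
Definition Wsimple_quot (D N : (X -> Y -> W) -> Prop) : Prop :=
  (exists f, D f /\ ~ N f) /\
  forall S, Wsubmod D S -> (forall f, N f -> S f) ->
    (forall f, S f -> N f) \/ (forall f, D f -> S f).

Definition Wtrivial_quot (D N : (X -> Y -> W) -> Prop) : Prop :=
  forall x f, adm x -> D f -> N (act x f).
End WmodNotions.

(* Z_2-graded K-modules.  The grading of V is encoded by the parity
   involution kpar (= +1 on V_0, -1 on V_1).  K is the super Weyl algebra:
   kt i = t_i, kti i = t_i^{-1} (only meaningful when laur), kx j = xi_j,
   kdt i = d/dt_i, kdx j = d/dxi_j.                                          *)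
Record Kops (V : lmodType C) := KOps {
  kpar : V -> V;
  kt : 'I_m -> V -> V;
  kti : 'I_m -> V -> V;
  kx : 'I_n -> V -> V;
  kdt : 'I_m -> V -> V;
  kdx : 'I_n -> V -> V }.

Definition lin (U : lmodType C) (W : lmodType C) (f : U -> W) : Prop :=
  forall (c : C) u v, f (c *: u + v) = c *: f u + f v.

Definition is_Kmodule (laur : bool) (V : lmodType C) (K : Kops V) : Prop :=
  (lin (kpar K) /\ (forall v, kpar K (kpar K v) = v)) /\
  ((forall i, lin (kt K i) /\ lin (kdt K i)) /\ (forall j, lin (kx K j) /\ lin (kdx K j))) /\
  (laur -> forall i, lin (kti K i) /\
      (forall v, kt K i (kti K i v) = v /\ kti K i (kt K i v) = v)) /\
  (forall i v, kpar K (kt K i v) = kt K i (kpar K v) /\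
               kpar K (kdt K i v) = kdt K i (kpar K v)) /\
  (forall j v, kpar K (kx K j v) = - kx K j (kpar K v) /\
               kpar K (kdx K j v) = - kdx K j (kpar K v)) /\
  (forall i k v, [/\ kt K i (kt K k v) = kt K k (kt K i v),
                     kdt K i (kdt K k v) = kdt K k (kdt K i v) &
                     kdt K i (kt K k v) = kt K k (kdt K i v) + (i == k)%:R *: v]) /\
  (forall j l v, [/\ kx K j (kx K l v) = - kx K l (kx K j v),
                     kdx K j (kdx K l v) = - kdx K l (kdx K j v) &
                     kdx K j (kx K l v) = - kx K l (kdx K j v) + (j == l)%:R *: v]) /\
  (forall i j v, [/\ kt K i (kx K j v) = kx K j (kt K i v),
                     kt K i (kdx K j v) = kdx K j (kt K i v),
                     kdt K i (kx K j v) = kx K j (kdt K i v) &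
                     kdt K i (kdx K j v) = kdx K j (kdt K i v)]).

Definition Ksubmod (laur : bool) (V : lmodType C) (K : Kops V) (S : V -> Prop) : Prop :=
  [/\ S 0, (forall u v, S u -> S v -> S (u + v)), (forall (c : C) u, S u -> S (c *: u)),
      (forall u, S u -> S (kpar K u)) &
      [/\ (forall i u, S u -> S (kt K i u) /\ S (kdt K i u)),
          (laur -> forall i u, S u -> S (kti K i u)) &
          (forall j u, S u -> S (kx K j u) /\ S (kdx K j u))]].

Definition Ksimple (laur : bool) (V : lmodType C) (K : Kops V) : Prop :=
  (exists v : V, v <> 0) /\
  forall S, Ksubmod laur K S -> (forall v, S v -> v = 0) \/ (forall v, S v).

(* The operator of multiplication by t^a xi_I (xi_I increasing product)     *)
Definition tpow (U : Type) (t ti : U -> U) (k : int) : U -> U :=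
  match k with Posz p => iter p t | Negz p => iter p.+1 ti end.

Definition mono_gen (U : Type) (t ti : 'I_m -> U -> U) (x : 'I_n -> U -> U)
    (a : {ffun 'I_m -> int}) (I : {set 'I_n}) : U -> U :=
  foldr (fun i g => tpow (t i) (ti i) (a i) \o g)
        (foldr (fun j g => x j \o g) id [seq j <- enum 'I_n | j \in I])
        (enum 'I_m).

Definition mono (V : lmodType C) (K : Kops V) := mono_gen (kt K) (kti K) (kx K).

Definition eim (i : 'I_m) : {ffun 'I_m -> int} := [ffun k => (k == i)%:Z].
Definition ejn (j : 'I_n) : {ffun 'I_n -> int} := [ffun k => (k == j)%:Z].

(* d/dxi_l (xi_I) = dxi_c l I * xi_{I \ l} *)
Definition dxi_c (l : 'I_n) (I : {set 'I_n}) : C :=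
  if l \in I then (-1) ^+ #|[set k in I | (k < l)%N]| else 0.

(* The natural K-module A (laur) / A^+ (~~ laur), realised by coefficient
   functions a : (alpha, J) |-> coefficient of t^alpha xi_J.               *)
Definition Afun := {ffun 'I_m -> int} -> {set 'I_n} -> C.

Definition A_dom (laur : bool) (a : Afun) : Prop :=
  (exists s : seq ({ffun 'I_m -> int} * {set 'I_n}),
      forall b J, a b J <> 0 -> (b, J) \in s) /\
  (forall b J, a b J <> 0 -> laur || nonneg_mon b).

Definition A_par (a : Afun) : Afun := fun b J => (-1) ^+ #|J| * a b J.
Definition A_t (i : 'I_m) (a : Afun) : Afun := fun b J => a (b - eim i) J.
Definition A_ti (i : 'I_m) (a : Afun) : Afun := fun b J => a (b + eim i) J.
Definition A_dt (i : 'I_m) (a : Afun) : Afun :=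
  fun b J => ((b i)%:~R + 1) * a (b + eim i) J.
Definition A_x (j : 'I_n) (a : Afun) : Afun :=
  fun b J => if j \in J then (-1) ^+ #|[set k in J | (k < j)%N]| * a b (J :\ j) else 0.
Definition A_dx (j : 'I_n) (a : Afun) : Afun :=
  fun b J => if j \in J then 0 else (-1) ^+ #|[set k in J | (k < j)%N]| * a b (j |: J).

Definition A_W (x : Wgen) : Afun -> Afun :=
  match x with
  | WT a Ix i => mono_gen A_t A_ti A_x a Ix \o A_dt i
  | WX a Ix j => mono_gen A_t A_ti A_x a Ix \o A_dx j
  end.

Definition A_constants (laur : bool) (a : Afun) : Prop :=
  A_dom laur a /\ forall b J, a b J <> 0 -> b = 0 /\ J = set0.

(* P is isomorphic, as a (graded) K-module, to A (shift = false) or to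
   Pi(A) (shift = true) *)
Definition Kiso_A (laur : bool) (V : lmodType C) (K : Kops V) (shift : bool) : Prop :=
  exists f : Afun -> V,
  [/\ (forall (c : C) a b, A_dom laur a -> A_dom laur b ->
          f (fadd (fscale c a) b) = c *: f a + f b),
      (forall a b, A_dom laur a -> A_dom laur b -> f a = f b -> a = b),
      (forall v, exists a, A_dom laur a /\ f a = v),
      (forall a, A_dom laur a -> f (A_par a) = (if shift then -1 else 1) *: kpar K (f a)) &
     [/\
      (forall i a, A_dom laur a -> f (A_t i a) = kt K i (f a) /\ f (A_dt i a) = kdt K i (f a)),
      (laur -> forall i a, A_dom laur a -> f (A_ti i a) = kti K i (f a)) &
      (forall j a, A_dom laur a -> f (A_x j a) = kx K j (f a) /\ f (A_dx j a) = kdx K j (f a))]].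

(* The gl(m,n)-module M(lambda).  Basis vectors e_J y(lambda + mu),
   J : {set 'I_m} (increasing wedge), mu : Z^n with lambda + mu in S(lambda). *)
Definition isInt (x : C) : Prop := exists k : int, x = k%:~R.

Definition inX (l x : C) : Prop :=
  [/\ (~ isInt l -> exists k : int, x = l + k%:~R),
      (forall k : int, l = k%:~R -> 0 <= k -> exists p : nat, x = p%:R) &
      (forall k : int, l = k%:~R -> k < 0 -> exists p : nat, x = - (p.+1)%:R)].

Definition inS (lam lam' : 'I_n -> C) : Prop := forall j, inX (lam j) (lam' j).

Definition shl (lam : 'I_n -> C) (mu : {ffun 'I_n -> int}) : 'I_n -> C :=
  fun j => lam j + (mu j)%:~R.

Definition validw (lam : 'I_n -> C) (mu : {ffun 'I_n -> int}) : Prop := inS lam (shl lam mu).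

Definition cntlt (i : 'I_m) (I : {set 'I_m}) : nat := #|[set k in I | (k < i)%N]|.
Definition cntgt (i : 'I_m) (I : {set 'I_m}) : nat := #|[set k in I | (i < k)%N]|.

(* e_s /\ e_I = wedge_c s I J e_J *)
Definition wedge_c (s : 'I_m) (I J : {set 'I_m}) : C :=
  if (s \notin I) && (J == s |: I) then (-1) ^+ cntlt s I else 0.
(* contraction iota_i (e_I) = contr_c i I J e_J *)
Definition contr_c (i : 'I_m) (I J : {set 'I_m}) : C :=
  if (i \in I) && (J == I :\ i) then (-1) ^+ cntlt i I else 0.
(* natural action of E_{s,i} on Lambda(C^m): E_{s,i} = e_s /\ iota_i *)
Definition Egl_c (s i : 'I_m) (I J : {set 'I_m}) : C :=
  \sum_(L : {set 'I_m}) contr_c i I L * wedge_c s L J.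
(* V-part of E_{m+j,i}: removes e_i with sign (-1)^{r-s} *)
Definition Edown_c (i : 'I_m) (I J : {set 'I_m}) : C :=
  if (i \in I) && (J == I :\ i) then (-1) ^+ cntgt i I else 0.

(* Elements of F(P, M(lambda)) = P (x) M(lambda):  f J mu is the P-component
   along e_J y(lambda + mu). *)
Definition Ffun (V : lmodType C) := {set 'I_m} -> {ffun 'I_n -> int} -> V.

Definition FM (V : lmodType C) (lam : 'I_n -> C) (f : Ffun V) : Prop :=
  (exists s : seq ({set 'I_m} * {ffun 'I_n -> int}),
      forall J mu, f J mu <> 0 -> (J, mu) \in s) /\
  (forall J mu, f J mu <> 0 -> validw lam mu).

(* F(P, L(V(r) (x) N(lambda))):  r' + |lambda'| = r + |lambda| *)
Definition FL (V : lmodType C) (r : nat) (lam : 'I_n -> C) (f : Ffun V) : Prop :=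
  FM lam f /\
  (forall J mu, f J mu <> 0 -> (#|J|%:Z + \sum_(j < n) mu j)%R = r%:Z).

(* parity on P (x) M(lambda): |u (x) e_J y(lambda')| = |u| + |lambda - lambda'| *)
Definition Fpar (V : lmodType C) (K : Kops V) (f : Ffun V) : Ffun V :=
  fun J mu => (-1) ^+ (odd (absz (\sum_(j < n) mu j))) *: kpar K (f J mu).

Definition Fpi (V : lmodType C) (K : Kops V) (lam : 'I_n -> C) (x : Wgen)
    (f : Ffun V) : Ffun V :=
  fun J nu => if `[< validw lam nu >] then
    match x with
    | WT a Ix i =>
        mono K a Ix (kdt K i (f J nu))
      + \sum_(s < m) \sum_(L : {set 'I_m})
           ((a s)%:~R * Egl_c s i L J) *: mono K (a - eim s) Ix (f L nu)
      + (-1) ^+ (#|Ix|.+1) *: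
         \sum_(l < n) \sum_(L : {set 'I_m})
           (dxi_c l Ix * Edown_c i L J) *:
              mono K a (Ix :\ l) (kpar K (f L (nu - ejn l)))
    | WX a Ix j =>
        mono K a Ix (kdx K j (f J nu))
      + \sum_(s < m) \sum_(L : {set 'I_m})
           ((a s)%:~R * ((-1) ^+ #|L| * shl lam (nu + ejn j) j * wedge_c s L J)) *:
              mono K (a - eim s) Ix (kpar K (f L (nu + ejn j)))
      + (-1) ^+ (#|Ix|.+1) *:
         \sum_(l < n)
           (dxi_c l Ix * shl lam (nu - ejn l + ejn j) j) *:
              mono K a (Ix :\ l) (f J (nu - ejn l + ejn j))
    end
  else 0.

Definition Fsigma (V : lmodType C) (K : Kops V) (lam : 'I_n -> C) (f : Ffun V) : Ffun V :=
  fun J nu => if `[< validw lam nu >] then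
      \sum_(s < m) \sum_(L : {set 'I_m}) wedge_c s L J *: kdt K s (f L nu)
    - \sum_(l < n) (-1) ^+ #|J| *: kdx K l (kpar K (f J (nu - ejn l)))
  else 0.

Definition Fr (V : lmodType C) (K : Kops V) (r : nat) (lam : 'I_n -> C) (f : Ffun V) : Prop :=
  (exists g, FM lam g /\ Fsigma K lam g = f) /\ FL r lam f.

Definition Ftil (laur : bool) (V : lmodType C) (K : Kops V) (r : nat) (lam : 'I_n -> C)
    (f : Ffun V) : Prop :=
  FL r lam f /\ forall x, Wadm laur x -> Fr K r lam (Fpi K lam x f).

Definition Pspan (V : lmodType C) (K : Kops V) : Prop :=
  forall v : V, exists (u : 'I_m -> V) (w : 'I_n -> V),
    v = \sum_(s < m) kdt K s (u s) + \sum_(l < n) kdx K l (w l).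

End Defs.
Arguments fz {R X Y W}.

(* Main.v *)
(* View P (x) M(lambda) as differential forms with coefficients in P: e_s stands
   for dt_s, and multiplication by y_l for dxi_l.  Then sigma_lambda is the
   differential D = sum_a d_a e_a, and W acts by Lie derivatives, so Cartan's
   formula L_X = D i_X + i_X D holds.  On a closed form w it reads L_X w = D i_X w.

   Let N be a W-submodule of the closed forms of degree k, and let Z be the space
   of forms w with D (x i_a w) in N for all monomials x and all a.  Cartan's formula
   gives N <= Z.  Comparing D (x i_a D (x_c i_b w)) with D (x x_c i_a D (i_b w))
   shows that Z is stable under e_c i_b, that is, under gl(m,n); it is also stable
   under K.  The weights of gl(m,n) on M(lambda) are distinct and its degree k part
   is connected under the e_c i_b, so, P being simple over K, a nonzero element of Z
   forces Z to contain all forms of degree k.  Every form of degree k - 1 is a sum of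
   contractions of forms of degree k, up to a form killed by D, so N contains all exact
   forms.  All parts follow by taking N to be a submodule, its image under D, or 0,
   together with the observation that a nonzero vector of P killed by all
   derivations generates a copy of A or of Pi(A). *)

Require Import Defs.
From HB Require Import structures.
From mathcomp Require Import all_boot all_order all_algebra.
From mathcomp Require Import complex.
From mathcomp Require Import reals boolp functions.
From mathcomp Require Import zify ring.
Set Implicit Arguments. Unset Strict Implicit. Unset Printing Implicit Defensive.
Import Order.TTheory GRing.Theory Num.Theory.
Local Open Scope ring_scope.

(** * Multiplication operators on a module over the super Weyl algebra *)

(** P is an arbitrary simple module, so the operators t_i d/dt_i need not be diagonalizable on it,
    and F(P, M) may contain no weight vectors for W. The usable weights are those of the second
    tensor factor, on which W does not act separately. The space Z separates the two factors: its
    condition runs over all monomials, so coordinates are absorbed, and D commutes with the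
    derivations, so K acts on Z; the commutator of D with a coordinate x_c is e_c up to sign, and
    from it the matrix units e_c i_b arise. The second obstacle is the truncation of M(lambda) to
    the weights in S(lambda). Contraction carries the factor lambda'_j, which vanishes where it
    would leave S(lambda), but multiplication by y_j has no such factor and has to be cut off. The
    commutation rules survive because S(lambda) is a product of intervals whose only possible edge
    lies between -1 and 0, exactly where the factor of the contraction vanishes. *)

Section LinearMaps.
Variables (R : realType) (U W : lmodType R[i]) (f : U -> W).
Hypothesis fL : lin f.

Lemma linD u v : f (u + v) = f u + f v.
Proof. by have := fL 1 u v; rewrite !scale1r. Qed.

Lemma lin0 : f 0 = 0.
Proof. by have := linD 0 0; rewrite addr0 => /eqP; rewrite -subr_eq subrr => /eqP <-. Qed.

Lemma linZ c u : f (c *: u) = c *: f u.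
Proof. by have := fL c u 0; rewrite lin0 !addr0. Qed.

Lemma linN u : f (- u) = - f u.
Proof. by rewrite -scaleN1r linZ scaleN1r. Qed.

Lemma lin_sum (I : Type) (s : seq I) (P : pred I) (F : I -> U) :
  f (\sum_(i <- s | P i) F i) = \sum_(i <- s | P i) f (F i).
Proof.
elim/big_rec2: _ => [|i u v _ <-]; first exact: lin0.
exact: linD.
Qed.
End LinearMaps.

Lemma lin_comp (R : realType) (U V W : lmodType R[i]) (f : V -> W) (g : U -> V) :
  lin f -> lin g -> lin (f \o g).
Proof. by move=> fL gL c u v; rewrite /= gL fL. Qed.

Lemma lin_iter (R : realType) (U : lmodType R[i]) (f : U -> U) p :
  lin f -> lin (iter p f).
Proof. by move=> fL; elim: p => [//|p IH] c u v; rewrite !iterS IH fL. Qed.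

Lemma ffun_neq0 (I : finType) (b : {ffun I -> int}) : b != 0 -> exists i, b i != 0.
Proof.
move=> b0; apply: contrapT => H; move/negP: b0; apply; apply/eqP/ffunP => i; rewrite ffunE.
by apply/eqP/negPn/negP => bi; apply: H; exists i.
Qed.

Definition isodd (A B : Type) (a : A + B) : bool := if a is inr _ then true else false.

Section KModule.
Variables (R : realType) (m n : nat) (laur : bool) (V : lmodType R[i]) (K : Kops m n V).
Hypothesis HK : is_Kmodule laur K.
Local Notation idx := ('I_m + 'I_n)%type.
Implicit Types (v : V).

(** Even and odd coordinates share the index type [idx], so that each super-commutation rule below
    becomes one formula with the sign (-1)^(|a||b|). *)
Definition kxop (a : idx) : V -> V := match a with inl i => kt K i | inr j => kx K j end.
Definition kdop (a : idx) : V -> V := match a with inl i => kdt K i | inr j => kdx K j end.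

Lemma kpar_lin : lin (kpar K). Proof. by case: HK => [[]]. Qed.
Lemma kparK v : kpar K (kpar K v) = v. Proof. by case: HK => [[]]. Qed.

Lemma kxop_lin a : lin (kxop a).
Proof. by case: HK => _ [[H1 H2] _]; case: a => i /=; [case: (H1 i)|case: (H2 i)]. Qed.
Lemma kdop_lin a : lin (kdop a).
Proof. by case: HK => _ [[H1 H2] _]; case: a => i /=; [case: (H1 i)|case: (H2 i)]. Qed.

Lemma kt_lin i : lin (kt K i). Proof. exact: (kxop_lin (inl i)). Qed.
Lemma kx_lin j : lin (kx K j). Proof. exact: (kxop_lin (inr j)). Qed.
Lemma kdt_lin i : lin (kdt K i). Proof. exact: (kdop_lin (inl i)). Qed.
Lemma kdx_lin j : lin (kdx K j). Proof. exact: (kdop_lin (inr j)). Qed.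

Lemma kti_lin i : laur -> lin (kti K i).
Proof. by case: HK => _ [_ [H _]] l; case: (H l i). Qed.
Lemma ktK i v : laur -> kti K i (kt K i v) = v.
Proof. by case: HK => _ [_ [H _]] l; case: (H l i) => _ /(_ v) []. Qed.
Lemma ktiK i v : laur -> kt K i (kti K i v) = v.
Proof. by case: HK => _ [_ [H _]] l; case: (H l i) => _ /(_ v) []. Qed.

Lemma kpar_kx a v : kpar K (kxop a v) = (-1) ^+ isodd a *: kxop a (kpar K v).
Proof.
case: HK => _ [_ [_ [H1 [H2 _]]]]; case: a => i /=.
  by rewrite expr0 scale1r; case: (H1 i v).
by rewrite expr1 scaleN1r; case: (H2 i v).
Qed.

Lemma kpar_kd a v : kpar K (kdop a v) = (-1) ^+ isodd a *: kdop a (kpar K v).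
Proof.
case: HK => _ [_ [_ [H1 [H2 _]]]]; case: a => i /=.
  by rewrite expr0 scale1r; case: (H1 i v).
by rewrite expr1 scaleN1r; case: (H2 i v).
Qed.

Lemma kx_kx a b v : kxop a (kxop b v) = (-1) ^+ (isodd a && isodd b) *: kxop b (kxop a v).
Proof.
case: HK => _ [_ [_ [_ [_ [H1 [H2 H3]]]]]].
case: a => i; case: b => j /=; rewrite ?expr0 ?expr1 ?scale1r ?scaleN1r.
- by case: (H1 i j v).
- by case: (H3 i j v).
- by case: (H3 j i v).
- by case: (H2 i j v).
Qed.

Lemma kd_kd a b v : kdop a (kdop b v) = (-1) ^+ (isodd a && isodd b) *: kdop b (kdop a v).
Proof.
case: HK => _ [_ [_ [_ [_ [H1 [H2 H3]]]]]].
case: a => i; case: b => j /=; rewrite ?expr0 ?expr1 ?scale1r ?scaleN1r.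
- by case: (H1 i j v).
- by case: (H3 i j v).
- by case: (H3 j i v).
- by case: (H2 i j v).
Qed.

Lemma kd_kx a b v :
  kdop a (kxop b v) = (-1) ^+ (isodd a && isodd b) *: kxop b (kdop a v) + (a == b)%:R *: v.
Proof.
case: HK => _ [_ [_ [_ [_ [H1 [H2 H3]]]]]].
case: a => i; case: b => j /=; rewrite ?expr0 ?expr1 ?scale1r ?scaleN1r ?scale0r ?addr0.
- by case: (H1 i j v).
- by case: (H3 i j v).
- by case: (H3 j i v).
- by case: (H2 i j v).
Qed.

Lemma kx_sq j v : kx K j (kx K j v) = 0.
Proof.
have := @kx_kx (inr j) (inr j) v; rewrite /= expr1 scaleN1r => /eqP.
rewrite -subr_eq0 opprK -mulr2n -scaler_nat scaler_eq0 pnatr_eq0 /=.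
by move=> /eqP.
Qed.

(** When [laur] is false nothing is known about [kti], which [tpow] applies for negative exponents;
    statements about monomials are guarded by these admissibility tests. *)
Definition okk (k : int) := laur || (0 <= k).
Definition okm (a : {ffun 'I_m -> int}) := laur || nonneg_mon a.

Lemma okm_okk a i : okm a -> okk (a i).
Proof. by rewrite /okm /okk; case: laur => //= /forallP. Qed.

Lemma okm_add a i : okm a -> okm (a + eim i).
Proof.
rewrite /okm; case: laur => //= /forallP H; apply/forallP => k.
by rewrite !ffunE addr_ge0.
Qed.

Lemma okm_sub a i : okm a -> a i != 0 -> okm (a - eim i).
Proof.
rewrite /okm; case: laur => //= /forallP H ai; apply/forallP => k.
rewrite !ffunE; have := H k; case: eqVneq => [->|_]; last by rewrite subr0.
by move: (a i) ai => x; lia.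
Qed.

Definition tp i k v := tpow (kt K i) (kti K i) k v.

Lemma tp_lin i k : okk k -> lin (tp i k).
Proof.
rewrite /okk /tp; case: k => p /=; first by move=> _; apply/lin_iter/(kt_lin i).
by rewrite orbF => l; apply: (@lin_iter _ _ _ p.+1); apply: kti_lin.
Qed.

Lemma tpS i k v : okk k -> tp i (k + 1) v = kt K i (tp i k v).
Proof.
rewrite /okk /tp; case: k => p; first by move=> _; rewrite addrC -intS.
rewrite orbF => l; case: p => [|p]; first by rewrite /= ktiK.
have -> : Negz p.+1 + 1 = Negz p by lia.
by rewrite [in RHS]/= ktiK.
Qed.

Lemma tp_comm (phi : V -> V) i k v :
  (forall w, phi (kt K i w) = kt K i (phi w)) -> okk k -> phi (tp i k v) = tp i k (phi v).
Proof.
move=> H; rewrite /okk /tp; case: k => p.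
  by move=> _ /=; elim: p => [//|p IH]; rewrite !iterS H IH.
rewrite orbF => l.
have Hi w : phi (kti K i w) = kti K i (phi w) by rewrite -{2}(@ktiK i w l) H ktK.
have H' q : phi (iter q (kti K i) v) = iter q (kti K i) (phi v).
  by elim: q => [//|q IH]; rewrite !iterS Hi IH.
exact: (H' p.+1).
Qed.

(** The upward step for d t^k = t^k d + k t^(k-1). At k = 0 the power t^(k-1) may be meaningless,
    but its coefficient is 0; hence the disjunction in the last hypothesis. *)
Lemma kdt_tp_up i k v :
  kdt K i (tp i k v) = tp i k (kdt K i v) + k%:~R *: tp i (k - 1) v -> okk k -> okk (k - 1) || (k == 0) ->
  kdt K i (tp i (k + 1) v) = tp i (k + 1) (kdt K i v) + (k + 1)%:~R *: tp i k v.
Proof.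
move=> IH ok ok'; rewrite !tpS //.
have := @kd_kx (inl i) (inl i) (tp i k v); rewrite /= expr0 eqxx !scale1r => ->.
rewrite IH (linD (kt_lin i)) /= -addrA; congr (_ + _).
rewrite (linZ (kt_lin i)) /= intrD scalerDl scale1r; congr (_ + _).
have [-> | k0] := eqVneq k 0; first by rewrite !scale0r.
by rewrite -tpS ?subrK //; move: ok'; rewrite (negbTE k0) orbF.
Qed.

Lemma kdt_tp i k v : okk k ->
  kdt K i (tp i k v) = tp i k (kdt K i v) + k%:~R *: tp i (k - 1) v.
Proof.
case: k => p.
  move=> _; elim: p => [|p IH]; first by rewrite scale0r addr0.
  have -> : Posz p.+1 = Posz p + 1 by rewrite intS addrC.
  rewrite kdt_tp_up ?addrK // /okk; first by rewrite orbT.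
  by apply/orP; case: (p) => [|q]; [right|left; apply/orP; right; lia].
rewrite /okk orbF => l.
have ok k : okk k by rewrite /okk l.
(* Negative exponents are reached downwards from 0: the rule at k + 1 gives the rule at k by
   cancelling the invertible t_i. *)
suff down k : kdt K i (tp i (k + 1) v) = tp i (k + 1) (kdt K i v) + (k + 1)%:~R *: tp i k v ->
    kdt K i (tp i k v) = tp i k (kdt K i v) + k%:~R *: tp i (k - 1) v.
  elim: p => [|p IH]; apply: down.
    by rewrite scale0r addr0.
  have -> : Negz p.+1 + 1 = Negz p by lia.
  rewrite IH; congr (_ + _ *: tp _ _ _); lia.
rewrite !tpS //.
have := @kd_kx (inl i) (inl i) (tp i k v); rewrite /= expr0 eqxx !scale1r => ->.
rewrite intrD scalerDl scale1r addrA => /addIr H.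
rewrite -[LHS](@ktK i _ l) H (linD (kti_lin i l)) ktK // (linZ (kti_lin i l)).
by congr (_ + _ *: _); rewrite -[k in tp i k v](subrK 1) tpS // ktK.
Qed.

Definition tfold (a : {ffun 'I_m -> int}) (s : seq 'I_m) v := foldr (fun i w => tp i (a i) w) v s.

Lemma tfold_lin a s : okm a -> lin (tfold a s).
Proof.
move=> ok; elim: s => [//|i s IH] c u v /=.
by rewrite IH tp_lin ?okm_okk.
Qed.

Lemma tfold_comm (phi : V -> V) a s v : okm a ->
  (forall i w, i \in s -> phi (kt K i w) = kt K i (phi w)) -> phi (tfold a s v) = tfold a s (phi v).
Proof.
move=> ok; elim: s => [//|i s IH] H /=.
rewrite tp_comm ?okm_okk ?IH // => [k w ks|w]; apply: H; rewrite inE ?eqxx //.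
by rewrite ks orbT.
Qed.

Lemma tfold_ext (a b : {ffun 'I_m -> int}) s v : {in s, a =1 b} -> tfold a s v = tfold b s v.
Proof.
elim: s => [//|i s IH] H /=; rewrite H ?inE ?eqxx // IH // => k ks.
by rewrite H // inE ks orbT.
Qed.

Lemma eim_out i (s : seq 'I_m) a : i \notin s -> {in s, a + eim i =1 a}.
Proof.
move=> i_s k ks; rewrite !ffunE; case: eqVneq => [E|]; last by rewrite addr0.
by rewrite -E ks in i_s.
Qed.

Lemma eim_outN i (s : seq 'I_m) a : i \notin s -> {in s, a - eim i =1 a}.
Proof.
move=> i_s k ks; rewrite !ffunE; case: eqVneq => [E|]; last by rewrite subr0.
by rewrite -E ks in i_s.
Qed.

Lemma tfoldS a s i v : okm a -> uniq s -> i \in s ->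
  tfold (a + eim i) s v = kt K i (tfold a s v).
Proof.
move=> ok; elim: s => [//|k s IH] /= /andP[k_s us]; rewrite inE.
case: eqVneq => [-> _|ik /= i_s].
  rewrite (@tfold_ext _ a); last exact: eim_out.
  by rewrite !ffunE eqxx tpS ?okm_okk.
rewrite IH // !ffunE eq_sym (negbTE ik) addr0.
rewrite [RHS](@tp_comm (kt K i)) ?okm_okk // => w.
by have := @kx_kx (inl i) (inl k) w; rewrite /= expr0 scale1r.
Qed.

Lemma kdt_tfold a s i v : okm a -> uniq s ->
  kdt K i (tfold a s v)
  = tfold a s (kdt K i v) + ((i \in s)%:R * (a i)%:~R) *: tfold (a - eim i) s v.
Proof.
move=> ok; elim: s => [|k s IH] /=; first by rewrite mul0r scale0r addr0.
move=> /andP[k_s us]; rewrite inE; case: eqVneq => [ik|ik] /=.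
  move: k_s; rewrite -{}ik => i_s.
  rewrite kdt_tp ?okm_okk // IH // (negbTE i_s) mul0r scale0r addr0 mul1r.
  rewrite (@tfold_ext (a - _) a); last exact: eim_outN.
  by rewrite !ffunE eqxx.
rewrite (@tp_comm (kdt K i)) ?okm_okk //; last first.
  move=> w; have := @kd_kx (inl i) (inl k) w; rewrite /= expr0 scale1r => ->.
  by rewrite -[inl i == _]/(i == k) (negbTE ik) scale0r addr0.
have tl := tp_lin k (okm_okk k ok).
by rewrite IH // (linD tl) (linZ tl) !ffunE eq_sym (negbTE ik) subr0.
Qed.

Definition xfold (s : seq 'I_n) v := foldr (fun j w => kx K j w) v s.

Lemma xfold_lin s : lin (xfold s).
Proof. by elim: s => [//|j s IH] c u v /=; rewrite IH kx_lin. Qed.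

Lemma kt_xfold s i v : kt K i (xfold s v) = xfold s (kt K i v).
Proof.
elim: s => [//|j s IH] /=; rewrite -IH.
by have := @kx_kx (inl i) (inr j) (xfold s v); rewrite /= expr0 scale1r.
Qed.

Lemma kdt_xfold s i v : kdt K i (xfold s v) = xfold s (kdt K i v).
Proof.
elim: s => [//|j s IH] /=; rewrite -IH.
by have := @kd_kx (inl i) (inr j) (xfold s v); rewrite /= expr0 scale1r scale0r addr0.
Qed.

Lemma kx_xfold s j v : kx K j (xfold s v) = (-1) ^+ size s *: xfold s (kx K j v).
Proof.
elim: s => [|k s IH] /=; first by rewrite expr0 scale1r.
have := @kx_kx (inr j) (inr k) (xfold s v); rewrite /= expr1 scaleN1r => ->.
by rewrite IH (linZ (kx_lin k)) /= exprS mulN1r scaleNr.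
Qed.

Lemma kpar_xfold s v : kpar K (xfold s v) = (-1) ^+ size s *: xfold s (kpar K v).
Proof.
elim: s => [|k s IH] /=; first by rewrite expr0 scale1r.
have := @kpar_kx (inr k) (xfold s v); rewrite /= expr1 scaleN1r => ->.
by rewrite IH (linZ (kx_lin k)) /= exprS mulN1r scaleNr.
Qed.

Lemma kdx_xfold s j v : uniq s ->
  kdx K j (xfold s v) = (-1) ^+ size s *: xfold s (kdx K j v)
     + ((j \in s)%:R * (-1) ^+ index j s) *: xfold (rem j s) v.
Proof.
elim: s => [|k s IH] /=; first by rewrite mul0r scale0r addr0 expr0 scale1r.
move=> /andP[k_s us]; rewrite inE.
have := @kd_kx (inr j) (inr k) (xfold s v); rewrite /= expr1 scaleN1r => ->.
rewrite IH // -[inr j == _]/(j == k) [k == j]eq_sym.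
have kl := kx_lin k.
case: eqVneq => [jk|jk] /=.
  move: k_s kl; rewrite -{}jk => j_s kl; rewrite (negbTE j_s) mul0r scale0r addr0 (linZ kl) /= exprS mulN1r scaleNr.
  by rewrite mul1r.
rewrite scale0r addr0 (linD kl) !(linZ kl) /= opprD !exprS !mulN1r mulrN !scaleNr.
by [].
Qed.

Lemma xfold_rem s j v : uniq s -> j \in s ->
  xfold s v = (-1) ^+ index j s *: kx K j (xfold (rem j s) v).
Proof.
elim: s => [//|k s IH] /= /andP[k_s us]; rewrite inE [k == j]eq_sym.
case: eqVneq => [->|jk] /=; first by rewrite expr0 scale1r.
move=> js; rewrite (IH us js) (linZ (kx_lin k)) /=.
have := @kx_kx (inr k) (inr j) (xfold (rem j s) v); rewrite /= expr1 scaleN1r => ->.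
by rewrite exprS mulN1r scaleNr scalerN.
Qed.

Definition Iseq (I : {set 'I_n}) := [seq j <- enum 'I_n | j \in I].

Lemma Iseq_uniq I : uniq (Iseq I). Proof. by rewrite filter_uniq ?enum_uniq. Qed.
Lemma mem_Iseq I j : (j \in Iseq I) = (j \in I).
Proof. by rewrite mem_filter mem_enum andbT. Qed.
Lemma size_Iseq I : size (Iseq I) = #|I|.
Proof. by rewrite cardE /enum_mem size_filter -size_filter /Iseq enumT. Qed.

(** [Iseq I] is strictly increasing, so the position of j counts the smaller members of I; this
    turns the sign of [kdx_xfold] into that of [dxi_c]. *)
Lemma index_Iseq (I : {set 'I_n}) j : j \in I -> index j (Iseq I) = #|[set k in I | (k < j)%N]|.
Proof.
move=> jI; have srt : sorted (fun x y : 'I_n => (x < y)%N) (Iseq I).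
  apply: sorted_filter; first by move=> x y z; apply: ltn_trans.
  by have := iota_ltn_sorted 0 n; rewrite -val_enum_ord sorted_map.
have -> : #|[set k in I | (k < j)%N]| = count (fun k : 'I_n => (k < j)%N) (Iseq I).
  rewrite cardE /enum_mem size_filter count_filter enumT; apply: eq_count => k /=.
  by rewrite !inE andbC.
have := mem_Iseq I j; rewrite jI.
elim: (Iseq I) srt => [//|k s IH] /= pth; rewrite inE [k == j]eq_sym.
have tr : transitive (fun x y : 'I_n => (x < y)%N) by move=> x y z; apply: ltn_trans.
have all_k : all (fun x : 'I_n => (k < x)%N) s by exact: order_path_min tr pth.
case: eqVneq => [->|jk] /=.
  move=> _; rewrite ltnn add0n; apply/esym/eqP; rewrite -leqn0 leqNgt -has_count.
  by apply/hasPn => x /(allP all_k); rewrite -leqNgt => /ltnW.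
by move=> js; rewrite (allP all_k _ js) (IH (path_sorted pth) js).
Qed.

Lemma rem_Iseq I j : rem j (Iseq I) = Iseq (I :\ j).
Proof.
rewrite rem_filter ?Iseq_uniq // /Iseq -filter_predI; apply: eq_filter => k /=.
by rewrite !inE.
Qed.

Lemma monoE a I v : mono K a I v = tfold a (enum 'I_m) (xfold (Iseq I) v).
Proof.
rewrite /mono /mono_gen; elim: (enum 'I_m) => [|i s IH] /=; last by rewrite IH.
by rewrite /Iseq; elim: [seq _ <- _ | _] => [//|j s IH] /=; rewrite IH.
Qed.

Lemma mono_lin a I : okm a -> lin (mono K a I).
Proof.
move=> ok c u v; rewrite !monoE xfold_lin; exact: (tfold_lin _ ok).
Qed.

Lemma mono0 v : mono K 0 set0 v = v.
Proof.
rewrite monoE /Iseq (eq_filter (a2 := pred0)); last by move=> j; rewrite /= inE.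
rewrite filter_pred0 /=; elim: (enum _) => [//|i s IH] /=.
by rewrite IH ffunE.
Qed.

Lemma mono_ktE a I i v : okm a -> kt K i (mono K a I v) = mono K (a + eim i) I v.
Proof. by move=> ok; rewrite !monoE tfoldS ?enum_uniq ?mem_enum. Qed.

Lemma mono_kt a I i v : okm a -> mono K a I (kt K i v) = mono K (a + eim i) I v.
Proof.
move=> ok; rewrite -mono_ktE // !monoE -kt_xfold (@tfold_comm (kt K i)) // => k w _.
by have := @kx_kx (inl i) (inl k) w; rewrite /= expr0 scale1r.
Qed.

Lemma mono_kti a I i v : laur -> mono K a I (kti K i v) = mono K (a - eim i) I v.
Proof.
by move=> l; rewrite -{2}(@ktiK i v l) mono_kt ?subrK // /okm l.
Qed.

Lemma mono_ktiE a I i v : laur -> kti K i (mono K a I v) = mono K (a - eim i) I v.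
Proof.
by move=> l; rewrite -{1}(subrK (eim i) a) -mono_ktE ?ktK // /okm l.
Qed.

Lemma kdt_mono a I i v : okm a ->
  kdt K i (mono K a I v) = mono K a I (kdt K i v) + (a i)%:~R *: mono K (a - eim i) I v.
Proof.
by move=> ok; rewrite !monoE kdt_tfold ?enum_uniq // mem_enum mul1r kdt_xfold.
Qed.

Lemma kx_tfold a s j v : okm a -> kx K j (tfold a s v) = tfold a s (kx K j v).
Proof.
move=> ok; apply: tfold_comm => // k w _.
by have := @kx_kx (inr j) (inl k) w; rewrite /= expr0 scale1r.
Qed.

Lemma kdx_mono a I j v : okm a ->
  kdx K j (mono K a I v) = (-1) ^+ #|I| *: mono K a I (kdx K j v)
     + dxi_c R j I *: mono K a (I :\ j) v.
Proof.
move=> ok; rewrite !monoE.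
have tl := tfold_lin (enum 'I_m) ok.
rewrite (@tfold_comm (kdx K j)) //; last first.
  move=> k w _; have := @kd_kx (inr j) (inl k) w.
  by rewrite /= expr0 scale1r scale0r addr0.
rewrite kdx_xfold ?Iseq_uniq // (linD tl) !(linZ tl) size_Iseq rem_Iseq mem_Iseq /dxi_c.
by congr (_ + _ *: _); case: ifP => jI; rewrite ?mul0r // mul1r index_Iseq.
Qed.

Lemma kpar_mono a I v : okm a -> kpar K (mono K a I v) = (-1) ^+ #|I| *: mono K a I (kpar K v).
Proof.
move=> ok; rewrite !monoE (@tfold_comm (kpar K)) //; last first.
  by move=> k w _; have := @kpar_kx (inl k) w; rewrite /= expr0 scale1r.
by rewrite kpar_xfold (linZ (tfold_lin _ ok)) size_Iseq.
Qed.

Lemma kx_monoE a I j v : okm a ->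
  kx K j (mono K a I v) = (-1) ^+ #|I| *: mono K a I (kx K j v).
Proof.
by move=> ok; rewrite !monoE kx_tfold // kx_xfold (linZ (tfold_lin _ ok)) size_Iseq.
Qed.

Lemma kx_mono a I j v : okm a ->
  kx K j (mono K a I v) = if j \in I then 0
     else (-1) ^+ #|[set k in I | (k < j)%N]| *: mono K a (j |: I) v.
Proof.
move=> ok; rewrite !monoE kx_tfold //; have tl := tfold_lin (enum 'I_m) ok.
case: ifP => jI.
  rewrite (@xfold_rem _ j) ?Iseq_uniq ?mem_Iseq // (linZ (kx_lin j)) /=.
  by rewrite kx_sq scaler0 (lin0 tl).
rewrite (@xfold_rem (Iseq (j |: I)) j) ?Iseq_uniq ?mem_Iseq ?setU11 //.
rewrite index_Iseq ?setU11 // rem_Iseq setU1K ?jI // (linZ tl) scalerA.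
have -> : [set k in j |: I | (k < j)%N] = [set k in I | (k < j)%N].
  by apply/setP => k; rewrite !inE; case: eqVneq => [->|//]; rewrite ltnn !andbF.
by rewrite -expr2 sqrr_sign scale1r.
Qed.

End KModule.

(** * The differential and the contractions *)

Section Forms.
Variables (R : realType) (m n : nat) (laur : bool) (V : lmodType R[i]) (K : Kops m n V).
Hypothesis HK : is_Kmodule laur K.
Variable lam : 'I_n -> R[i].
Local Notation C := (R[i]).
Local Notation idx := ('I_m + 'I_n)%type.
Local Notation form := ({set 'I_m} -> {ffun 'I_n -> int} -> V).

(** * The weight set S(lambda) and its edge *)

Definition coef j (k : int) : C := lam j + k%:~R.
Definition vld j (k : int) : Prop := inX (lam j) (coef j k).

(** The integral cases of X_j are treated together: lambda_j + k lies in X_j exactly when it is on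
    the same side of the gap between -1 and 0 as lambda_j. *)
Lemma vldP j : (~ isInt (lam j) /\ forall k, vld j k) \/
  (exists z : int, lam j = z%:~R /\ forall k, vld j k <-> (0 <= z) = (0 <= z + k)).
Proof.
case: (pselect (isInt (lam j))) => [[z E]|H]; last first.
  left; split=> // k; split=> [_|z E|z E]; first by exists k.
    by case: H; exists z.
  by case: H; exists z.
right; exists z; split=> // k; rewrite /vld /coef E -intrD.
have P q : (z + k)%:~R = q%:R :> C -> z + k = q by move/eqP; rewrite pmulrn eqr_int => /eqP.
have N q : (z + k)%:~R = - q%:R :> C -> z + k = - q%:Z.
  by move/eqP; rewrite pmulrn -mulrNz eqr_int => /eqP.
split=> [[_ H2 H3]|H].
  have [z0|z0] := lerP 0 z.
    by have [p /P ->] := H2 z erefl z0.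
  by have [p /N ->] := H3 z erefl z0.
split=> [[]|q /eqP|q /eqP]; first by exists z.
  rewrite eqr_int => /eqP <- z0; move: H; rewrite z0 => /esym H.
  by exists (absz (z + k)); rewrite pmulrn gez0_abs.
rewrite eqr_int => /eqP <- z0; have z1 : (z + k < 0) by move: H; lia.
exists (absz (z + k)).-1; rewrite prednK ?absz_gt0 ?lt_eqF //.
by rewrite pmulrn ltz0_abs // mulrNz opprK.
Qed.

Lemma coef_neq0 j k : ~ isInt (lam j) -> coef j k != 0.
Proof.
move=> H; apply/negP => /eqP E; apply: H; exists (- k).
by apply/eqP; rewrite -subr_eq0 mulrNz opprK; apply/eqP.
Qed.

Lemma vld0 j : vld j 0.
Proof. by case: (vldP j) => [[_ H]|[z [_ H]]]; [exact: H | apply/H; rewrite addr0]. Qed.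

(** The only edge of X_j lies between -1 and 0, so a unit step leaves X_j exactly when the larger of
    its two ends is 0. The same remark gives [vld_down]. *)
Lemma vld_up j k : vld j k -> (vld j (k + 1) <-> coef j (k + 1) != 0).
Proof.
case: (vldP j) => [[H1 H] _|[z [E H]]]; first by split=> // _; exact: coef_neq0.
rewrite !H /coef E -intrD intr_eq0; lia.
Qed.

Lemma vld_down j k : vld j k -> (vld j (k - 1) <-> coef j k != 0).
Proof.
case: (vldP j) => [[H1 H] _|[z [E H]]]; first by split=> // _; exact: coef_neq0.
rewrite !H /coef E -intrD intr_eq0; lia.
Qed.

Lemma vld_coef_lt j k k' : vld j k -> vld j k' -> k' < k -> coef j k != 0.
Proof.
case: (vldP j) => [[H1 H] _ _ _|[z [E H]]]; first exact: coef_neq0.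
rewrite !H /coef E -intrD intr_eq0; lia.
Qed.

Lemma vld_convex j k k' k'' : vld j k -> vld j k'' -> k <= k' -> k' <= k'' -> vld j k'.
Proof.
case: (vldP j) => [[H1 H] //|[z [E H]]].
rewrite !H; lia.
Qed.

(** Forms are functions on all of Z^n, so the convention y(mu) = 0 outside S(lambda) has to be
    imposed; the rules relating [eop] and [iop] depend on it. *)
Definition vsupp (f : form) := forall J nu, ~ validw lam nu -> f J nu = 0.

Lemma validwE nu : validw lam nu <-> forall j, vld j (nu j). Proof. by []. Qed.

Definition pw (phi : V -> V) (f : form) : form := fun J nu => phi (f J nu).

(* Exterior multiplication by dt_s or dxi_l and contraction.  The parity operator
   and the sign (-1)^|J| are built into the odd operators so that Dop below is
   sigma_lambda and every commutation rule with an odd or even operator carries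
   only the usual super sign. *)
Definition eop (a : idx) (f : form) : form :=
  match a with
  | inl s => fun J nu => if s \in J then (-1) ^+ cntlt s J *: f (J :\ s) nu else 0
  | inr l => fun J nu =>
      if `[< validw lam nu >] then - ((-1) ^+ #|J| *: kpar K (f J (nu - ejn l))) else 0
  end.

Definition iop (a : idx) (f : form) : form :=
  match a with
  | inl i => fun J nu => if i \in J then 0 else (-1) ^+ cntlt i J *: f (i |: J) nu
  | inr j => fun J nu =>
      ((-1) ^+ #|J| * coef j (nu j + 1)) *: kpar K (f J (nu + ejn j))
  end.

Definition Dop (f : form) : form := \sum_(a : idx) pw (kdop K a) (eop a f).

Lemma Dop_sum f : Dop f = \sum_(a : idx) pw (kdop K a) (eop a f).
Proof. by []. Qed.

Definition plin (o : bool) (phi : V -> V) :=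
  lin phi /\ forall v, kpar K (phi v) = (-1) ^+ o *: phi (kpar K v).

Lemma plin_kx a : plin (isodd a) (kxop K a).
Proof. by split; [apply: kxop_lin HK _ | apply: kpar_kx HK _]. Qed.
Lemma plin_kd a : plin (isodd a) (kdop K a).
Proof. by split; [apply: kdop_lin HK _ | apply: kpar_kd HK _]. Qed.
Lemma plin_mono a (I : {set 'I_n}) : okm laur a -> plin (odd #|I|) (mono K a I).
Proof.
move=> ok; split; first exact: mono_lin HK _ _ ok.
by move=> v; rewrite (kpar_mono HK) // signr_odd.
Qed.

Lemma form_ext (f g : form) : (forall J nu, f J nu = g J nu) -> f = g.
Proof. by move=> H; apply/funext => J; apply/funext => nu. Qed.

Lemma form_addE (f g : form) J nu : (f + g) J nu = f J nu + g J nu. Proof. by []. Qed.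
Lemma form_oppE (f : form) J nu : (- f) J nu = - f J nu. Proof. by []. Qed.
Lemma form_scaleE c (f : form) J nu : (c *: f) J nu = c *: f J nu. Proof. by []. Qed.
Lemma form_sumE (I : Type) (s : seq I) (P : pred I) (F : I -> form) J nu :
  (\sum_(i <- s | P i) F i) J nu = \sum_(i <- s | P i) F i J nu.
Proof. by rewrite fct_sumE fct_sumE. Qed.

Lemma pw_lin phi : lin phi -> lin (pw phi).
Proof. by move=> H c u v; apply: form_ext => J nu; apply: H. Qed.

Lemma eop_lin a : lin (eop a).
Proof.
have pl := kpar_lin HK.
case: a => s c u v; apply: form_ext => J nu; rewrite !(form_addE, form_scaleE) /=.
  by case: ifP => _; rewrite ?scaler0 ?addr0 // form_addE form_scaleE scalerDr !scalerA mulrC.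
case: ifP => _; rewrite ?scaler0 ?addr0 // form_addE form_scaleE pl scalerDr opprD !scalerA.
by rewrite mulrC -scalerA scalerN.
Qed.

Lemma iop_lin a : lin (iop a).
Proof.
have pl := kpar_lin HK.
case: a => s c u v; apply: form_ext => J nu; rewrite !(form_addE, form_scaleE) /=.
  by case: ifP => _; rewrite ?scaler0 ?addr0 // form_addE form_scaleE scalerDr !scalerA mulrC.
by rewrite form_addE form_scaleE pl scalerDr !scalerA [c * _]mulrC.
Qed.

Lemma Dop_lin : lin Dop.
Proof.
move=> c u v; rewrite /Dop scaler_sumr -big_split /=; apply: eq_bigr => a _.
by rewrite eop_lin (pw_lin (kdop_lin HK a)).
Qed.

Lemma vsupp_lin c u v : vsupp u -> vsupp v -> vsupp (c *: u + v).
Proof. by move=> Hu Hv J nu H; rewrite form_addE form_scaleE Hu // Hv // scaler0 addr0. Qed.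

Lemma vsupp_pw phi f : lin phi -> vsupp f -> vsupp (pw phi f).
Proof. by move=> pl Hf J nu H; rewrite /pw Hf // lin0. Qed.

Lemma ejn_self (j : 'I_n) : ejn j j = 1. Proof. by rewrite ffunE eqxx. Qed.
Lemma ejn_neq (j l : 'I_n) : l != j -> ejn j l = 0. Proof. by rewrite ffunE => /negbTE ->. Qed.

Lemma validw_shift (nu : {ffun 'I_n -> int}) j k : vld j k -> (forall l, l != j -> vld l (nu l)) ->
  nu j = k -> validw lam nu.
Proof.
move=> Hk H E; apply/validwE => l; have [->|lj] := eqVneq l j; first by rewrite E.
exact: H.
Qed.

(** Crossing the edge downwards means going from 0 to -1, where the factor lambda'_j of the
    contraction is 0; thus [iop] needs no cutoff, while [eop] does. *)
Lemma invalid_add nu j : ~ validw lam nu -> validw lam (nu + ejn j) -> coef j (nu j + 1) = 0.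
Proof.
move=> H /validwE H'; have Hj := H' j; rewrite !ffunE eqxx in Hj.
apply/eqP/negPn/negP => /(vld_down Hj); rewrite addrK => Hk; apply: H.
apply: (validw_shift (j := j) (k := nu j)) => // l lj.
by have := H' l; rewrite !ffunE (negbTE lj) addr0.
Qed.

Lemma vsupp_eop a f : vsupp f -> vsupp (eop a f).
Proof.
move=> Hf J nu H; case: a => s /=; first by case: ifP => // _; rewrite Hf // scaler0.
by case: asboolP.
Qed.

Lemma vsupp_iop a f : vsupp f -> vsupp (iop a f).
Proof.
move=> Hf J nu H; case: a => s /=; first by case: ifP => // _; rewrite Hf // scaler0.
case: (pselect (validw lam (nu + ejn s))) => [H'|H'].
  by rewrite (invalid_add H H') mulr0 scale0r.
by rewrite Hf // (lin0 (kpar_lin HK)) scaler0.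
Qed.

Lemma vsupp_Dop f : vsupp f -> vsupp (Dop f).
Proof.
move=> Hf J nu H; rewrite /Dop form_sumE big1 // => a _.
by apply: vsupp_pw => //; [apply: kdop_lin HK _ | apply: vsupp_eop].
Qed.

Lemma eop_pw o phi a f : plin o phi ->
  eop a (pw phi f) = (-1) ^+ (isodd a && o) *: pw phi (eop a f).
Proof.
move=> [pl pp]; apply: form_ext => J nu; rewrite form_scaleE /pw.
case: a => s /=; case: ifP => _; rewrite ?(lin0 pl) ?scaler0 ?(linN pl) ?(linZ pl) ?scale1r //.
by rewrite pp scalerN !scalerA mulrC.
Qed.

Lemma iop_pw o phi a f : plin o phi ->
  iop a (pw phi f) = (-1) ^+ (isodd a && o) *: pw phi (iop a f).
Proof.
move=> [pl pp]; apply: form_ext => J nu; rewrite form_scaleE /pw.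
case: a => s /=.
  by case: ifP => _; rewrite ?(lin0 pl) ?scaler0 ?(linZ pl) ?scale1r.
by rewrite pp (linZ pl) !scalerA mulrC.
Qed.

Lemma cntltU1 (x y : 'I_m) (J : {set 'I_m}) : x \notin J -> cntlt y (x |: J) = ((x < y) + cntlt y J)%N.
Proof.
move=> xJ; rewrite /cntlt.
have -> : [set k in x |: J | (k < y)%N] =
    if (x < y)%N then x |: [set k in J | (k < y)%N] else [set k in J | (k < y)%N].
  apply/setP => k; case: ifP => xy; rewrite !inE; case: eqVneq => [->|] //=.
  by rewrite xy andbF.
by case: ifP => xy //; rewrite cardsU1 !inE (negbTE xJ).
Qed.

Lemma cntltD1 (x y : 'I_m) (J : {set 'I_m}) : x \in J -> cntlt y J = ((x < y) + cntlt y (J :\ x))%N.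
Proof. by move=> xJ; rewrite -{1}(setD1K xJ) cntltU1 // !inE eqxx. Qed.

Lemma signC (p : nat) : (-1) ^+ p * (-1) ^+ p = 1 :> C.
Proof. by rewrite -expr2 sqrr_sign. Qed.

Lemma sign_lt (i s : 'I_m) : i != s -> (-1) ^+ (s < i)%N = - (-1) ^+ (i < s)%N :> C.
Proof.
move=> ns; have := ns; rewrite -val_eqE neq_ltn => /orP[] H; rewrite H ltnNge (ltnW H) /=.
  by rewrite expr0 expr1 opprK.
by rewrite expr0 expr1.
Qed.

(** Clifford relations for the dt_s and Weyl relations for the y_l. Only the case of two odd indices
    is delicate: the cutoff in [eop] could spoil it at the edge of S(lambda), but there the factor
    of [iop] vanishes. *)
Lemma iop_eop a b f : vsupp f ->
  iop a (eop b f) = - ((-1) ^+ (isodd a && isodd b) *: eop b (iop a f))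
     + ((-1) ^+ isodd a * (a == b)%:R) *: f.
Proof.
move=> Hf; apply: form_ext => J nu; rewrite form_addE form_oppE !form_scaleE.
case: a => i; case: b => s; rewrite /= ?scale1r ?mul1r.
- rewrite -[inl i == _]/(i == s).
  have [<-|ns] := eqVneq i s.
    case: ifP => iJ; last first.
      by rewrite setU11 setU1K ?iJ // cntltU1 ?iJ // ltnn scalerA signC oppr0 add0r.
    by rewrite !inE eqxx /= setD1K // (cntltD1 i iJ) ltnn scalerA signC addrC scale1r subrr.
  rewrite scale0r addr0; case: ifP => iJ.
    by case: ifP => sJ; rewrite ?oppr0 // !inE iJ ns scaler0 oppr0.
  rewrite !inE [s == i]eq_sym (negbTE ns) iJ andbF /=; case: ifP => sJ; rewrite ?scaler0 ?oppr0 //.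
  rewrite cntltU1 ?iJ // (cntltD1 i sJ) !scalerA.
  have -> : (i |: J) :\ s = i |: (J :\ s).
    by apply/setP => k; rewrite !inE; case: eqVneq => [->|]//=; rewrite eq_sym (negbTE ns).
  rewrite -scaleNr; congr (_ *: _); rewrite !exprD (sign_lt ns).
  case: (i < s)%N; rewrite /= ?expr0 ?expr1; ring.
- rewrite scale0r addr0.
  case: ifP => iJ; case: ifP => Hv; rewrite ?(lin0 (kpar_lin HK)) ?scaler0 ?oppr0 //.
  rewrite (linZ (kpar_lin HK)) cardsU1 iJ scalerN !scalerA exprD expr1 mulN1r mulrN scaleNr mulrC.
  by [].
- rewrite mulr0 scale0r addr0.
  case: ifP => sJ; rewrite ?(lin0 (kpar_lin HK)) ?scaler0 ?oppr0 //.
  rewrite (linZ (kpar_lin HK)) !scalerA (cardsD1 s J) sJ exprD expr1 mulN1r.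
  by rewrite !mulNr scaleNr; congr (- (_ *: _)); ring.
- rewrite -[inr i == _]/(i == s) expr1 !mulN1r !scaleN1r opprK.
  have E : nu + ejn i - ejn s = nu - ejn s + ejn i by rewrite addrAC.
  have -> : (nu - ejn s) i + 1 = nu i + 1 - (i == s)%:Z by rewrite !ffunE addrAC.
  have pl := kpar_lin HK.
  have L (b : bool) (w : V) (c : C) : (c * coef i (nu i + 1)) *:
    kpar K (if b then - (c *: kpar K w) else 0) = - ((c * c * b%:R * coef i (nu i + 1)) *: w).
    case: b; last by rewrite (lin0 pl) mulr0 mul0r scaler0 scale0r oppr0.
    rewrite (linN pl) (linZ pl) (kparK HK) scalerN scalerA; congr (- (_ *: _)); by rewrite mulr1 mulrAC.
  rewrite L signC mul1r E.
  rewrite -[X in if X then _ else _]/(`[< validw lam nu >]).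
  rewrite (linZ pl) (kparK HK) !scalerA mulrA signC mul1r.
  have [is_ | ns] := eqVneq i s.
    move: E; rewrite -{s}is_ subrK addrK => E.
    case: (pselect (validw lam nu)) => Hn; last first.
      by rewrite (Hf _ _ Hn) !scaler0 oppr0 addr0; case: asboolP.
    rewrite (asboolT Hn).
    have -> : `[< validw lam (nu + ejn i) >]%:R * coef i (nu i + 1) = coef i (nu i + 1) :> C.
      case: asboolP => H'; first by rewrite mul1r.
      rewrite mul0r; apply/esym/eqP/negPn/negP => /(vld_up (Hn i)) Hk; apply: H'.
      apply: (validw_shift (j := i) Hk); last by rewrite !ffunE eqxx.
      by move=> l lj; have := (validwE _).1 Hn l; rewrite !ffunE (negbTE lj) addr0.
    (* The two factors are lambda'_i + 1 and lambda'_i; their difference is the constant of the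
       relation. *)
    rewrite -scaleNr -scaleNr -scalerDl /coef; congr (_ *: _); rewrite addrK intrD -opprD.
    by rewrite addrA.
  rewrite scaleNr scale0r oppr0 addr0 subr0.
  case: (pselect (validw lam (nu - ejn s + ejn i))) => Hn; last first.
    by rewrite (Hf _ _ Hn) !scaler0 oppr0; case: asboolP.
  have [c0|c0] := eqVneq (coef i (nu i + 1)) 0.
    by rewrite c0 mulr0 !scale0r oppr0; case: asboolP.
  have Hni : vld i ((nu - ejn s + ejn i) i) := Hn i; rewrite !ffunE (negbTE ns) eqxx subr0 in Hni.
  (* A nonzero factor at nu_i + 1 means that the step down to nu_i stays in X_i, so both cutoffs
     agree. *)
  have -> : `[< validw lam (nu + ejn i) >] = `[< validw lam nu >].
    apply: asbool_equiv_eq; split=> H.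
      apply: (validw_shift (j := i) (k := nu i)) => //.
        by move/(vld_down Hni): c0; rewrite addrK.
      by move=> l lj; have := (validwE _).1 H l; rewrite !ffunE (negbTE lj) addr0.
    apply: (validw_shift (j := i) Hni); last by rewrite !ffunE eqxx.
    by move=> l lj; have := (validwE _).1 H l; rewrite !ffunE (negbTE lj) addr0.
  by case: asboolP => _; rewrite ?mul1r // mul0r scale0r oppr0.
Qed.

Lemma eop_eop a b f : vsupp f ->
  eop a (eop b f) = - ((-1) ^+ (isodd a && isodd b) *: eop b (eop a f)).
Proof.
have pl := kpar_lin HK.
move=> Hf; apply: form_ext => J nu; rewrite form_oppE !form_scaleE.
case: a => i; case: b => s; rewrite /= ?scale1r ?mul1r.
- have [<-|ns] := eqVneq i s.
    by rewrite !inE eqxx /= scaler0 if_same oppr0.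
  rewrite !inE eq_sym ns /=.
  case: ifP => iJ; case: ifP => sJ; rewrite ?scaler0 ?oppr0 //.
  rewrite !scalerA (cntltD1 i sJ) (cntltD1 s iJ).
  have -> : (J :\ i) :\ s = (J :\ s) :\ i by apply/setP => k; rewrite !inE andbCA.
  by rewrite -scaleNr; congr (_ *: _); rewrite !exprD (sign_lt ns); ring.
- case: ifP => iJ; case: ifP => Hv; rewrite ?(lin0 pl) ?scaler0 ?oppr0 //.
  rewrite (linZ pl) (cardsD1 i J) iJ scalerN !scalerA exprD expr1 mulN1r !mulNr !scaleNr opprK mulrC //.
- case: ifP => Hv; case: ifP => sJ; rewrite ?(lin0 pl) ?scaler0 ?oppr0 //.
  rewrite (linZ pl) (cardsD1 s J) sJ scalerN !scalerA exprD expr1 mulN1r !mulNr !scaleNr !opprK mulrC //.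
- rewrite expr1 scaleN1r opprK.
  case: asboolP => Hn //.
  rewrite !fun_if !(linN pl) !(linZ pl) !(kparK HK) !(lin0 pl) !scalerN !scalerA signC scale1r !opprK.
  have E : nu - ejn i - ejn s = nu - ejn s - ejn i by rewrite addrAC.
  rewrite E scaler0 oppr0 scale1r.
  case: (pselect (validw lam (nu - ejn s - ejn i))) => Hm; last first.
    by rewrite (Hf _ _ Hm) !if_same.
  have H k : validw lam (nu - ejn k) <-> vld k (nu k - 1).
    split=> [/(_ k)|Hk]; first by rewrite /shl !ffunE eqxx.
    apply: (validw_shift (j := k) Hk); last by rewrite !ffunE eqxx.
    by move=> l lj; have := (validwE _).1 Hn l; rewrite !ffunE (negbTE lj) subr0.
  (* Both ends of the double step are valid and each X_j is an interval, so the intermediate weights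
     are valid too. *)
  have cv (k : 'I_n) : k \in [:: i; s] -> validw lam (nu - ejn k).
    move=> ks; apply/H; apply: (vld_convex (Hm k) (Hn k)); last lia.
    rewrite !ffunE; move: ks; rewrite !inE.
    by move: (nu k) => x; case: (k == s); case: (k == i) => //= _; lia.
  by rewrite !asboolT //; apply: cv; rewrite !inE eqxx ?orbT.
Qed.

(** Leibniz rule for a coordinate: the commutator of D with x_b is dx_b, up to sign. It recovers
    exterior multiplication from D and K. *)
Lemma Dop_kx b f :
  Dop (pw (kxop K b) f) = pw (kxop K b) (Dop f) + (-1) ^+ isodd b *: eop b f.
Proof.
have xl := pw_lin (kxop_lin HK b).
rewrite /Dop (lin_sum xl).
have -> : (-1) ^+ isodd b *: eop b f =
    \sum_a ((-1) ^+ (isodd a && isodd b) * (a == b)%:R) *: eop a f.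
  rewrite (bigD1 b) //= eqxx mulr1 andbb big1 ?addr0 // => a /negbTE ->.
  by rewrite mulr0 scale0r.
rewrite -big_split; apply: eq_bigr => a _ /=.
have al := pw_lin (kdop_lin HK a).
rewrite (eop_pw _ _ (plin_kx b)) (linZ al); apply: form_ext => J nu.
rewrite form_addE !form_scaleE /pw (kd_kx HK) scalerDr !scalerA signC scale1r.
by [].
Qed.

Lemma Dop_kd b f : Dop (pw (kdop K b) f) = pw (kdop K b) (Dop f).
Proof.
have xl := pw_lin (kdop_lin HK b).
rewrite /Dop (lin_sum xl); apply: eq_bigr => a _.
have al := pw_lin (kdop_lin HK a).
rewrite (eop_pw _ _ (plin_kd b)) (linZ al); apply: form_ext => J nu.
by rewrite !form_scaleE /pw (kd_kd HK) !scalerA signC scale1r.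
Qed.

Lemma form_eqN (f : form) : f = - f -> f = 0.
Proof.
move/eqP; rewrite -subr_eq0 opprK -mulr2n -scaler_nat scaler_eq0 pnatr_eq0 /=.
by move=> /eqP.
Qed.

(** The sign with which the e_a anticommute is the one with which the d_a commute, so the double sum
    is antisymmetric in a and b, and 2 is invertible. *)
Lemma Dop_Dop f : vsupp f -> Dop (Dop f) = 0.
Proof.
move=> Hf; pose T a b := pw (kdop K a) (eop a (pw (kdop K b) (eop b f))).
have TN a b : T a b = - T b a.
  have al := pw_lin (kdop_lin HK a); have bl := pw_lin (kdop_lin HK b).
  rewrite /T !(eop_pw _ _ (plin_kd _)) (linZ al) (linZ bl) (eop_eop a b Hf).
  rewrite (linN bl) (linN al) scalerN (linZ bl) (linZ al) scalerA signC scale1r.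
  congr (- _); apply: form_ext => J nu; rewrite form_scaleE /pw (kd_kd HK).
  by rewrite andbC.
have E : Dop (Dop f) = \sum_a \sum_b T a b.
  rewrite {1}/Dop; apply: eq_bigr => a _.
  by rewrite /Dop (lin_sum (eop_lin a)) (lin_sum (pw_lin (kdop_lin HK a))).
rewrite E; apply: form_eqN; rewrite {1}exchange_big -sumrN; apply: eq_bigr => a _.
by rewrite -sumrN; apply: eq_bigr => b _.
Qed.

(** Cartan's formula for the constant field d_a, whose Lie derivative acts on coefficients only. All
    terms e_b i_a cancel, and the constant of [iop_eop] survives at b = a. *)
Lemma Cartan_kd a f : vsupp f -> Dop (iop a f) + iop a (Dop f) = pw (kdop K a) f.
Proof.
move=> Hf; rewrite /Dop (lin_sum (iop_lin a)) -big_split /=.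
rewrite (bigD1 a) //= big1 ?addr0 => [|b ba]; have bl b' := pw_lin (kdop_lin HK b').
  rewrite (iop_pw _ _ (plin_kd a)) iop_eop // eqxx mulr1 (linD (bl a)) (linN (bl a)) !(linZ (bl a)).
  by rewrite scalerDr scalerN !scalerA andbb signC !scale1r addrA subrr add0r.
rewrite (iop_pw _ _ (plin_kd b)) iop_eop // eq_sym (negbTE ba) mulr0 scale0r addr0.
by rewrite (linN (bl b)) !(linZ (bl b)) scalerN scalerA signC scale1r subrr.
Qed.

End Forms.

(** * Cartan's formula *)

Section Cartan.
Variables (R : realType) (m n : nat) (laur : bool) (V : lmodType R[i]) (K : Kops m n V).
Hypothesis HK : is_Kmodule laur K.
Variable lam : 'I_n -> R[i].
Local Notation idx := ('I_m + 'I_n)%type.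
Local Notation form := ({set 'I_m} -> {ffun 'I_n -> int} -> V).
Local Notation eop := (eop K lam).
Local Notation iop := (iop K lam).
Local Notation Dop := (Dop K lam).

Lemma DopE f : Dop f = \sum_(s < m) pw (kdt K s) (eop (inl s) f)
   + \sum_(l < n) pw (kdx K l) (eop (inr l) f).
Proof. by rewrite /Dop big_sumType. Qed.

(** For fixed J at most one L has a nonzero matrix coefficient; this and the next two lemmas
    evaluate the sums in the definitions accordingly. *)
Lemma wedge_sum s J (F : {set 'I_m} -> V) :
  \sum_L wedge_c R s L J *: F L = if s \in J then (-1) ^+ cntlt s J *: F (J :\ s) else 0.
Proof.
case: ifP => sJ.
  rewrite (bigD1 (J :\ s)) //= big1 ?addr0 => [|L LJ].
    by rewrite /wedge_c !inE eqxx /= setD1K // eqxx (cntltD1 s sJ) ltnn.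
  rewrite /wedge_c; case: ifP => [/andP[sL /eqP E]|]; last by rewrite scale0r.
  by move: LJ; rewrite E setU1K // eqxx.
rewrite big1 // => L _; rewrite /wedge_c; case: ifP => [/andP[sL /eqP E]|]; last by rewrite scale0r.
by move: sJ; rewrite E setU11.
Qed.

Lemma contr_sum i J (F : {set 'I_m} -> V) :
  \sum_L contr_c R i L J *: F L = if i \in J then 0 else (-1) ^+ cntlt i J *: F (i |: J).
Proof.
case: ifP => iJ.
  rewrite big1 // => L _; rewrite /contr_c; case: ifP => [/andP[sL /eqP E]|]; last by rewrite scale0r.
  by move: iJ; rewrite E !inE eqxx.
rewrite (bigD1 (i |: J)) //= big1 ?addr0 => [|L LJ].
  by rewrite /contr_c setU11 setU1K ?iJ // eqxx cntltU1 ?iJ // ltnn.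
rewrite /contr_c; case: ifP => [/andP[sL /eqP E]|]; last by rewrite scale0r.
by move: LJ; rewrite E setD1K // eqxx.
Qed.

Lemma Edown_sum i J (F : {set 'I_m} -> V) :
  \sum_L Edown_c R i L J *: F L = if i \in J then 0 else (-1) ^+ cntgt i J *: F (i |: J).
Proof.
case: ifP => iJ.
  rewrite big1 // => L _; rewrite /Edown_c; case: ifP => [/andP[sL /eqP E]|]; last by rewrite scale0r.
  by move: iJ; rewrite E !inE eqxx.
rewrite (bigD1 (i |: J)) //= big1 ?addr0 => [|L LJ].
  rewrite /Edown_c setU11 setU1K ?iJ // eqxx; congr (_ ^+ _ *: _).
  by congr #|pred_of_set _|; apply/setP => k; rewrite !inE; case: eqVneq => [->|//]; rewrite ltnn !andbF.
rewrite /Edown_c; case: ifP => [/andP[sL /eqP E]|]; last by rewrite scale0r.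
by move: LJ; rewrite E setD1K // eqxx.
Qed.

(** E_{m+j,i} counts the factors after e_i, contraction those before it; the two signs differ by
    (-1)^|J|, the sign built into the odd operators. *)
Lemma cntlt_gt i (J : {set 'I_m}) : i \notin J -> (cntlt i J + cntgt i J)%N = #|J|.
Proof.
move=> iJ; rewrite /cntlt /cntgt -cardsUI.
have -> : [set k in J | (k < i)%N] :&: [set k in J | (i < k)%N] = set0.
  by apply/setP => k; rewrite !inE; case: ltngtP; rewrite ?andbF.
rewrite cards0 addn0; congr #|pred_of_set _|; apply/setP => k; rewrite !inE -andb_orr -neq_ltn.
by case: (eqVneq (k : nat) i) => [/val_inj ->|]; rewrite ?andbT // (negbTE iJ).
Qed.

(** Leibniz rule D (x g) = x D g + dx g for a monomial x, with dx expanded in the coordinates. *)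
Lemma Dop_mono a (I : {set 'I_n}) g : okm laur a ->
  Dop (pw (mono K a I) g) = pw (mono K a I) (Dop g)
   + \sum_(s < m) (a s)%:~R *: pw (mono K (a - eim s) I) (eop (inl s) g)
   + (-1) ^+ #|I| *: \sum_(l < n) dxi_c R l I *: pw (mono K a (I :\ l)) (eop (inr l) g).
Proof.
move=> ok; have ml : lin (pw (mono K a I) : form -> form) := pw_lin (mono_lin HK I ok).
rewrite !DopE (linD ml) !(lin_sum ml) -!addrA scaler_sumr.
rewrite [X in _ = _ + X]addrCA [RHS]addrA.
rewrite -!big_split; congr (_ + _).
  apply: eq_bigr => s _; apply: form_ext => J nu.
  rewrite (eop_pw _ _ _ (plin_mono HK I ok)) /= expr0 scale1r form_addE !form_scaleE /pw.
  by rewrite (kdt_mono HK).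
apply: eq_bigr => l _; apply: form_ext => J nu.
have kl : lin (pw (kdx K l) : form -> form) := pw_lin (kdx_lin HK l).
rewrite (eop_pw _ _ _ (plin_mono HK I ok)) (linZ kl) /= form_addE !form_scaleE /pw.
by rewrite (kdx_mono HK) // scalerDr !scalerA signr_odd signC scale1r.
Qed.

Definition Xgen (a : {ffun 'I_m -> int}) (I : {set 'I_n}) (b : idx) : Wgen m n :=
  match b with inl i => WT a I i | inr j => WX a I j end.

(* The action of W is the Lie derivative: L_X = D i_X + i_X D, with i_X = x i_b for X = x d_b. *)
Lemma Fpi_Cartan a I b f : vsupp lam f -> okm laur a ->
  Fpi K lam (Xgen a I b) f
  = Dop (pw (mono K a I) (iop b f)) + pw (mono K a I) (iop b (Dop f)).
Proof.
move=> Hf ok; have pl := kpar_lin HK; have ml I' := mono_lin HK I' ok.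
(* If a_s = 0 the exponent a - e_s need not be admissible, but then the term has coefficient 0. *)
have ok' s : a s != 0 -> lin (mono K (a - eim s) I).
  by move=> as0; apply: mono_lin HK _ _ (okm_sub ok as0).
have pml : lin (pw (mono K a I) : form -> form) := pw_lin (ml I).
(* The Leibniz rule and the constant case give x d_b f + dx i_b f; it remains to identify dx i_b
   with the gl(m,n) part of [Fpi], one matrix unit e_s i_b at a time. *)
rewrite Dop_mono // addrAC [X in X + _]addrAC -(linD pml) (Cartan_kd HK) //.
have He c : vsupp lam (eop c (iop b f)) by apply/vsupp_eop/(vsupp_iop HK).
apply: form_ext => J nu.
case: (pselect (validw lam nu)) => Hn; last first.
  rewrite /Fpi asboolF // !form_addE form_scaleE !form_sumE /pw (Hf _ _ Hn).
  rewrite (lin0 (kdop_lin HK b)) (lin0 (ml I)) !big1 ?scaler0 ?addr0 // => s _; rewrite form_scaleE.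
    by rewrite He // (lin0 (ml _)) scaler0.
  have [->|as0] := eqVneq (a s) 0; first by rewrite scale0r.
  by rewrite He // (lin0 (ok' s as0)) scaler0.
rewrite !form_addE form_scaleE !form_sumE /Fpi asboolT //.
case: b He => [i|j] _ /=.
- congr (_ + _ + _).
    apply: eq_bigr => s _; rewrite form_scaleE /pw.
    have [->|as0] := eqVneq (a s) 0.
      by rewrite big1 ?scale0r // => L _; rewrite mul0r scale0r.
    rewrite (eq_bigr (fun L => (a s)%:~R *: (Egl_c R s i L J *: mono K (a - eim s) I (f L nu)))); last first.
      by move=> L _; rewrite scalerA.
    rewrite -scaler_sumr; congr (_ *: _).
    rewrite (eq_bigr (fun L => mono K (a - eim s) I (Egl_c R s i L J *: f L nu))); last first.
      by move=> L _; rewrite (linZ (ok' s as0)).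
    rewrite -(lin_sum (ok' s as0)); congr (mono _ _ _ _).
    rewrite (eq_bigr (fun L => \sum_L' (wedge_c R s L' J *: (contr_c R i L L' *: f L nu)))); last first.
      by move=> L _; rewrite /Egl_c scaler_suml; apply: eq_bigr => L' _; rewrite scalerA mulrC.
    rewrite exchange_big /= (eq_bigr (fun L' => wedge_c R s L' J *: iop (inl i) f L' nu)); last first.
      by move=> L' _; rewrite -scaler_sumr contr_sum.
    by rewrite wedge_sum.
  rewrite exprS mulN1r scaleNr -scalerN; congr (_ *: _); rewrite -sumrN.
  apply: eq_bigr => l _; rewrite form_scaleE /pw asboolT //.
  rewrite (eq_bigr (fun L => dxi_c R l I *: mono K a (I :\ l) (Edown_c R i L J *: kpar K (f L (nu - ejn l))))); last first.
    by move=> L _; rewrite (linZ (ml _)) scalerA.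
  rewrite -scaler_sumr -scalerN -(lin_sum (ml _)) -(linN (ml _)) Edown_sum.
  congr (_ *: mono _ _ _ (- _)); case: ifP => iJ; first by rewrite (lin0 pl) scaler0.
  rewrite (linZ pl) scalerA -(cntlt_gt (i := i)) ?iJ // exprD mulrAC -expr2 sqrr_sign mul1r.
  by [].
- congr (_ + _ + _).
    apply: eq_bigr => s _; rewrite form_scaleE /pw.
    have [->|as0] := eqVneq (a s) 0.
      by rewrite big1 ?scale0r // => L _; rewrite mul0r scale0r.
    rewrite (eq_bigr (fun L => (a s)%:~R *: (mono K (a - eim s) I (wedge_c R s L J *:
       (((-1) ^+ #|L| * coef lam j (nu j + 1)) *: kpar K (f L (nu + ejn j))))))); last first.
      move=> L _; rewrite (linZ (ok' s as0)) (linZ (ok' s as0)) !scalerA; congr (_ *: _).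
      by congr (_ * _); rewrite mulrC /shl /coef !ffunE eqxx.
    by rewrite -scaler_sumr -(lin_sum (ok' s as0)) wedge_sum.
  rewrite exprS mulN1r scaleNr -scalerN; congr (_ *: _); rewrite -sumrN.
  apply: eq_bigr => l _; rewrite form_scaleE /pw asboolT //.
  rewrite -scalerA -[in LHS](linZ (ml _)) -[in LHS]scalerN.
  rewrite -(linN (ml _)); congr (_ *: mono _ _ _ (- _)).
  rewrite (linZ pl) (kparK HK) !scalerA mulrA signC mul1r; congr (_ *: _).
  by rewrite /shl /coef !ffunE eqxx.
Qed.

Lemma Fsigma_Dop f : vsupp lam f -> Fsigma K lam f = Dop f.
Proof.
move=> Hf; apply: form_ext => J nu.
case: (pselect (validw lam nu)) => Hn; last first.
  by rewrite /Fsigma asboolF // (vsupp_Dop HK).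
rewrite /Fsigma asboolT // DopE form_addE !form_sumE -sumrN; congr (_ + _).
  apply: eq_bigr => s _; have dl := kdt_lin HK s; rewrite /pw /= -(wedge_sum s J (fun L => f L nu)) (lin_sum dl).
  by apply: eq_bigr => L _; rewrite (linZ dl).
apply: eq_bigr => l _; have dl := kdx_lin HK l; rewrite /pw /= asboolT //.
by rewrite (linN dl) (linZ dl).
Qed.

End Cartan.

(** * Finite supports and degrees *)

Section Supports.
Variables (R : realType) (m n : nat) (laur : bool) (V : lmodType R[i]) (K : Kops m n V).
Hypothesis HK : is_Kmodule laur K.
Variable lam : 'I_n -> R[i].
Local Notation C := (R[i]).
Local Notation form := ({set 'I_m} -> {ffun 'I_n -> int} -> V).
Local Notation eop := (eop K lam).
Local Notation iop := (iop K lam).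
Local Notation Dop := (Dop K lam).

Implicit Types (f g : form) (J : {set 'I_m}) (mu nu : {ffun 'I_n -> int}).

Definition fsupp (f : form) := exists s : seq ({set 'I_m} * {ffun 'I_n -> int}),
  forall J mu, f J mu <> 0 -> (J, mu) \in s.

Definition hasdeg (k : int) (f : form) :=
  forall J mu, f J mu <> 0 -> (#|J|%:Z + \sum_(j < n) mu j)%R = k.

Lemma FM_vsupp f : FM lam f -> vsupp lam f.
Proof. by move=> [_ H] J nu Hn; apply: contrapT => /H. Qed.

Lemma FMP f : fsupp f -> vsupp lam f -> FM lam f.
Proof. by move=> Hs Hv; split=> // J mu H; apply: contrapT => /Hv. Qed.

Lemma fsupp_re (h : {set 'I_m} * {ffun 'I_n -> int} -> {set 'I_m} * {ffun 'I_n -> int}) (f g : form) :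
  (forall J mu, g J mu <> 0 -> exists p, f p.1 p.2 <> 0 /\ (J, mu) = h p) ->
  fsupp f -> fsupp g.
Proof.
move=> H [s Hs]; exists (map h s) => J mu /H [[J' mu'] [/Hs Hp ->]].
exact: map_f.
Qed.

Lemma fsupp_lin c f g : fsupp f -> fsupp g -> fsupp (c *: f + g).
Proof.
move=> [s Hs] [t Ht]; exists (s ++ t) => J mu; rewrite form_addE form_scaleE mem_cat => H.
apply/orP; case: (pselect (f J mu = 0)) => [f0|/Hs]; last by left.
by right; apply: Ht => g0; apply: H; rewrite f0 g0 scaler0 addr0.
Qed.

Lemma fsupp0 : fsupp 0. Proof. by exists [::]. Qed.

Lemma fsupp_sum (I : Type) (s : seq I) (F : I -> form) :
  (forall i, fsupp (F i)) -> fsupp (\sum_(i <- s) F i).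
Proof.
move=> H; elim: s => [|i s IH]; first by rewrite big_nil; exact: fsupp0.
by rewrite big_cons -(scale1r (F i)); apply: fsupp_lin.
Qed.

Lemma fsupp_pw phi f : phi 0 = 0 -> fsupp f -> fsupp (pw phi f).
Proof.
move=> p0; apply: (@fsupp_re id) => J mu H; exists (J, mu); split=> // f0.
by apply: H; rewrite /pw f0.
Qed.

Lemma fsupp_eop a f : fsupp f -> fsupp (eop a f).
Proof.
case: a => s.
  apply: (@fsupp_re (fun p => (s |: p.1, p.2))) => J mu /=.
  case: ifP => // sJ H; exists (J :\ s, mu); rewrite /= setD1K //; split=> // f0.
  by apply: H; rewrite f0 scaler0.
apply: (@fsupp_re (fun p => (p.1, p.2 + ejn s))) => J mu /=.
case: ifP => // _ H; exists (J, mu - ejn s); rewrite /= subrK; split=> // f0.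
by apply: H; rewrite f0 (lin0 (kpar_lin HK)) scaler0 oppr0.
Qed.

Lemma fsupp_iop a f : fsupp f -> fsupp (iop a f).
Proof.
case: a => s.
  apply: (@fsupp_re (fun p => (p.1 :\ s, p.2))) => J mu /=.
  case: ifP => // sJ H; exists (s |: J, mu); rewrite /= setU1K ?sJ //; split=> // f0.
  by apply: H; rewrite f0 scaler0.
apply: (@fsupp_re (fun p => (p.1, p.2 - ejn s))) => J mu /= H.
exists (J, mu + ejn s); rewrite /= addrK; split=> // f0.
by apply: H; rewrite f0 (lin0 (kpar_lin HK)) scaler0.
Qed.

Lemma FM_lin c f g : FM lam f -> FM lam g -> FM lam (c *: f + g).
Proof.
move=> Hf Hg; apply: FMP; first by apply: fsupp_lin; [apply Hf|apply Hg].
by apply: vsupp_lin; apply: FM_vsupp.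
Qed.

Lemma FM0 : FM lam (0 : form). Proof. by apply: FMP => //; exact: fsupp0. Qed.

Lemma FM_pw phi f : lin phi -> FM lam f -> FM lam (pw phi f).
Proof.
move=> pl Hf; apply: FMP; first by apply: fsupp_pw (lin0 pl) _; apply Hf.
exact/vsupp_pw/FM_vsupp.
Qed.

Lemma FM_iop a f : FM lam f -> FM lam (iop a f).
Proof.
by move=> Hf; apply: FMP; [apply: fsupp_iop; apply Hf | apply/(vsupp_iop HK)/FM_vsupp].
Qed.

Lemma FM_Dop f : FM lam f -> FM lam (Dop f).
Proof.
move=> Hf; apply: FMP; last exact/(vsupp_Dop HK)/FM_vsupp.
apply: fsupp_sum => a; apply: fsupp_pw; first exact: lin0 (kdop_lin HK a).
by apply: fsupp_eop; apply Hf.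
Qed.

Lemma hasdegN k f J mu : hasdeg k f -> (#|J|%:Z + \sum_(j < n) mu j)%R <> k -> f J mu = 0.
Proof. by move=> H ne; apply: contrapT => /H. Qed.

Lemma hasdeg_lin k c f g : hasdeg k f -> hasdeg k g -> hasdeg k (c *: f + g).
Proof.
move=> Hf Hg J mu H; apply: contrapT => ne; apply: H.
by rewrite form_addE form_scaleE (hasdegN Hf ne) (hasdegN Hg ne) scaler0 addr0.
Qed.

Lemma hasdeg0 k : hasdeg k 0. Proof. by []. Qed.

Lemma hasdeg_pw k phi f : phi 0 = 0 -> hasdeg k f -> hasdeg k (pw phi f).
Proof. by move=> p0 Hf J mu H; apply: Hf => f0; apply: H; rewrite /pw f0. Qed.

Lemma sum_ejn (j : 'I_n) : \sum_(l < n) ejn j l = 1.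
Proof.
rewrite (bigD1 j) //= ejn_self big1 ?addr0 // => l lj; exact: ejn_neq.
Qed.

Lemma sum_addejn (mu : {ffun 'I_n -> int}) j :
  \sum_(l < n) (mu + ejn j) l = \sum_(l < n) mu l + 1.
Proof.
by rewrite -(sum_ejn j) -big_split; apply: eq_bigr => l _; rewrite ffunE.
Qed.

Lemma sum_subejn (mu : {ffun 'I_n -> int}) j :
  \sum_(l < n) (mu - ejn j) l = \sum_(l < n) mu l - 1.
Proof. by rewrite -{2}(subrK (ejn j) mu) sum_addejn addrK. Qed.

Lemma hasdeg_eop k a f : hasdeg k f -> hasdeg (k + 1) (eop a f).
Proof.
move=> Hf J mu H; apply: contrapT => ne; apply: H; case: a => s /=; case: ifP => // sJ.
  rewrite (hasdegN Hf) ?scaler0 // => E; apply: ne; rewrite -E (cardsD1 s J) sJ PoszD.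
  by rewrite -addrA addrC.
rewrite (hasdegN Hf) ?(lin0 (kpar_lin HK)) ?scaler0 ?oppr0 // sum_subejn => E; apply: ne.
by rewrite -E -!addrA addNr addr0.
Qed.

Lemma hasdeg_iop k a f : hasdeg k f -> hasdeg (k - 1) (iop a f).
Proof.
move=> Hf J mu H; apply: contrapT => ne; apply: H; case: a => s /=.
  case: ifP => // sJ.
  rewrite (hasdegN Hf) ?scaler0 // => E; apply: ne; rewrite -E cardsU1 sJ PoszD.
  by rewrite [RHS]addrC !addrA addNr add0r.
rewrite (hasdegN Hf) ?(lin0 (kpar_lin HK)) ?scaler0 ?oppr0 // sum_addejn => E; apply: ne.
by rewrite -E -!addrA subrr addr0.
Qed.

Lemma hasdeg_sum k (I : Type) (s : seq I) (F : I -> form) :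
  (forall i, hasdeg k (F i)) -> hasdeg k (\sum_(i <- s) F i).
Proof.
move=> H; elim: s => [|i s IH]; first by rewrite big_nil; exact: hasdeg0.
by rewrite big_cons -(scale1r (F i)); apply: hasdeg_lin.
Qed.

Lemma hasdeg_Dop k f : hasdeg k f -> hasdeg (k + 1) (Dop f).
Proof.
move=> Hf; apply: hasdeg_sum => a; apply: hasdeg_pw; first exact: lin0 (kdop_lin HK a).
exact: hasdeg_eop.
Qed.

(** At k = r this is [FL r] by definition. Integer degrees are needed because potentials have degree
    r - 1, which may be -1. *)
Definition Fk k f := FM lam f /\ hasdeg k f.

Lemma Fk_lin k c f g : Fk k f -> Fk k g -> Fk k (c *: f + g).
Proof. by move=> [? ?] [? ?]; split; [exact: FM_lin|exact: hasdeg_lin]. Qed.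
Lemma Fk0 k : Fk k 0. Proof. split; [exact: FM0|exact: hasdeg0]. Qed.
Lemma Fk_pw k phi f : lin phi -> Fk k f -> Fk k (pw phi f).
Proof. by move=> pl [? ?]; split; [exact: FM_pw|apply: hasdeg_pw => //; exact: lin0]. Qed.
Lemma Fk_iop k a f : Fk k f -> Fk (k - 1) (iop a f).
Proof. by move=> [? ?]; split; [exact: FM_iop|exact: hasdeg_iop]. Qed.
Lemma Fk_Dop k f : Fk k f -> Fk (k + 1) (Dop f).
Proof. by move=> [? ?]; split; [exact: FM_Dop|exact: hasdeg_Dop]. Qed.

Definition sgnz (k : int) : C := (-1) ^+ odd (absz k).

Lemma sgnz1 k : sgnz (k + 1) = - sgnz k.
Proof.
rewrite /sgnz; have -> : odd (absz (k + 1)) = ~~ odd (absz k) by lia.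
by case: odd; rewrite ?expr0 ?expr1 ?opprK.
Qed.

Lemma FparE f J mu : Fpar K f J mu = sgnz (\sum_(j < n) mu j) *: kpar K (f J mu).
Proof. by []. Qed.

Lemma Fpar_lin : lin (Fpar K : form -> form).
Proof.
move=> c u v; apply: form_ext => J mu; rewrite form_addE form_scaleE !FparE.
by rewrite form_addE form_scaleE (kpar_lin HK) scalerDr !scalerA mulrC.
Qed.

Lemma FM_par f : FM lam f -> FM lam (Fpar K f).
Proof.
have p0 J mu : Fpar K f J mu <> 0 -> f J mu <> 0.
  by move=> H f0; apply: H; rewrite FparE f0 (lin0 (kpar_lin HK)) scaler0.
by move=> [[s Hs] Hv]; split; [exists s => J mu /p0 /Hs | move=> J mu /p0 /Hv].
Qed.

Lemma Fk_par k f : Fk k f -> Fk k (Fpar K f).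
Proof.
move=> [Hf Hd]; split=> [|J mu H]; first exact: FM_par.
by apply: Hd => f0; apply: H; rewrite FparE f0 (lin0 (kpar_lin HK)) scaler0.
Qed.

Lemma Fpar_pw o phi f : plin K o phi -> Fpar K (pw phi f) = (-1) ^+ o *: pw phi (Fpar K f).
Proof.
move=> [pl pp]; apply: form_ext => J mu; rewrite form_scaleE /pw !FparE pp (linZ pl) !scalerA.
by rewrite mulrC.
Qed.

Lemma Fpar_eop a f : Fpar K (eop a f) = (-1) ^+ isodd a *: eop a (Fpar K f).
Proof.
have pl := kpar_lin HK.
apply: form_ext => J mu; rewrite form_scaleE FparE; case: a => s /=; case: ifP => _;
  rewrite ?(lin0 pl) ?scaler0 //.
  by rewrite FparE (linZ pl) !scalerA mul1r mulrC.
rewrite FparE sum_subejn (linN pl) !(linZ pl) !scalerN !scalerA; congr (- (_ *: _)).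
rewrite -{1}(subrK 1 (\sum_j mu j)) sgnz1; ring.
Qed.

Lemma Fpar_iop a f : Fpar K (iop a f) = (-1) ^+ isodd a *: iop a (Fpar K f).
Proof.
have pl := kpar_lin HK.
apply: form_ext => J mu; rewrite form_scaleE FparE; case: a => s /=.
  case: ifP => _; rewrite ?(lin0 pl) ?scaler0 //.
  by rewrite FparE (linZ pl) !scalerA mul1r mulrC.
rewrite FparE sum_addejn !(linZ pl) !scalerA sgnz1; congr (_ *: _); ring.
Qed.

Lemma Fpar_Dop f : Fpar K (Dop f) = Dop (Fpar K f).
Proof.
rewrite !Dop_sum (lin_sum Fpar_lin); apply: eq_bigr => a _.
rewrite (Fpar_pw _ (plin_kd HK a)) Fpar_eop (linZ (pw_lin (kdop_lin HK a))) scalerA signC.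
by rewrite scale1r.
Qed.

(** The pure tensor of u with e_J y(lambda + mu). *)
Definition del (J : {set 'I_m}) (mu : {ffun 'I_n -> int}) (u : V) : form :=
  fun J' mu' => if (J' == J) && (mu' == mu) then u else 0.

Lemma del_self J mu u : del J mu u J mu = u. Proof. by rewrite /del !eqxx. Qed.

Lemma del_lin J mu : lin (del J mu).
Proof.
move=> c u v; apply: form_ext => J' mu'; rewrite form_addE form_scaleE /del.
by case: ifP => // _; rewrite scaler0 addr0.
Qed.

Lemma Fk_del J mu u : validw lam mu -> Fk (#|J|%:Z + \sum_(j < n) mu j)%R (del J mu u).
Proof.
move=> Hv; have p J' mu' : del J mu u J' mu' <> 0 -> J' = J /\ mu' = mu.
  by rewrite /del; case: ifP => // /andP[/eqP -> /eqP ->].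
split; first split.
- by exists [:: (J, mu)] => J' mu' /p [-> ->]; rewrite inE.
- by move=> J' mu' /p [_ ->].
- by move=> J' mu' /p [-> ->].
Qed.

Lemma Fk_ind k (Q : form -> Prop) : Q 0 ->
  (forall f g, Q f -> Q g -> Q (f + g)) ->
  (forall J mu u, validw lam mu -> (#|J|%:Z + \sum_(j < n) mu j)%R = k -> Q (del J mu u)) ->
  forall f, Fk k f -> Q f.
Proof.
move=> Q0 QD Qd f [[[s Hs] Hv] Hd]; elim: s f Hs Hv Hd => [|[J mu] s IH] f Hs Hv Hd.
  suff -> : f = 0 by [].
  by apply: form_ext => J mu; apply: contrapT => /Hs.
have [f0|f0] := pselect (f J mu = 0).
  apply: IH => // J' mu' H; have := Hs _ _ H; rewrite inE => /orP[/eqP [E1 E2]|//].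
  by case: H; rewrite E1 E2.
rewrite -(subrK (del J mu (f J mu)) f); apply: QD; last by apply: Qd; [exact: (Hv _ _ f0)|exact: (Hd _ _ f0)].
have E J' mu' : (f - del J mu (f J mu)) J' mu' =
    if (J' == J) && (mu' == mu) then 0 else f J' mu'.
  rewrite form_addE form_oppE /del; case: ifP => [/andP[/eqP -> /eqP ->]|]; first exact: subrr.
  by rewrite subr0.
apply: IH => J' mu'; rewrite E; case: ifP => // H f1.
- by have := Hs _ _ f1; rewrite inE xpair_eqE H.
- exact: Hv f1.
- exact: Hd f1.
Qed.

End Supports.

(** * Basis labels of M(lambda) and the simplicity argument *)

Section Labels.
Variables (R : realType) (m n : nat) (lam : 'I_n -> R[i]).
Local Notation C := (R[i]).
Local Notation idx := ('I_m + 'I_n)%type.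
Local Notation lbl := ({set 'I_m} * {ffun 'I_n -> int})%type.
Implicit Types (p q : lbl) (a b c : idx).

Definition degl p : int := #|p.1|%:Z + \sum_(j < n) p.2 j.

Definition subl b p : lbl :=
  match b with inl i => (p.1 :\ i, p.2) | inr j => (p.1, p.2 - ejn j) end.
Definition addl b p : lbl :=
  match b with inl i => (i |: p.1, p.2) | inr j => (p.1, p.2 + ejn j) end.
(** [canl] says that i_b does not kill the basis vector, [cana] that e_b does not. *)
Definition canl b p : bool :=
  match b with inl i => i \in p.1 | inr j => coef lam j (p.2 j) != 0 end.
Definition cana b p : Prop :=
  match b with inl i => i \notin p.1 | inr j => validw lam (p.2 + ejn j) end.
(** The weight: the eigenvalue of E_{b,b} on the basis vector with label p. *)
Definition wt b p : C :=
  match b with inl s => (s \in p.1)%:R | inr j => coef lam j (p.2 j) end.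

Lemma wt_sep p q : p != q -> exists c, wt c p != wt c q.
Proof.
move=> pq; apply: contrapT => H; move/negP: pq; apply.
have W c : wt c p = wt c q by apply/eqP/negPn/negP => Hc; apply: H; exists c.
case: p q W {H} => [J mu] [J' mu'] W; apply/eqP; congr (_, _).
  apply/setP => s; have /= := W (inl s); case: (s \in J); case: (s \in J') => //= /eqP.
    by rewrite oner_eq0.
  by rewrite eq_sym oner_eq0.
apply/ffunP => j; have /= /eqP := W (inr j); rewrite /coef (inj_eq (addrI _)) eqr_int.
by move/eqP.
Qed.

Definition posi (z : int) : nat := match z with Posz k => k | Negz _ => 0 end.

(* Number of moves E_{c,b} needed to pass from p to q when both have the same degree. *)
Definition exl p q : nat := (#|p.1 :\: q.1| + \sum_(j < n) posi (p.2 j - q.2 j)%R)%N.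

Definition excess b p q : bool :=
  match b with inl i => (i \in p.1) && (i \notin q.1) | inr j => q.2 j < p.2 j end.

(** The surplus of p over q minus that of q over p is the difference of the degrees; for equal
    degrees both run out at the same time. *)
Lemma exl_deg p q : degl p = degl q -> exl p q = exl q p.
Proof.
move=> E; apply/eqP; rewrite -eqz_nat /exl !PoszD -subr_eq0; apply/eqP.
have S (x y : lbl) : (\sum_(j < n) posi (x.2 j - y.2 j)%R)%N%:Z = \sum_(j < n) (posi (x.2 j - y.2 j))%:Z.
  by apply: (big_morph Posz PoszD).
have P z : (posi z)%:Z - (posi (- z))%:Z = z by case: z => [[|k]|k] /=; lia.
have D : \sum_(j < n) (posi (p.2 j - q.2 j))%:Z - \sum_(j < n) (posi (q.2 j - p.2 j))%:Z
    = \sum_(j < n) p.2 j - \sum_(j < n) q.2 j.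
  rewrite -!sumrB; apply: eq_bigr => j _; rewrite -[RHS]P; congr (_ - (posi _)%:Z).
  by rewrite opprB.
have CD (A B : {set 'I_m}) : #|A|%:Z = #|A :&: B|%:Z + #|A :\: B|%:Z by rewrite -PoszD cardsID.
move: E; rewrite /degl (CD p.1 q.1) (CD q.1 p.1) setIC !S.
move: D; lia.
Qed.

Lemma exl_gt0 p q : (0 < exl p q)%N -> exists b, excess b p q.
Proof.
move=> H; apply: contrapT => N; move: H; rewrite /exl.
have -> : p.1 :\: q.1 = set0.
  apply/setP => i; rewrite !inE; apply/negbTE/negP => H; apply: N; exists (inl i).
  by rewrite /= andbC.
rewrite cards0 big1 // => j _.
have : ~~ (q.2 j < p.2 j) by apply/negP => H; apply: N; exists (inr j).
rewrite -leNgt -subr_le0; case: (p.2 j - q.2 j) => // -[] //.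
Qed.

Lemma exl_eq0 p q : exl p q = 0%N -> exl q p = 0%N -> p = q.
Proof.
move=> H1 H2; have N x y b : exl x y = 0%N -> ~~ excess b x y.
  move=> H; apply/negP; move/eqP: H; rewrite addn_eq0 cards_eq0 sum_nat_eq0 => /andP[/eqP H /forallP H'].
  case: b => i /=; first by move/setP/(_ i): H; rewrite !inE andbC => ->.
  by have := H' i; rewrite /= -subr_gt0; case: (x.2 i - y.2 i) => [[]|].
case: p q N H1 H2 => [J mu] [J' mu'] N H1 H2; congr (_, _).
  apply/setP => i; have /= := N _ _ (inl i) H1; have /= := N _ _ (inl i) H2.
  by case: (i \in J); case: (i \in J').
by apply/ffunP => j; have /= := N _ _ (inr j) H1; have /= := N _ _ (inr j) H2; case: ltgtP.
Qed.

Lemma exl_subl b p q : excess b p q -> (exl (subl b p) q).+1 = exl p q.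
Proof.
rewrite /exl; case: b => i /=.
  move=> /andP[ip iq]; rewrite -addSn; congr (_ + _)%N.
  rewrite [RHS](cardsD1 i) !inE ip iq add1n; congr (_.+1); congr #|pred_of_set _|.
  by apply/setP => k; rewrite !inE andbCA.
move=> lt; rewrite -addnS; congr (_ + _)%N; rewrite (bigD1 i) // [in RHS](bigD1 i) //= -addSn; congr (_ + _)%N.
  rewrite !ffunE eqxx; move: lt; rewrite -subr_gt0 addrAC.
  case: (p.2 i - q.2 i) => [[|k]|k] // _.
  have E : (Posz k.+1 - 1 = k)%R by lia.
  by rewrite -[X in posi X]/(Posz k.+1 - 1)%R E.
by apply: eq_bigr => l li; rewrite !ffunE (negbTE li) subr0.
Qed.

(** Adding where p falls short of q creates no surplus, so a move from a surplus to a deficit lowers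
    [exl] by exactly one. *)
Lemma exl_addl c p q : excess c q p -> exl (addl c p) q = exl p q.
Proof.
rewrite /exl; case: c => i /=.
  move=> /andP[iq ip]; congr (#|pred_of_set _| + _)%N.
  by apply/setP => k; rewrite !inE; case: eqVneq => [->|//]; rewrite iq.
move=> lt; congr (_ + _)%N; apply: eq_bigr => l _; rewrite !ffunE.
case: eqVneq => [->|_]; last by rewrite addr0.
move: lt; rewrite -subr_lt0 addrAC; case: (p.2 i - q.2 i) => [[|k]|[|k]] // _.
Qed.

Lemma excess_subl b c p q : excess b p q -> excess c q p -> excess c q (subl b p).
Proof.
case: c => k; case: b => i //=.
  by move=> _ /andP[-> H]; rewrite !inE (negbTE H) andbF.
rewrite !ffunE => H1 H2; case: eqVneq => [E|_]; last by rewrite subr0.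
by move: H1 H2; rewrite E; case: ltgtP.
Qed.

Lemma sublK c p : cana c p -> subl c (addl c p) = p.
Proof.
by case: p => J mu; case: c => i /=; [move=> iJ; rewrite setU1K | rewrite addrK].
Qed.

Lemma degl_addl c p : cana c p -> degl (addl c p) = degl p + 1.
Proof.
case: c => i /= H; rewrite /degl /=; first by rewrite cardsU1 H PoszD -addrA addrC.
by rewrite sum_addejn addrA.
Qed.

Lemma degl_move b c p q : excess b p q -> excess c q p ->
  degl (addl c (subl b p)) = degl p.
Proof.
move=> H1 H2; have H3 := excess_subl H1 H2.
have E : degl (subl b p) + 1 = degl p.
  move: H1; rewrite /degl; case: b {H3} => i /=.
    by move=> /andP[ip _]; rewrite (cardsD1 i p.1) ip PoszD -!addrA [RHS]addrC -addrA.
  by move=> _; rewrite sum_subejn -addrA subrK.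
rewrite -E; move: H3; rewrite /degl; case: c {H2} => i /=.
  by move=> /andP[iq ip]; rewrite cardsU1 ip PoszD -!addrA addrC addrA.
by move=> _; rewrite sum_addejn addrA.
Qed.

(** A step from p towards a valid q stays between the two, hence in S(lambda). The contraction does
    not vanish either: 0 can only be the least element of X_j, and q lies strictly below p at j. *)
Lemma validw_subl b p q : validw lam p.2 -> validw lam q.2 -> excess b p q ->
  canl b p /\ validw lam (subl b p).2.
Proof.
move=> Hp Hq; case: b => j /=; first by move=> /andP[-> _].
move=> lt; have c0 := vld_coef_lt (Hp j) (Hq j) lt; split=> //.
apply: (validw_shift (j := j) (k := p.2 j - 1)).
- by apply/(vld_down (Hp j)).
- by move=> l lj; have := (validwE _ _).1 Hp l; rewrite !ffunE (negbTE lj) subr0.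
- by rewrite !ffunE eqxx.
Qed.

Lemma validw_addl c p q : validw lam p.2 -> validw lam q.2 -> excess c q p ->
  cana c p /\ validw lam (addl c p).2.
Proof.
move=> Hp Hq; case: c => j /=; first by move=> /andP[_ ->].
move=> lt; suff H : validw lam (p.2 + ejn j) by [].
apply: (validw_shift (j := j) (k := p.2 j + 1)).
- by apply: (vld_convex (Hp j) (Hq j)); lia.
- by move=> l lj; have := (validwE _ _).1 Hp l; rewrite !ffunE (negbTE lj) addr0.
- by rewrite !ffunE eqxx.
Qed.

End Labels.

(** * From one nonzero element of [Zs] to all forms of its degree *)

Section Core.
Variables (R : realType) (m n : nat) (laur : bool) (V : lmodType R[i]) (K : Kops m n V).
Hypothesis HK : is_Kmodule laur K.
Hypothesis HP : Ksimple laur K.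
Variable lam : 'I_n -> R[i].
Local Notation C := (R[i]).
Local Notation idx := ('I_m + 'I_n)%type.
Local Notation lbl := ({set 'I_m} * {ffun 'I_n -> int})%type.
Local Notation form := ({set 'I_m} -> {ffun 'I_n -> int} -> V).
Local Notation eop := (eop K lam).
Local Notation iop := (iop K lam).
Local Notation Dop := (Dop K lam).
Local Notation delp p := (del p.1 p.2).
Implicit Types (f g : form) (J : {set 'I_m}) (mu nu : {ffun 'I_n -> int}) (p q : lbl) (b : idx).

(** A coordinate is absorbed into the monomial, up to a scalar, so a condition over all monomials is
    stable under multiplication by x_b. *)
Lemma mono_kxop (a : {ffun 'I_m -> int}) I b : okm laur a ->
  exists (c : C) (a' : {ffun 'I_m -> int}) (I' : {set 'I_n}), okm laur a' /\ forall v, mono K a I (kxop K b v) = c *: mono K a' I' v.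
Proof.
move=> ok; case: b => i /=.
  exists 1, (a + eim i), I; split; first exact: okm_add.
  by move=> v; rewrite (mono_kt HK) // scale1r.
exists (if i \in I then 0 else (-1) ^+ #|I| * (-1) ^+ #|[set k in I | (k < i)%N]|), a, (i |: I).
split=> // v; have := kx_monoE HK I i v ok; rewrite (kx_mono HK) // => /(congr1 (fun w => (-1) ^+ #|I| *: w)).
rewrite scalerA signC scale1r => <-; case: ifP => _; first by rewrite scaler0 scale0r.
by rewrite scalerA.
Qed.

(** A derivation is moved to the left, where it commutes with D; the price is one more monomial. *)
Lemma mono_kdop (a : {ffun 'I_m -> int}) I b : okm laur a ->
  exists (c e : C) (a' : {ffun 'I_m -> int}) (I' : {set 'I_n}), okm laur a' /\
    forall v, mono K a I (kdop K b v) = c *: kdop K b (mono K a I v) + e *: mono K a' I' v.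
Proof.
move=> ok; case: b => i /=.
  have [a0|a0] := eqVneq (a i) 0.
    (* With a_i = 0 there is no lower monomial, and a - e_i might be inadmissible; a itself is a
       placeholder with coefficient 0. *)
    exists 1, 0, a, I; split=> // v.
    by rewrite (kdt_mono HK) // a0 !scale0r !addr0 scale1r.
  exists 1, (- (a i)%:~R), (a - eim i), I; split; first exact: okm_sub.
  by move=> v; rewrite (kdt_mono HK) // scale1r scaleNr addrK.
exists ((-1) ^+ #|I|), (- ((-1) ^+ #|I| * dxi_c R i I)), a, (I :\ i); split=> // v.
by rewrite (kdx_mono HK) // scalerDr !scalerA signC scale1r scaleNr addrK.
Qed.

Lemma pw_mono0 f : pw (mono K 0 set0) f = f.
Proof. by apply: form_ext => J nu; rewrite /pw mono0. Qed.

Lemma okm0 : okm laur (0 : {ffun 'I_m -> int}).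
Proof. by rewrite /okm; apply/orP; right; apply/forallP => i; rewrite ffunE. Qed.

Lemma pw_del (phi : V -> V) p (u : V) : phi 0 = 0 -> pw phi (delp p u) = delp p (phi u).
Proof. by move=> p0; apply: form_ext => J nu; rewrite /pw /del; case: ifP. Qed.

(** The parity twist which an odd move leaves on the P-component of a pure tensor. *)
Definition kpo (o : bool) (u : V) := if o then kpar K u else u.
Lemma kpoK o u : kpo o (kpo o u) = u.
Proof. by case: o => //=; rewrite (kparK HK). Qed.

Lemma iop_del b p : canl lam b p -> exists2 x : C, x != 0 &
  forall u, iop b (delp p u) = x *: delp (subl b p) (kpo (isodd b) u).
Proof.
case: p => J mu; case: b => i /= H.
  exists ((-1) ^+ cntlt i J); first by rewrite signr_eq0.
  move=> u; apply: form_ext => J' mu'; rewrite form_scaleE /= /del.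
  have [->|ne] := eqVneq J' (J :\ i).
    rewrite !inE eqxx /= setD1K // eqxx /= (cntltD1 i H) ltnn.
    by case: ifP => // _; rewrite scaler0.
  rewrite /= scaler0; case: ifP => // iJ'; case: eqVneq => [E|]; last by rewrite scaler0.
  by move: ne; rewrite -E setU1K ?iJ' // eqxx.
exists ((-1) ^+ #|J| * coef lam i (mu i)); first by rewrite mulf_neq0 // signr_eq0.
move=> u; apply: form_ext => J' mu'; rewrite form_scaleE /= /del.
have -> : (mu' == mu - ejn i) = (mu' + ejn i == mu) by rewrite eq_sym subr_eq eq_sym.
case: ifP => [/andP[/eqP -> /eqP E]|]; last by rewrite (lin0 (kpar_lin HK)) !scaler0.
by rewrite -E !ffunE eqxx.
Qed.

Lemma eop_del (c : idx) p : cana lam c p -> exists2 x : C, x != 0 &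
  forall u, eop c (delp p u) = x *: delp (addl c p) (kpo (isodd c) u).
Proof.
case: p => J mu; case: c => i /= H.
  exists ((-1) ^+ cntlt i J); first by rewrite signr_eq0.
  move=> u; apply: form_ext => J' mu'; rewrite form_scaleE /= /del.
  have [->|ne] := eqVneq J' (i |: J).
    rewrite setU11 setU1K // eqxx /= (cntltU1 i H) ltnn.
    by case: ifP => // _; rewrite scaler0.
  rewrite /= scaler0; case: ifP => // iJ'; case: eqVneq => [E|]; last by rewrite scaler0.
  by move: ne; rewrite -E setD1K // eqxx.
exists (- (-1) ^+ #|J|); first by rewrite oppr_eq0 signr_eq0.
move=> u; apply: form_ext => J' mu'; rewrite form_scaleE /= /del.
have -> : (mu' - ejn i == mu) = (mu' == mu + ejn i) by rewrite subr_eq.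
have p0 := lin0 (kpar_lin HK).
case: (boolP ((J' == J) && _)) => [/andP[/eqP -> /eqP ->]|_]; last by rewrite p0 !scaler0 oppr0 if_same.
by rewrite asboolT // scaleNr.
Qed.

(** A basis vector that e_c does not kill can be lowered again by i_c, since lambda'_j + 1 is
    nonzero after a valid raising. Hence a pure tensor that is not obtained by contraction from
    above is killed by every e_c, and so by D. *)
Lemma eop_del0 (c : idx) p u : validw lam p.2 -> ~ (cana lam c p /\ canl lam c (addl c p)) ->
  eop c (delp p u) = 0.
Proof.
case: p => J mu; case: c => i /= Hv H; apply: form_ext => J' mu' /=.
  rewrite setU11 in H; case: ifP => // iJ'; rewrite /del.
  case: eqVneq => [E|]; last by rewrite scaler0.
  by case: H; rewrite -E !inE eqxx.
case: asboolP => // Hv'; rewrite /del subr_eq.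
case: ifP => [/andP[_ /eqP E]|_]; last by rewrite (lin0 (kpar_lin HK)) scaler0 oppr0.
case: H; rewrite -E; split=> //; rewrite E !ffunE eqxx.
apply/(vld_up (Hv i)).
by have := Hv' i; rewrite E /shl !ffunE eqxx.
Qed.

Variable N : form -> Prop.
Hypothesis N0 : N 0.
Hypothesis N_lin : forall c f g, N f -> N g -> N (c *: f + g).
Hypothesis N_par : forall f, N f -> N (Fpar K f).
Hypothesis N_kd : forall b f, N f -> N (pw (kdop K b) f).

Let N_scale c f : N f -> N (c *: f).
Proof. by move=> H; rewrite -[_ *: _]addr0; apply: N_lin. Qed.

(* For a W-submodule N of closed forms, Zs contains N and is stable under K (x) U(gl(m,n)). *)
Definition Zs f := FM lam f /\
  forall a I b, okm laur a -> N (Dop (pw (mono K a I) (iop b f))).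

Hypothesis NZ : forall f, N f -> Zs f.

Let NDop c f : N (Dop f) -> N (Dop (c *: f)).
Proof. by rewrite (linZ (Dop_lin HK lam)); apply: N_scale. Qed.

Lemma Zs_lin c f g : Zs f -> Zs g -> Zs (c *: f + g).
Proof.
move=> [Hf Zf] [Hg Zg]; split; first exact: FM_lin.
move=> a I b ok; rewrite (iop_lin HK) (pw_lin (mono_lin HK I ok)) (Dop_lin HK).
by apply: N_lin; [apply: Zf | apply: Zg].
Qed.

Lemma Zs0 : Zs 0. Proof. exact: NZ. Qed.

Lemma Zs_scale c f : Zs f -> Zs (c *: f).
Proof. by move=> H; rewrite -[_ *: _]addr0; apply: Zs_lin => //; exact: Zs0. Qed.

Lemma Zs_kx (c : idx) f : Zs f -> Zs (pw (kxop K c) f).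
Proof.
move=> [Hf Zf]; split; first exact: FM_pw (kxop_lin HK c) Hf.
move=> a I b ok; rewrite (iop_pw _ _ _ (plin_kx HK c)) (linZ (pw_lin (mono_lin HK I ok))).
apply: NDop; have [e [a' [I' [ok' E]]]] := mono_kxop I c ok.
have -> : pw (mono K a I) (pw (kxop K c) (iop b f)) = e *: pw (mono K a' I') (iop b f).
  by apply: form_ext => J nu; rewrite form_scaleE /pw E.
by apply: NDop; apply: Zf.
Qed.

Lemma Zs_kd (c : idx) f : Zs f -> Zs (pw (kdop K c) f).
Proof.
move=> [Hf Zf]; split; first exact: FM_pw (kdop_lin HK c) Hf.
move=> a I b ok; rewrite (iop_pw _ _ _ (plin_kd HK c)) (linZ (pw_lin (mono_lin HK I ok))).
apply: NDop; have [e [e' [a' [I' [ok' E]]]]] := mono_kdop I c ok.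
have -> : pw (mono K a I) (pw (kdop K c) (iop b f))
   = e *: pw (kdop K c) (pw (mono K a I) (iop b f)) + e' *: pw (mono K a' I') (iop b f).
  by apply: form_ext => J nu; rewrite form_addE !form_scaleE /pw E.
rewrite (Dop_lin HK) (Dop_kd HK); apply: N_lin; first by apply/N_kd/Zf.
by apply: NDop; apply: Zf.
Qed.

Lemma Zs_kti i f : laur -> Zs f -> Zs (pw (kti K i) f).
Proof.
(* The evenness of t_i^{-1} follows from that of t_i by cancellation. *)
move=> l [Hf Zf]; have pk : plin K false (kti K i).
  split=> [|v]; first exact: kti_lin HK i l.
  rewrite expr0 scale1r -[LHS](ktK HK i _ l); congr (kti K i _).
  have := kpar_kx HK (inl i) (kti K i v); rewrite /= expr0 scale1r => <-.
  by rewrite (ktiK HK).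
split; first exact: FM_pw (kti_lin HK i l) Hf.
move=> a I b ok; rewrite (iop_pw _ _ _ pk) (linZ (pw_lin (mono_lin HK I ok))).
apply: NDop.
have -> : pw (mono K a I) (pw (kti K i) (iop b f)) = pw (mono K (a - eim i) I) (iop b f).
  by apply: form_ext => J nu; rewrite /pw (mono_kti HK).
by apply: Zf; rewrite /okm l.
Qed.

Lemma Zs_par f : Zs f -> Zs (Fpar K f).
Proof.
move=> [Hf Zf]; split; first exact: (FM_par HK).
move=> a I b ok; have ml : lin (pw (mono K a I) : form -> form) := pw_lin (mono_lin HK I ok).
have -> : iop b (Fpar K f) = (-1) ^+ isodd b *: Fpar K (iop b f).
  by rewrite (Fpar_iop HK) scalerA signC scale1r.
rewrite (linZ ml); apply: NDop.
have -> : pw (mono K a I) (Fpar K (iop b f)) = (-1) ^+ odd #|I| *: Fpar K (pw (mono K a I) (iop b f)).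
  by rewrite (Fpar_pw _ (plin_mono HK I ok)) scalerA signC scale1r.
by apply: NDop; rewrite -(Fpar_Dop HK); apply/N_par/Zf.
Qed.

(* D (x_c g) - x_c D g = +- e_c g, applied to g = i_b f: both D (x_c g) and D g lie in N. *)
Lemma Zs_ei (c : idx) b f : Zs f -> Zs (eop c (iop b f)).
Proof.
move=> Zf; have [Hf H] := Zf.
have E := Dop_kx HK lam c (iop b f).
have -> : eop c (iop b f) = (-1) ^+ isodd c *: ((-1) *: pw (kxop K c) (Dop (iop b f)) + Dop (pw (kxop K c) (iop b f))) + 0.
  by rewrite E addr0 scaleN1r addrA addNr add0r scalerA signC scale1r.
apply: Zs_lin; last exact: Zs0.
apply: Zs_lin.
  by apply/Zs_kx/NZ; rewrite -[iop b f]pw_mono0; apply: H; exact: okm0.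
apply: NZ; have [e [a' [I' [ok' E']]]] := mono_kxop set0 c okm0.
have -> : pw (kxop K c) (iop b f) = e *: pw (mono K a' I') (iop b f).
  by apply: form_ext => J nu; rewrite form_scaleE /pw -E' mono0.
by apply: NDop; apply: H.
Qed.

(** Up to sign e_c i_c is E_{c,c}, which acts by the weight; so [Zs] is stable under E_{c,c} - x for
    every scalar x. *)
Lemma Zs_wt (c : idx) (x : C) f : Zs f -> Zs (fun J nu => (wt lam c (J, nu) - x) *: f J nu).
Proof.
move=> Zf; have vf := FM_vsupp Zf.1.
have -> : (fun J nu => (wt lam c (J, nu) - x) *: f J nu)
    = (-1) ^+ isodd c *: eop c (iop c f) + (- x) *: f.
  apply: form_ext => J nu; rewrite form_addE !form_scaleE scalerDl; congr (_ + _).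
  case: c => i /=.
    rewrite scale1r; case: ifP => iJ; last by rewrite scale0r.
    by rewrite !inE eqxx /= setD1K // scale1r (cntltD1 i iJ) ltnn scalerA signC scale1r.
  case: asboolP => Hn; last by rewrite vf // !scaler0.
  rewrite subrK (linZ (kpar_lin HK)) (kparK HK) scalerN scaleN1r opprK !scalerA mulrA signC mul1r.
  by rewrite !ffunE eqxx subrK.
by apply: Zs_lin; [exact: Zs_ei | exact: Zs_scale].
Qed.

(* The weights of gl(m,n) separate the basis of M(lambda). *)
Lemma Zs_component f p : Zs f -> f p.1 p.2 <> 0 -> exists2 u, u <> 0 & Zs (delp p u).
Proof.
move=> Zf fp; have [[[s Hs] _] _] := Zf.
have {}Hs q : f q.1 q.2 <> 0 -> q \in p :: s.
  by case: q => J mu /Hs; rewrite inE => ->; rewrite orbT.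
elim: s f Zf fp Hs => [|q s IH] f Zf fp Hs.
  exists (f p.1 p.2) => //; suff -> : delp p (f p.1 p.2) = f by [].
  apply: form_ext => J nu; rewrite /del; case: ifP => [/andP[/eqP -> /eqP ->] //|E].
  apply/esym; apply: contrapT => f0; have := Hs (J, nu) f0; rewrite inE => /eqP Ep.
  by move: E; rewrite -Ep /= !eqxx.
have [qp|qp] := eqVneq p q.
  apply: (IH f) => // q' /Hs; rewrite !inE -qp orbA orbb.
  by [].
(* Subtracting the weight of q kills the component at q and multiplies the one at p by a nonzero
   scalar. *)
have [c Hc] := wt_sep lam qp.
apply: (IH _ (Zs_wt c (wt lam c q) Zf)).
  by case: (p) Hc fp => J mu Hc fp /= /eqP; rewrite scaler_eq0 subr_eq0 (negbTE Hc) /= => /eqP.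
move=> q' /= H; have := Hs q'; rewrite !inE.
have fq : f q'.1 q'.2 <> 0 by move=> f0; apply: H; rewrite f0 scaler0.
move=> /(_ fq); case: (eqVneq q' q) => [E|_]; last by rewrite orbF || rewrite orFb.
by case: H; rewrite E -surjective_pairing subrr scale0r.
Qed.

Definition full p := forall u, Zs (delp p u).

(** The vectors whose pure tensor at p lies in [Zs] form a graded K-submodule of P; here the
    simplicity of P enters. *)
Lemma Zs_full p u : u <> 0 -> Zs (delp p u) -> full p.
Proof.
move=> u0 Zu; have [_ /(_ (fun u => Zs (delp p u)))] := HP.
have dl : lin (delp p : V -> form) := del_lin p.1 p.2.
have pwd phi w : lin phi -> Zs (pw phi (delp p w)) -> Zs (delp p (phi w)).
  by move=> pl; rewrite pw_del // (lin0 pl).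
case=> //; last by move=> H; case: u0; apply: H.
split.
- by rewrite (lin0 dl); exact: Zs0.
- by move=> v w Hv Hw; rewrite (linD dl) -[delp p v]scale1r; apply: Zs_lin.
- by move=> c v Hv; rewrite (linZ dl); apply: Zs_scale.
- move=> v /Zs_par; have -> : Fpar K (delp p v) = sgnz R (\sum_j p.2 j) *: delp p (kpar K v).
    apply: form_ext => J mu; rewrite FparE form_scaleE /del; case: ifP => [/andP[_ /eqP ->]//|_].
    by rewrite (lin0 (kpar_lin HK)) !scaler0.
  by move/(Zs_scale (sgnz R (\sum_j p.2 j))); rewrite scalerA signC scale1r.
split.
- move=> i v Hv; split; apply: pwd; first exact: kt_lin HK i.
  + exact: (Zs_kx (inl i) Hv).
  + exact: kdt_lin HK i.
  + exact: (Zs_kd (inl i) Hv).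
- by move=> l i v Hv; apply: pwd; [exact: kti_lin HK i l | exact: Zs_kti].
- move=> i v Hv; split; apply: pwd; first exact: kx_lin HK i.
  + exact: (Zs_kx (inr i) Hv).
  + exact: kdx_lin HK i.
  + exact: (Zs_kd (inr i) Hv).
Qed.

Lemma full_move b (c : idx) p : full p -> canl lam b p -> cana lam c (subl b p) ->
  full (addl c (subl b p)).
Proof.
move=> Fp Hb Hc u; have [x x0 Ex] := iop_del Hb; have [y y0 Ey] := eop_del Hc.
(* The vector is twisted beforehand so that the parity twists of the two moves cancel. *)
have := Zs_ei c b (Fp (kpo (isodd b) (kpo (isodd c) u))).
rewrite Ex kpoK (linZ (eop_lin HK lam c)) Ey kpoK => /(Zs_scale (x * y)^-1).
by rewrite !scalerA -mulrA mulVf ?mulf_neq0 // scale1r.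
Qed.

Lemma full_connected p q : full p -> validw lam p.2 -> validw lam q.2 -> degl p = degl q -> full q.
Proof.
move=> Fp Hp Hq; move e : (exl p q) => k; elim: k p Fp Hp e => [|k IH] p Fp Hp e E.
  by rewrite -(@exl_eq0 _ _ p q e) // -(exl_deg E).
have [b Hb] : exists b, excess b p q by apply: exl_gt0; rewrite e.
have [c Hc] : exists c, excess c q p by apply: exl_gt0; rewrite -(exl_deg E) e.
have Hc' := excess_subl Hb Hc.
have [cb vb] := validw_subl Hp Hq Hb.
have [cc vc] := validw_addl vb Hq Hc'.
apply: (IH (addl c (subl b p))) => //; first exact: full_move.
  by rewrite (exl_addl Hc'); apply/eqP; rewrite -eqSS (exl_subl Hb) e.
by rewrite (degl_move Hb Hc).
Qed.

Lemma core k w : Zs w -> Fk lam k w -> w <> 0 ->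
  forall g, Fk lam (k - 1) g -> N (Dop g).
Proof.
move=> Zw [[_ wv] wd] w0.
have [p fp] : exists p : lbl, w p.1 p.2 <> 0.
  by apply: contrapT => H; apply: w0; apply: form_ext => J mu; apply: contrapT => f0;
     apply: H; exists (J, mu).
have [u u0 Zu] := Zs_component Zw fp.
have Fp := Zs_full u0 Zu; have vp := wv _ _ fp; have dp := wd _ _ fp.
have FA q : validw lam q.2 -> degl q = k -> full q.
  by move=> vq dq; apply: (full_connected Fp vp vq); rewrite dq.
have Dl := Dop_lin HK lam.
apply: Fk_ind => [|f g Hf Hg|J mu v vm dm]; first by rewrite (lin0 Dl).
  by rewrite (linD Dl) -[Dop f]scale1r; apply: N_lin.
(* Either some e_c raises the label to one of degree k, and the pure tensor is a multiple of i_c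
   applied to an element of [Zs], or all e_c kill it and D does too. *)
case: (pselect (exists c, cana lam c (J, mu) /\ canl lam c (addl c (J, mu)))) => [[c [Ha Hl]]|H].
  have va : validw lam (addl c (J, mu)).2 by case: c Ha {Hl}.
  have da : degl (addl c (J, mu)) = k by rewrite (degl_addl Ha) /degl dm subrK.
  have [x x0 Ex] := iop_del Hl.
  have [_ /(_ 0 set0 c okm0)] := FA _ va da (kpo (isodd c) v).
  rewrite pw_mono0 Ex kpoK (sublK Ha) => /(NDop x^-1).
  by rewrite scalerA mulVf // scale1r.
rewrite Dop_sum big1 // => c _; rewrite (@eop_del0 c (J, mu)) //.
  exact: lin0 (pw_lin (kdop_lin HK c)).
by move=> Hc; apply: H; exists c.
Qed.

End Core.

(** * Closed and exact forms *)

Section Main.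
Variables (R : realType) (m n : nat) (laur : bool) (V : lmodType R[i]) (K : Kops m n V).
Hypothesis HK : is_Kmodule laur K.
Hypothesis HP : Ksimple laur K.
Variable lam : 'I_n -> R[i].
Local Notation C := (R[i]).
Local Notation idx := ('I_m + 'I_n)%type.
Local Notation lbl := ({set 'I_m} * {ffun 'I_n -> int})%type.
Local Notation form := ({set 'I_m} -> {ffun 'I_n -> int} -> V).
Local Notation eop := (eop K lam).
Local Notation iop := (iop K lam).
Local Notation Dop := (Dop K lam).
Local Notation Fk := (Fk lam).
Local Notation adm := (@Wadm m n laur).
Local Notation Fpi := (Fpi K lam).
Implicit Types (f g : form) (J : {set 'I_m}) (mu nu : {ffun 'I_n -> int}) (p q : lbl) (b : idx).

Lemma XgenP (x : Wgen m n) : exists a I b, x = Xgen a I b.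
Proof. by case: x => a I i; [exists a, I, (inl i) | exists a, I, (inr i)]. Qed.

Lemma Wadm_Xgen a I b : adm (Xgen a I b) = okm laur a.
Proof. by case: b. Qed.

Lemma Fpi_closed a I b f : FM lam f -> Dop f = 0 -> okm laur a ->
  Fpi (Xgen a I b) f = Dop (pw (mono K a I) (iop b f)).
Proof.
move=> Hf Df ok; rewrite (Fpi_Cartan HK) ?Df //; last exact: FM_vsupp.
by rewrite (lin0 (iop_lin HK lam b)) (lin0 (pw_lin (mono_lin HK I ok))) addr0.
Qed.

(** Constant fields act on the coefficients alone; this makes W-submodules stable under the
    derivations of K. *)
Lemma Fpi_kd b f : FM lam f -> Fpi (Xgen 0 set0 b) f = pw (kdop K b) f.
Proof.
move=> Hf; rewrite (Fpi_Cartan HK) ?okm0 //; last exact: FM_vsupp.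
by rewrite !pw_mono0 (Cartan_kd HK) //; exact: FM_vsupp.
Qed.

Lemma Fk_contr k a I b f : okm laur a -> Fk k f -> Fk (k - 1) (pw (mono K a I) (iop b f)).
Proof. by move=> ok Hf; apply: Fk_pw (mono_lin HK I ok) _; apply: (Fk_iop HK). Qed.

Lemma Fk_Fpi k a I b f : okm laur a -> Fk k f -> Fk k (Fpi (Xgen a I b) f).
Proof.
move=> ok Hf; rewrite (Fpi_Cartan HK) //; last by apply: FM_vsupp; apply Hf.
rewrite -[Dop _]scale1r; apply: Fk_lin.
  by rewrite -{1}(subrK 1 k); apply: (Fk_Dop HK); apply: Fk_contr.
by rewrite -{1}(addrK 1 k); apply: Fk_contr => //; apply: (Fk_Dop HK).
Qed.

Definition cut k f : form :=
  fun J mu => if #|J|%:Z + \sum_(j < n) mu j == k then f J mu else 0.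

Lemma Fk_cut k f : FM lam f -> Fk k (cut k f).
Proof.
move=> [[s Hs] Hv]; split; [split|].
- by exists s => J mu; rewrite /cut; case: ifP => // _; exact: Hs.
- by move=> J mu; rewrite /cut; case: ifP => // _; exact: Hv.
- by move=> J mu; rewrite /cut; case: eqVneq.
Qed.

Lemma cut_id k f : hasdeg k f -> cut k f = f.
Proof.
move=> Hd; apply: form_ext => J mu; rewrite /cut; case: eqVneq => // /eqP ne.
by rewrite (hasdegN Hd).
Qed.

Lemma eop_cut k b f : eop b (cut k f) = cut (k + 1) (eop b f).
Proof.
apply: form_ext => J mu; rewrite /cut; case: b => s /=; case: ifP => // sJ; rewrite ?if_same //.
  have -> : (#|J|%:Z + \sum_(j < n) mu j == k + 1) = (#|J :\ s|%:Z + \sum_(j < n) mu j == k).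
    by rewrite (cardsD1 s J) sJ PoszD -addrA addrC (inj_eq (addIr _)).
  by case: ifP => _; rewrite ?scaler0.
have -> : (#|J|%:Z + \sum_(j < n) mu j == k + 1) = (#|J|%:Z + \sum_(j < n) (mu - ejn s) j == k).
  by rewrite sum_subejn addrA subr_eq.
by case: ifP => _; rewrite ?(lin0 (kpar_lin HK)) ?scaler0 ?oppr0.
Qed.

Lemma Dop_cut k f : Dop (cut k f) = cut (k + 1) (Dop f).
Proof.
apply: form_ext => J mu; rewrite /cut !Dop_sum !form_sumE.
case: ifP => E.
  by apply: eq_bigr => b _; rewrite eop_cut /pw /cut E.
by rewrite big1 // => b _; rewrite eop_cut /pw /cut E (lin0 (kdop_lin HK b)).
Qed.

(** [Fr] admits potentials with components in all degrees; as D raises degrees by one, the component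
    of degree r - 1 is a potential too. *)
Lemma FrP r f : Fr K r lam f <-> exists2 g, Fk (r%:Z - 1) g & Dop g = f.
Proof.
split=> [[[g [Hg E]] [Hf Hd]]|[g Hg <-]]; last first.
  split; last by have := Fk_Dop HK Hg; rewrite subrK.
  by exists g; split; [apply Hg | apply/(Fsigma_Dop HK)/FM_vsupp; apply Hg].
exists (cut (r%:Z - 1) g); first exact: Fk_cut.
by rewrite Dop_cut subrK -(Fsigma_Dop HK) ?E ?cut_id //; exact: FM_vsupp.
Qed.

(* If D f <> 0, the simplicity argument with N = 0 shows that D vanishes in the degree of f. *)
Lemma closed_of_trivial k f : Fk k f ->
  (forall a I b, okm laur a -> exists2 g, FM lam g & Dop g = Fpi (Xgen a I b) f) ->
  Dop f = 0.
Proof.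
move=> Hf H; apply: contrapT => w0; apply: (w0).
have Dl := Dop_lin HK lam.
have Hw := Fk_Dop HK Hf.
apply: (@core _ _ _ _ _ _ HK HP lam (fun g => g = 0) erefl _ _ _ _ (k + 1) (Dop f)) => //; last 1 first.
- by rewrite addrK.
- by move=> c g h -> ->; rewrite scaler0 addr0.
- by move=> g ->; rewrite (lin0 (Fpar_lin HK)).
- by move=> b g ->; rewrite (lin0 (pw_lin (kdop_lin HK b))).
- move=> g ->; split; first exact: FM0.
  move=> a I b ok; rewrite (lin0 (iop_lin HK lam b)) (lin0 (pw_lin (mono_lin HK I ok))).
  exact: lin0.
- split; first by apply Hw.
  move=> a I b ok; have [g Hg E] := H a I b ok.
  have vf : vsupp lam f by apply: FM_vsupp; apply Hf.
  have Hc := Fk_contr I b ok Hf.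
  (* Applying D to Cartan's formula gives D L_X f = D x i_b D f. The left side is 0 because L_X f is
     exact, so D f satisfies the condition of [Zs] for N = 0. *)
  have := congr1 Dop E; rewrite (Dop_Dop HK (FM_vsupp Hg)) (Fpi_Cartan HK) // (linD Dl).
  rewrite (Dop_Dop HK) ?add0r //; last by apply: FM_vsupp; apply Hc.
Qed.

Lemma FtilP r f : Ftil laur K r lam f <-> FL r lam f /\ Dop f = 0.
Proof.
split=> [[Hf H]|[Hf Df]]; split=> //.
  apply: (closed_of_trivial Hf) => a I b ok.
  have /FrP[g Hg E] : Fr K r lam (Fpi (Xgen a I b) f) by apply: H; rewrite Wadm_Xgen.
  by exists g => //; apply Hg.
move=> x; have [a [I [b ->]]] := XgenP x; rewrite Wadm_Xgen => ok; apply/FrP.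
exists (pw (mono K a I) (iop b f)); first exact: Fk_contr.
by rewrite Fpi_closed //; apply Hf.
Qed.

Section Submodule.
Variables D S : form -> Prop.
Hypothesis HS : Wsubmod adm (Fpar K) Fpi D S.

Lemma Wsubmod_sub f : S f -> D f. Proof. by case: HS => [[H _ _ _] _ _]; exact: H. Qed.
Lemma Wsubmod0 : S 0. Proof. by case: HS => [[_ H _ _] _ _]. Qed.
Lemma Wsubmod_lin c f g : S f -> S g -> S (c *: f + g).
Proof. by case: HS => [[_ _ Ha Hs] _ _] Hf Hg; apply: (Ha _ _ (Hs c _ Hf) Hg). Qed.
Lemma Wsubmod_par f : S f -> S (Fpar K f).
Proof. by case: HS => _ H _; exact: H. Qed.
Lemma Wsubmod_act a I b f : okm laur a -> S f -> S (Fpi (Xgen a I b) f).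
Proof. by case: HS => _ _ H ok; apply: H; rewrite Wadm_Xgen. Qed.
End Submodule.

Lemma Fr_submod r : Wsubmod adm (Fpar K) Fpi (FL r lam) (Fr K r lam).
Proof.
split; [split|..].
- by move=> f [].
- by apply/FrP; exists 0; [exact: Fk0 | exact: lin0 (Dop_lin HK lam)].
- move=> f g /FrP[f' Hf <-] /FrP[g' Hg <-]; apply/FrP; exists (1 *: f' + g'); first exact: Fk_lin.
  by rewrite (Dop_lin HK) scale1r.
- move=> c f /FrP[f' Hf <-]; apply/FrP; exists (c *: f' + 0); first by apply: Fk_lin => //; exact: Fk0.
  by rewrite addr0 (linZ (Dop_lin HK lam)).
- move=> f /FrP[f' Hf <-]; apply/FrP; exists (Fpar K f'); first exact: (Fk_par HK).
  by rewrite (Fpar_Dop HK).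
- move=> x f; have [a [I [b ->]]] := XgenP x; rewrite Wadm_Xgen => ok /FrP[f' Hf <-]; apply/FrP.
  exists (pw (mono K a I) (iop b (Dop f'))).
    by apply: Fk_contr => //; have := Fk_Dop HK Hf; rewrite subrK.
  rewrite Fpi_closed ?(Dop_Dop HK) //; first by apply: (FM_Dop HK); apply Hf.
  by apply: FM_vsupp; apply Hf.
Qed.

Lemma eop_del_out b c p (u : V) : b != c -> cana lam c p ->
  eop b (del p.1 p.2 u) (addl c p).1 (addl c p).2 = 0.
Proof.
case: p => J mu bc; have E1 (s i : 'I_m) : s \notin J -> i != s -> ((s |: J) :\ i == J) = false.
  move=> sJ si; apply/negP => /eqP E; move: sJ; rewrite -E !inE eqxx andbT eq_sym si //.
have E2 (i : 'I_m) : i \in J -> (J :\ i == J) = false.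
  by move=> iJ; apply/negP => /eqP E; move: iJ; rewrite -E !inE eqxx.
have E3 (s : 'I_m) : s \notin J -> (s |: J == J) = false.
  by move=> sJ; apply/negP => /eqP E; move: sJ; rewrite -E setU11.
have p0 := lin0 (kpar_lin HK).
case: b c bc => i [s|l] /= bc H; rewrite /del /=; case: ifP => // Hi.
- by rewrite E1 // scaler0.
- by rewrite E2 // scaler0.
- by rewrite E3 // p0 scaler0 oppr0.
- rewrite eqxx /= subr_eq (inj_eq (addrI mu)); case: eqVneq => [/ffunP/(_ l)|_].
    have [E|li] := eqVneq l i; first by move: bc; rewrite E eqxx.
    by rewrite ejn_self ejn_neq // => /eqP; rewrite oner_eq0.
  by rewrite p0 scaler0 oppr0.
Qed.

(** From the label p only e_c reaches [addl c p], so this coefficient of D is d_c u up to a nonzero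
    scalar and a parity twist; it detects forms that are not closed. *)
Lemma Dop_del_addl c p : cana lam c p -> exists2 x : C, x != 0 &
  forall u, Dop (del p.1 p.2 u) (addl c p).1 (addl c p).2 = x *: kdop K c (kpo K (isodd c) u).
Proof.
move=> Hc; have [x x0 Ex] := eop_del HK Hc; exists x => // u.
rewrite Dop_sum form_sumE (bigD1 c) //= big1 ?addr0 => [|b bc].
  by rewrite Ex /pw form_scaleE del_self (linZ (kdop_lin HK c)).
by rewrite /pw eop_del_out // (lin0 (kdop_lin HK b)).
Qed.

Lemma Dop_neq0 c p : cana lam c p -> exists u, Dop (del p.1 p.2 u) <> 0.
Proof.
move=> Hc; have [u0 Hu0] : exists u, kdop K c u <> 0.
  (* No derivation is 0 on P: if d_c v = 0 then d_c (x_c v) = v. *)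
  have [[v v0] _] := HP; have [dv|//] := pselect (kdop K c v = 0); last by exists v.
  exists (kxop K c v); rewrite (kd_kx HK) dv (lin0 (kxop_lin HK c)) scaler0 add0r eqxx scale1r.
  by [].
have [x x0 Ex] := Dop_del_addl Hc.
exists (kpo K (isodd c) u0) => /(congr1 (fun f : form => f (addl c p).1 (addl c p).2)).
by rewrite Ex (kpoK HK) => /eqP; rewrite scaler_eq0 (negbTE x0) /= => /eqP.
Qed.

Lemma card_setex r : (r <= m)%N -> exists J, #|J| = r.
Proof.
move=> rm; exists [set x in take r (enum 'I_m)]; rewrite cardsE.
by rewrite (card_uniqP _) ?take_uniq ?enum_uniq // size_takel // size_enum_ord.
Qed.

Lemma validw0 : validw lam 0.
Proof. by apply/validwE => j; rewrite ffunE; exact: vld0. Qed.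

Lemma sum_ffun0 : \sum_(j < n) (0 : {ffun 'I_n -> int}) j = 0.
Proof. by rewrite big1 // => j _; rewrite ffunE. Qed.

Lemma cana_inr j mu : validw lam mu -> coef lam j (mu j + 1) != 0 -> validw lam (mu + ejn j).
Proof.
move=> Hv c0; apply: (validw_shift (j := j) (k := mu j + 1)).
- exact/(vld_up (Hv j)).
- by move=> l lj; have := (validwE _ _).1 Hv l; rewrite !ffunE (negbTE lj) addr0.
- by rewrite !ffunE eqxx.
Qed.

Lemma notin_ex (J : {set 'I_m}) : (#|J| < m)%N -> exists s, s \notin J.
Proof.
move=> H; apply: contrapT => N; move: H; have -> : J = setT.
  by apply/setP => s; rewrite inE; apply/negPn/negP => sJ; apply: N; exists s.
by rewrite cardsT card_ord ltnn.
Qed.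

(** A label that can be raised carries a form that is not closed. For r < m a factor e_s is free;
    for r = m a coordinate lambda_j <> -1 can be increased without meeting the edge. *)
Lemma FL_not_closed r : (r <= m)%N -> (r <> m \/ ~ (forall j, lam j = -1)) ->
  exists f, FL r lam f /\ Dop f <> 0.
Proof.
move=> rm H; have [J cJ] := card_setex rm.
suff [c Hc] : exists c : idx, cana lam c (J, 0).
  have [u Hu] := Dop_neq0 Hc; exists (del J 0 u); split=> //.
  by have := Fk_del J u validw0; rewrite cJ sum_ffun0 addr0.
have [rm'|rm'] := eqVneq r m.
  case: H => // /existsNP[j Hj]; exists (inr j); apply: cana_inr validw0 _.
  by rewrite /coef ffunE add0r; apply/eqP => E; apply: Hj; apply/eqP; rewrite -addr_eq0; apply/eqP.
have [s sJ] : exists s, s \notin J by apply: notin_ex; rewrite cJ ltn_neqAle rm' rm.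
by exists (inl s).
Qed.

(** Nonzero exact forms come from a label of degree r - 1 that can be raised: r - 1 of the e_s if r
    > 0, and for r = 0 a coordinate lambda_j <> 0 lowered by one. *)
Lemma Fr_neq0 r : (r <= m)%N -> (r <> 0%N \/ ~ (forall j, lam j = 0)) ->
  exists f, Fr K r lam f /\ f <> 0.
Proof.
move=> rm H.
suff [p [c [vp dp Hc]]] : exists p (c : idx), [/\ validw lam p.2, degl p = r%:Z - 1 & cana lam c p].
  have [u Hu] := Dop_neq0 Hc; exists (Dop (del p.1 p.2 u)); split=> //; apply/FrP.
  by exists (del p.1 p.2 u) => //; have := Fk_del p.1 u vp; rewrite -dp.
case: r rm H => [|r] rm H; last first.
  have [J cJ] := card_setex (ltnW rm).
  have [s sJ] : exists s, s \notin J by apply: notin_ex; rewrite cJ.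
  exists (J, 0), (inl s); split=> //; first exact: validw0.
  by rewrite /degl /= sum_ffun0 cJ addr0 intS addrC addKr.
case: H => // /existsNP[j Hj].
exists (set0, - ejn j), (inr j); split=> //=.
- apply: (validw_shift (j := j) (k := 0 - 1)).
  + by apply/(vld_down (vld0 lam j)); rewrite /coef addr0; apply/eqP.
  + by move=> l lj; rewrite !ffunE (negbTE lj) oppr0; exact: vld0.
  + by rewrite !ffunE eqxx.
- rewrite /degl /= cards0 add0r.
  transitivity (\sum_(l < n) ((0 : {ffun 'I_n -> int}) - ejn j) l); last by rewrite sum_subejn sum_ffun0.
  by apply: eq_bigr => l _; rewrite add0r.
- by rewrite addNr; exact: validw0.
Qed.

Lemma quotient_simple r : (r <= m)%N -> (r <> m \/ ~ (forall j, lam j = -1)) ->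
  Wsimple_quot adm (Fpar K) Fpi (FL r lam) (Ftil laur K r lam).
Proof.
move=> rm H; split.
  have [f [Hf Df]] := FL_not_closed rm H; exists f; split=> // /FtilP[_ Df0].
  exact: Df.
move=> S HS tS; have Dl := Dop_lin HK lam.
case: (pselect (forall f, S f -> Dop f = 0)) => [all0|/existsNP[s /not_implyP[Ss Ds]]].
  by left => f Sf; apply/FtilP; split; [exact: (Wsubmod_sub HS) | exact: all0].
(* N is the image D(S). It suffices to find f in S with D f = D g, since g - f is then closed and S
   contains [Ftil]. *)
right => g Hg; pose N h := exists2 f, S f & Dop f = h.
have SF f : S f -> Fk r%:Z f by move=> Sf; exact: (Wsubmod_sub HS Sf).
have [f Sf Ef] : N (Dop g).
  apply: (@core _ _ _ _ _ _ HK HP lam N _ _ _ _ _ (r%:Z + 1) (Dop s)) => //; last 1 first.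
  - by rewrite addrK.
  - by exists 0; [exact: (Wsubmod0 HS) | exact: lin0].
  - move=> c _ _ [f Sf <-] [h Sh <-]; exists (c *: f + h); first exact: (Wsubmod_lin HS).
    exact: Dl.
  - move=> _ [f Sf <-]; exists (Fpar K f); first exact: (Wsubmod_par HS).
    by rewrite (Fpar_Dop HK).
  - move=> b _ [f Sf <-]; exists (pw (kdop K b) f); last by rewrite (Dop_kd HK).
    rewrite -Fpi_kd; last by apply SF.
    by apply: (Wsubmod_act HS); first exact: okm0.
  - move=> _ [f Sf <-]; split; first by apply: (FM_Dop HK); apply SF.
    move=> a I b ok; exists (Fpi (Xgen a I b) f); first exact: (Wsubmod_act HS).
    have vf : vsupp lam f by apply: FM_vsupp; apply SF.
    have Hc := Fk_contr I b ok (SF _ Sf).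
    rewrite (Fpi_Cartan HK) // (linD Dl) (Dop_Dop HK) ?add0r //.
    by apply: FM_vsupp; apply Hc.
  - split; first by apply: (FM_Dop HK); apply SF.
    move=> a I b ok; exists (Fpi (Xgen a I b) s); first exact: (Wsubmod_act HS).
    have vf : vsupp lam s by apply: FM_vsupp; apply SF.
    have Hc := Fk_contr I b ok (SF _ Ss).
    rewrite (Fpi_Cartan HK) // (linD Dl) (Dop_Dop HK) ?add0r //.
    by apply: FM_vsupp; apply Hc.
  - by apply: (Fk_Dop HK); apply: SF.
rewrite -(subrK f g) -[g - f]scale1r; apply: (Wsubmod_lin HS) => //.
apply: tS; apply/FtilP; split.
  rewrite addrC -scaleN1r; apply: (@Fk_lin _ _ _ _ lam) => //; exact: SF.
by rewrite (linD Dl) (linN Dl) Ef subrr.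
Qed.

Lemma Fr_simple r : (r <= m)%N -> (r <> 0%N \/ ~ (forall j, lam j = 0)) ->
  Wsimple adm (Fpar K) Fpi (Fr K r lam).
Proof.
move=> rm H; split; first exact: Fr_neq0.
move=> S HS; case: (pselect (forall f, S f -> f = 0)) => [|/existsNP[s /not_implyP[Ss s0]]].
  by left.
right => _ /FrP[g Hg <-].
have SF f : S f -> exists2 g, Fk (r%:Z - 1) g & Dop g = f.
  by move=> Sf; apply/FrP; exact: (Wsubmod_sub HS Sf).
have SFk f : S f -> Fk r f by move=> /SF[h Hh <-]; have := Fk_Dop HK Hh; rewrite subrK.
have SD f : S f -> Dop f = 0.
  by move=> /SF[h Hh <-]; rewrite (Dop_Dop HK) //; apply: FM_vsupp; apply Hh.
have SZ f : S f -> Zs laur K lam S f.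
  move=> Sf; split; first by apply SFk.
  move=> a I b ok; rewrite -Fpi_closed //; [exact: (Wsubmod_act HS) | by apply SFk | exact: SD].
apply: (@core _ _ _ _ _ _ HK HP lam S _ _ _ _ _ r s) => //.
- exact: (Wsubmod0 HS).
- by move=> c f h; exact: (Wsubmod_lin HS).
- by move=> f; exact: (Wsubmod_par HS).
- move=> b f Sf; rewrite -Fpi_kd; last by apply SFk.
  by apply: (Wsubmod_act HS); first exact: okm0.
- exact: SZ.
- exact: SFk.
Qed.

(** * The exceptional case r = m and lambda = (-1, ..., -1) *)

Section Top.
Hypothesis lam_top : forall j, lam j = -1.

Lemma validw_top mu j : validw lam mu -> mu j <= 0.
Proof.
move=> Hv; have Hj := (validwE _ _).1 Hv j; move: Hj.
case: (vldP lam j) => [[H _]|[z [E H]]]; first by case: H; exists (-1); rewrite lam_top.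
have z1 : z = -1.
  by apply/eqP; rewrite -(eqr_int C) -E lam_top.
by move/H; rewrite z1; lia.
Qed.

(** No coordinate of a weight exceeds -1, so m is the greatest degree and is attained only by the
    top form: the module is P placed at one label. *)
Lemma top_lbl J mu : validw lam mu -> (#|J|%:Z + \sum_(j < n) mu j)%R = m%:Z -> J = setT /\ mu = 0.
Proof.
move=> Hv E; have cJ : (#|J| <= m)%N by have := max_card (mem J); rewrite card_ord.
have S0 : \sum_(j < n) mu j <= 0.
  by apply: sumr_le0 => j _; exact: validw_top.
have E0 : \sum_(j < n) mu j = 0 by move: E S0 cJ; move: (\sum_(j < n) mu j) => x; lia.
split.
  apply/eqP; rewrite eqEcard subsetT cardsT card_ord.
  by move: E; rewrite E0 addr0 => -[->]; rewrite leqnn.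
apply/ffunP => j; rewrite ffunE; apply/eqP.
have : \sum_(j < n) (- mu j) == 0 by rewrite sumrN E0 oppr0.
rewrite psumr_eq0 => [/allP/(_ j)|l _]; last by rewrite oppr_ge0 validw_top.
by rewrite mem_index_enum oppr_eq0 => /(_ isT).
Qed.

Lemma FL_topE f : FL m lam f -> f = del setT 0 (f setT 0).
Proof.
move=> [[_ Hv] Hd]; apply: form_ext => J mu; rewrite /del.
case: ifP => [/andP[/eqP -> /eqP ->] //|E]; apply: contrapT => f0.
by have [E1 E2] := top_lbl (Hv _ _ f0) (Hd _ _ f0); move: E; rewrite E1 E2 !eqxx.
Qed.

Lemma FL_top_del u : FL m lam (del setT 0 u : form).
Proof.
by have := Fk_del (setT : {set 'I_m}) u validw0; rewrite cardsT card_ord sum_ffun0 addr0.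
Qed.

Lemma FL_top_closed f : FL m lam f -> Dop f = 0.
Proof.
move=> Hf; have [_ Hd] : Fk (m%:Z + 1) (Dop f) by apply: (Fk_Dop HK).
have /FM_vsupp Hv := FM_Dop HK Hf.1.
apply: form_ext => J mu; apply: contrapT => f0.
have vm : validw lam mu by apply: contrapT => /Hv.
have := Hd _ _ f0; have cJ : (#|J| <= m)%N by have := max_card (mem J); rewrite card_ord.
have S0 : \sum_(j < n) mu j <= 0.
  by apply: sumr_le0 => j _; exact: validw_top.
by move: S0 cJ; move: (\sum_(j < n) mu j) => x; lia.
Qed.

Lemma top_trivial : Wtrivial_quot adm Fpi (FL m lam) (Fr K m lam).
Proof.
move=> x f Hx Hf; have /FtilP[_] : FL m lam f /\ Dop f = 0 by split=> //; exact: FL_top_closed.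
exact.
Qed.

Lemma top_simple : (0 < m + n)%N ->
  Wsimple adm (Fpar K) Fpi (FL m lam) <-> Pspan K.
Proof.
(* If m = 0 then n > 0, and (-1, ..., -1) is not 0; so the results on [Fr] apply. *)
move=> mn; have H : m <> 0%N \/ ~ (forall j, lam j = 0).
  case: (m) mn => [|k] mn; last by left.
  right => H; have := H (Ordinal mn); rewrite lam_top => /eqP.
  by rewrite oppr_eq0 oner_eq0.
split=> [[_ /(_ _ (Fr_submod m))]|PS].
  case=> [all0|sub] v.
    by have [f [Ff f0]] := Fr_neq0 (leqnn m) H; case: f0; exact: all0.
  have /FrP[g Hg E] := sub _ (FL_top_del v).
  (* At the top label D g is a sum of derivatives, whose arguments are the coefficients of the e_a g
     there. *)
  exists (fun s => eop (inl s) g setT 0), (fun l => eop (inr l) g setT 0).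
  have := congr1 (fun f : form => f setT 0) E; rewrite del_self => <-.
  by rewrite DopE form_addE !form_sumE.
have -> : FL m lam = Fr K m lam.
  apply/funext => f; apply/propext; split=> [Hf|[]] //.
  have [u [w E]] := PS (f setT 0).
  (* Cartan's formula for a closed top form w gives D i_b w = d_b w, so derivatives are exact. *)
  have kd b v : del setT 0 (kdop K b v) = Dop (iop b (del setT 0 v)).
    rewrite -(@pw_del _ _ _ _ (kdop K b) (setT, 0) v) ?(lin0 (kdop_lin HK b)) //=.
    rewrite -(Cartan_kd HK (lam := lam)); last by apply: FM_vsupp; apply (FL_top_del v).
    by rewrite (FL_top_closed (FL_top_del v)) (lin0 (iop_lin HK lam b)) addr0.
  apply/FrP; exists (\sum_(b : idx) iop b (del setT 0 (match b with inl s => u s | inr l => w l end))).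
    apply: (big_ind (Fk (m%:Z - 1))) => [|f1 f2 H1 H2|b _]; first exact: Fk0.
      by rewrite -[f1]scale1r; apply: Fk_lin.
    by apply: (Fk_iop HK); exact: FL_top_del.
  rewrite (lin_sum (Dop_lin HK lam)) [RHS](FL_topE Hf) E big_sumType /=.
  have dl : lin (del setT 0 : V -> form) := del_lin setT 0.
  rewrite (linD dl) !(lin_sum dl); congr (_ + _); apply: eq_bigr => s _.
    by rewrite -(kd (inl s)).
  by rewrite -(kd (inr s)).
exact: Fr_simple.
Qed.

End Top.
End Main.

(** * The natural module and its quotient by the constants *)

Section NaturalModule.
Variables (R : realType) (m n : nat) (laur : bool).
Local Notation C := (R[i]).
Local Notation poly := ({ffun 'I_m -> int} -> {set 'I_n} -> C).
Local Notation lbl := ({ffun 'I_m -> int} * {set 'I_n})%type.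
Implicit Types (a : poly) (b : {ffun 'I_m -> int}) (J : {set 'I_n}) (p q : lbl).

Definition dA b J : poly := fun b' J' => ((b' == b) && (J' == J))%:R.

Lemma poly_ext (a a' : poly) : (forall b J, a b J = a' b J) -> a = a'.
Proof. by move=> H; apply/funext => b; apply/funext => J. Qed.

Lemma poly_addE (a a' : poly) b J : (a + a') b J = a b J + a' b J. Proof. by []. Qed.
Lemma poly_scaleE (c : C) a b J : (c *: a) b J = c * a b J. Proof. by []. Qed.

Lemma A_dom_lin (c : C) a a' : A_dom laur a -> A_dom laur a' -> A_dom laur (c *: a + a').
Proof.
move=> [[s Hs] Ha] [[t Ht] Ha'].
have E b J : (c *: a + a') b J <> 0 -> a b J <> 0 \/ a' b J <> 0.
  move=> H; case: (pselect (a b J = 0)) => a0; last by left.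
  by right => a0'; apply: H; rewrite poly_addE poly_scaleE a0 a0' mulr0 addr0.
split; first by exists (s ++ t) => b J /E[/Hs|/Ht] H; rewrite mem_cat H ?orbT.
by move=> b J /E[/Ha|/Ha'].
Qed.

Lemma A_dom0 : A_dom laur (0 : poly).
Proof. by split; [exists [::] | move=> b J /=]. Qed.

Lemma A_dom_dA b J : okm laur b -> A_dom laur (dA b J).
Proof.
move=> ok; split=> [|b' J']; first exists [:: (b, J)] => b' J'; rewrite /dA.
  by case: andP => // -[/eqP -> /eqP ->]; rewrite inE.
by case: andP => // -[/eqP -> _].
Qed.

Lemma A_ind (Q : poly -> Prop) : Q 0 ->
  (forall (c : C) b J a, okm laur b -> A_dom laur a -> Q a -> Q (c *: dA b J + a)) ->
  forall a, A_dom laur a -> Q a.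
Proof.
move=> Q0 QD a [[s Hs] Ha]; elim: s a Hs Ha => [|[b J] s IH] a Hs Ha.
  suff -> : a = 0 by [].
  by apply: poly_ext => b J; apply: contrapT => /Hs.
have [a0|a0] := pselect (a b J = 0).
  apply: IH => // b' J' H; have := Hs _ _ H; rewrite inE => /orP[/eqP [E1 E2]|//].
  by case: H; rewrite E1 E2.
pose a' : poly := fun b' J' => if (b' == b) && (J' == J) then 0 else a b' J'.
have -> : a = a b J *: dA b J + a'.
  apply: poly_ext => b' J'; rewrite poly_addE poly_scaleE /dA /a'.
  by case: ifP => [/andP[/eqP -> /eqP ->]|_]; rewrite ?mulr1 ?addr0 // mulr0 add0r.
have Hs' b' J' : a' b' J' <> 0 -> (b', J') \in s.
  rewrite /a'; case: ifP => // H /Hs; by rewrite inE xpair_eqE H.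
have Ha' b' J' : a' b' J' <> 0 -> laur || nonneg_mon b'.
  by rewrite /a'; case: ifP => // _; exact: Ha.
apply: QD; [exact: Ha a0 | by split=> //; exists s | exact: IH].
Qed.

Lemma A_t_lin i : lin (@A_t R m n i : poly -> poly). Proof. by []. Qed.
Lemma A_ti_lin i : lin (@A_ti R m n i : poly -> poly). Proof. by []. Qed.
Lemma A_dt_lin i : lin (@A_dt R m n i : poly -> poly).
Proof.
move=> c a a'; apply: poly_ext => b J; rewrite poly_addE poly_scaleE /A_dt.
by rewrite poly_addE poly_scaleE mulrDr mulrCA.
Qed.
Lemma A_x_lin j : lin (@A_x R m n j : poly -> poly).
Proof.
move=> c a a'; apply: poly_ext => b J; rewrite poly_addE poly_scaleE /A_x.
by case: ifP => _; rewrite ?mulr0 ?addr0 // poly_addE poly_scaleE mulrDr mulrCA.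
Qed.
Lemma A_dx_lin j : lin (@A_dx R m n j : poly -> poly).
Proof.
move=> c a a'; apply: poly_ext => b J; rewrite poly_addE poly_scaleE /A_dx.
by case: ifP => _; rewrite ?mulr0 ?addr0 // poly_addE poly_scaleE mulrDr mulrCA.
Qed.
Lemma A_par_lin : lin (@A_par R m n : poly -> poly).
Proof.
move=> c a a'; apply: poly_ext => b J; rewrite poly_addE poly_scaleE /A_par.
by rewrite poly_addE poly_scaleE mulrDr mulrCA.
Qed.

Definition cntn (j : 'I_n) J : nat := #|[set k in J | (k < j)%N]|.

Lemma cntn_U j J : cntn j (j |: J) = cntn j J.
Proof.
congr #|pred_of_set _|; apply/setP => k; rewrite !inE.
by case: eqVneq => [->|//]; rewrite ltnn !andbF.
Qed.

Lemma cntn_D j J : cntn j (J :\ j) = cntn j J.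
Proof.
congr #|pred_of_set _|; apply/setP => k; rewrite !inE.
by case: eqVneq => [->|//]; rewrite ltnn !andbF.
Qed.

Lemma A_t_dA i b J : A_t i (dA b J) = dA (b + eim i) J.
Proof. by apply: poly_ext => b' J'; rewrite /A_t /dA subr_eq. Qed.

Lemma A_ti_dA i b J : A_ti i (dA b J) = dA (b - eim i) J.
Proof. by apply: poly_ext => b' J'; rewrite /A_ti /dA [b' == _]eq_sym subr_eq eq_sym. Qed.

Lemma A_dt_dA i b J : A_dt i (dA b J) = (b i)%:~R *: dA (b - eim i) J.
Proof.
apply: poly_ext => b' J'; rewrite poly_scaleE /A_dt /dA [b' == b - _]eq_sym subr_eq [b == _]eq_sym.
case: eqVneq => [<-|_]; last by rewrite !mulr0.
by rewrite !ffunE eqxx intrD.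
Qed.

Lemma A_x_dA j b J : A_x j (dA b J) = (if j \in J then 0 else (-1) ^+ cntn j J) *: dA b (j |: J).
Proof.
apply: poly_ext => b' J'; rewrite poly_scaleE /A_x /dA -/(cntn j J').
case: ifP => jJ'; last first.
  case: (eqVneq J' (j |: J)) => [E|_]; last by rewrite andbF mulr0.
  by move: jJ'; rewrite E setU11.
case: ifP => jJ.
  case: eqVneq => [_|_] /=; last by rewrite mulr0 mul0r.
  case: eqVneq => [E|_]; last by rewrite mulr0 mul0r.
  by move: jJ; rewrite -E !inE eqxx.
have -> : (J' :\ j == J) = (J' == j |: J).
  apply/eqP/eqP => [<-|->]; first by rewrite setD1K.
  by rewrite setU1K ?jJ.
case: (eqVneq J' (j |: J)) => [->|_]; last by rewrite andbF !mulr0.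
by rewrite cntn_U.
Qed.

Lemma A_dx_dA j b J : A_dx j (dA b J) = dxi_c R j J *: dA b (J :\ j).
Proof.
apply: poly_ext => b' J'; rewrite poly_scaleE /A_dx /dA /dxi_c -/(cntn j J') -/(cntn j J).
case: ifP => jJ'.
  case: (eqVneq J' (J :\ j)) => [E|_]; last by rewrite andbF mulr0.
  by move: jJ'; rewrite E !inE eqxx.
case: ifP => jJ; last first.
  rewrite mul0r; case: (eqVneq (j |: J') J) => [E|_]; last by rewrite andbF mulr0.
  by move: jJ; rewrite -E setU11.
have -> : (j |: J' == J) = (J' == J :\ j).
  apply/eqP/eqP => [<-|->]; first by rewrite setU1K ?jJ'.
  by rewrite setD1K.
case: (eqVneq J' (J :\ j)) => [->|_]; last by rewrite andbF !mulr0.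
by rewrite cntn_D.
Qed.

Lemma A_par_dA b J : A_par (dA b J) = (-1) ^+ #|J| *: dA b J.
Proof.
apply: poly_ext => b' J'; rewrite poly_scaleE /A_par /dA.
by case: (eqVneq J' J) => [->//|_]; rewrite andbF !mulr0.
Qed.

Lemma mono_gen_dA (a b : {ffun 'I_m -> int}) I :
  mono_gen (@A_t R m n) (@A_ti R m n) (@A_x R m n) a I (dA b set0) = dA (a + b) I.
Proof.
have tpE i k b' J : tpow (@A_t R m n i) (@A_ti R m n i) k (dA b' J) = dA (b' + [ffun l => (l == i)%:Z * k]) J.
  case: k => k /=.
    elim: k => [|k IH] /=.
      by congr dA; apply/ffunP => l; rewrite !ffunE mulr0 addr0.
    rewrite IH A_t_dA; congr dA; apply/ffunP => l; rewrite !ffunE -addrA; congr (_ + _).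
    by rewrite -[X in _ + X = _]mulr1 -mulrDr; congr (_ * _); rewrite intS addrC.
  elim: k => [|k IH].
    rewrite /= A_ti_dA; congr dA; apply/ffunP => l; rewrite !ffunE; congr (_ + _).
    by rewrite NegzE mulrN1.
  rewrite [iter _.+1 _ _]/= in IH *.
  rewrite IH A_ti_dA; congr dA; apply/ffunP => l; rewrite !ffunE -addrA; congr (_ + _).
  rewrite -mulN1r [_ * (l == i)%:Z]mulrC -mulrDr; congr (_ * _); lia.
rewrite /mono_gen.
set x0 := foldr _ id _.
have -> : foldr (fun i g => tpow (@A_t R m n i) (@A_ti R m n i) (a i) \o g) x0 (enum 'I_m) (dA b set0)
   = foldr (fun i w => tpow (@A_t R m n i) (@A_ti R m n i) (a i) w) (x0 (dA b set0)) (enum 'I_m).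
  by elim: (enum 'I_m) => [//|i s /= ->].
have -> : x0 (dA b set0) = dA b I.
  rewrite /x0; have srt : sorted (fun x y : 'I_n => (x < y)%N) [seq j <- enum 'I_n | j \in I].
    apply: sorted_filter; first by move=> x y z; apply: ltn_trans.
    by have := iota_ltn_sorted 0 n; rewrite -val_enum_ord sorted_map.
  (* I is replaced by its increasing list, on which the induction runs. *)
  have -> : I = [set j in [seq j <- enum 'I_n | j \in I]].
    by apply/setP => j; rewrite inE mem_filter mem_enum andbT.
  have -> : [seq j <- enum 'I_n | j \in [set j in [seq j <- enum 'I_n | j \in I]]]
     = [seq j <- enum 'I_n | j \in I].
    by apply: eq_filter => j; rewrite inE mem_filter mem_enum andbT.
  elim: [seq j <- enum 'I_n | j \in I] srt => [|j s IH] /= pth.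
    by congr dA; apply/setP => j; rewrite !inE.
  rewrite IH ?(path_sorted pth) // A_x_dA.
  have tr : transitive (fun x y : 'I_n => (x < y)%N) by move=> x y z; apply: ltn_trans.
  have all_j : all (fun x : 'I_n => (j < x)%N) s by exact: order_path_min tr pth.
  have js : j \notin s by apply/negP => /(allP all_j); rewrite ltnn.
  rewrite inE (negbTE js).
  (* The new index j precedes all others, so multiplication by xi_j costs no sign. *)
  have -> : cntn j [set j0 in s] = 0%N.
    apply/eqP; rewrite cards_eq0; apply/eqP/setP => k; rewrite !inE.
    by apply/negP => /andP[/(allP all_j) /ltnW]; rewrite leqNgt => /negP.
  by rewrite expr0 scale1r; congr dA; apply/setP => k; rewrite !inE.
have -> : a + b = b + [ffun l => \sum_(i <- enum 'I_m) (l == i)%:Z * a i].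
  apply/ffunP => l; rewrite !ffunE addrC; congr (_ + _).
  rewrite big_enum (bigD1 l) //= eqxx mul1r big1 ?addr0 // => i.
  by rewrite eq_sym => /negbTE ->; rewrite mul0r.
elim: (enum 'I_m) => [|i s IH] /=.
  by congr dA; apply/ffunP => l; rewrite !ffunE big_nil addr0.
rewrite IH tpE; congr dA; apply/ffunP => l; rewrite !ffunE big_cons -addrA; congr (_ + _).
by rewrite addrC.
Qed.

Lemma mono_gen_id a : mono_gen (@A_t R m n) (@A_ti R m n) (@A_x R m n) 0 set0 a = a.
Proof.
rewrite /mono_gen (eq_filter (a2 := pred0)); last by move=> j; rewrite inE.
rewrite filter_pred0 /=; elim: (enum 'I_m) => [//|i s IH] /=.
by rewrite IH ffunE.
Qed.

(** * Monomials as weight vectors of A *)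

Section Component.
Variable S : poly -> Prop.
Hypothesis S_lin : forall (c : C) a a', S a -> S a' -> S (c *: a + a').
Hypothesis S0 : S 0.
Hypothesis S_dom : forall a, S a -> A_dom laur a.
Hypothesis S_t : forall i a, S a -> S (A_t i (A_dt i a)).
Hypothesis S_x : forall j a, S a -> S (A_x j (A_dx j a)).

(** The eigenvalues of t_i d/dt_i and xi_j d/dxi_j on the monomial with label p. *)
Definition wtA (c : 'I_m + 'I_n) p : C :=
  match c with inl i => (p.1 i)%:~R | inr j => (j \in p.2)%:R end.

Lemma wtA_sep p q : p != q -> exists c, wtA c p != wtA c q.
Proof.
move=> pq; apply: contrapT => H; move/negP: pq; apply.
have W c : wtA c p = wtA c q by apply/eqP/negPn/negP => Hc; apply: H; exists c.
case: p q W {H} => [b J] [b' J'] W; apply/eqP; congr (_, _).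
  by apply/ffunP => i; have /= /eqP := W (inl i); rewrite eqr_int => /eqP.
apply/setP => s; have /= := W (inr s); case: (s \in J); case: (s \in J') => //= /eqP.
  by rewrite oner_eq0.
by rewrite eq_sym oner_eq0.
Qed.

Lemma S_wt c (x : C) a : S a -> S (fun b J => (wtA c (b, J) - x) * a b J).
Proof.
move=> Sa; have -> : (fun b J => (wtA c (b, J) - x) * a b J) =
   match c with inl i => A_t i (A_dt i a) | inr j => A_x j (A_dx j a) end + ((- x) *: a + 0).
  apply: poly_ext => b J; rewrite poly_addE addr0 poly_scaleE mulrDl; congr (_ + _).
  case: c => i /=.
    by rewrite /A_t /A_dt subrK !ffunE eqxx intrB subrK.
  rewrite /A_x /A_dx; case: ifP => iJ; last by rewrite mul0r.
  by rewrite !inE eqxx /= setD1K // mulrA -/(cntn i J) -/(cntn i (J :\ i)) cntn_D signC.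
rewrite -[X in X + _]scale1r; apply: S_lin; last exact: S_lin.
by case: c => i; [exact: S_t | exact: S_x].
Qed.

(** Other monomials are removed from a one at a time, each by subtracting its eigenvalue from an
    operator that separates it from t^b xi_J. *)
Lemma S_component a b J : S a -> a b J <> 0 -> S (dA b J).
Proof.
move=> Sa ab; have [[s Hs] _] := S_dom Sa.
pose p := (b, J); have {}Hs q : a q.1 q.2 <> 0 -> q \in p :: s.
  by case: q => b' J' /Hs; rewrite inE => ->; rewrite orbT.
elim: s a Sa ab Hs => [|q s IH] a Sa ab Hs.
  have -> : dA b J = (a b J)^-1 *: a + 0.
    apply: poly_ext => b' J'; rewrite addr0 poly_scaleE /dA.
    case: andP => [[/eqP -> /eqP ->]|N]; first by rewrite mulVf //; apply/eqP.
    suff -> : a b' J' = 0 by rewrite mulr0.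
    apply: contrapT => f0; have := Hs (b', J') f0; rewrite inE => /eqP[E1 E2].
    by case: N; rewrite E1 E2.
  exact: S_lin.
have [qp|qp] := eqVneq p q.
  by apply: (IH a) => // q' /Hs; rewrite !inE -qp orbA orbb.
have [c Hc] := wtA_sep qp.
apply: (IH _ (S_wt c (wtA c q) Sa)).
  by move/eqP; rewrite mulf_eq0 subr_eq0 (negbTE Hc) /= => /eqP.
move=> q' /= H; have aq : a q'.1 q'.2 <> 0 by move=> f0; apply: H; rewrite f0 mulr0.
have := Hs q' aq; rewrite !inE; case: (eqVneq q' q) => [E|_] //.
by case: H; rewrite E -surjective_pairing subrr mul0r.
Qed.
End Component.

(** * Submodules of A that contain the constants *)

Section QuotientByConstants.
Variable S : poly -> Prop.
Hypothesis HS : Wsubmod (@Wadm m n laur) (@A_par R m n) (@A_W R m n) (@A_dom R m n laur) S.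
Hypothesis cS : forall a, A_constants laur a -> S a.

Let S_lin (c : C) a a' : S a -> S a' -> S (c *: a + a').
Proof. by case: HS => [[_ _ Ha Hs] _ _] Sa Sa'; apply: (Ha _ _ (Hs c _ Sa) Sa'). Qed.
Let S0 : S 0. Proof. by case: HS => [[]]. Qed.
Let S_dom a : S a -> A_dom laur a. Proof. by case: HS => [[H _ _ _] _ _]; exact: H. Qed.
Let S_scale (c : C) a : S a -> S (c *: a).
Proof. by move=> Sa; rewrite -[_ *: _]addr0; apply: S_lin. Qed.
Let S_W x a : Wadm laur x -> S a -> S (A_W x a).
Proof. by case: HS => _ _; apply. Qed.

Definition lowA (c : 'I_m + 'I_n) a := match c with inl i => A_dt i a | inr j => A_dx j a end.

Let S_gen (e : {ffun 'I_m -> int}) (I : {set 'I_n}) c a : okm laur e -> S a ->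
  S (mono_gen (@A_t R m n) (@A_ti R m n) (@A_x R m n) e I (lowA c a)).
Proof.
by case: c => i ok Sa; [apply: (@S_W (WT e I i)) | apply: (@S_W (WX e I i))].
Qed.

Let S_low c a : S a -> S (lowA c a).
Proof. by move=> Sa; rewrite -[lowA c a]mono_gen_id; apply: S_gen => //; exact: okm0. Qed.

(** If d_c sends the monomial to x t^b', then t^(e - b') xi_I d_c sends it to x t^e xi_I, for any
    target. The condition on b' keeps e - b' admissible in the polynomial case. *)
Lemma S_everything b J c (x : C) b' : S (dA b J) -> okm laur b' -> laur || (b' == 0) ->
  x != 0 -> lowA c (dA b J) = x *: dA b' set0 ->
  forall a, A_dom laur a -> S a.
Proof.
move=> Sb ok' lb x0 E; apply: A_ind => // y e I a ok _ Sa; apply: S_lin => //.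
have oke : okm laur (e - b').
  by move: ok lb; rewrite /okm; case: laur => //= ok /eqP ->; rewrite subr0.
have xi : S (x *: dA b' set0) by rewrite -E; exact: S_low.
suff : S (x *: dA e I) by move/(S_scale x^-1); rewrite scalerA mulVf // scale1r.
have := S_gen I c oke Sb; rewrite E.
suff -> : mono_gen (@A_t R m n) (@A_ti R m n) (@A_x R m n) (e - b') I (x *: dA b' set0) = x *: dA e I by [].
have L (g : poly -> poly) (s : seq 'I_m) : lin g ->
    lin (foldr (fun i g => tpow (@A_t R m n i) (@A_ti R m n i) ((e - b') i) \o g) g s).
  move=> gl; elim: s => [//|i s IH] /=; apply: lin_comp => //.
  by case: ((e - b') i) => k; [exact: lin_iter (A_t_lin i) | exact: (@lin_iter _ _ _ k.+1 (A_ti_lin i))].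
have ml : lin (mono_gen (@A_t R m n) (@A_ti R m n) (@A_x R m n) (e - b') I : poly -> poly).
  apply: L; elim: [seq _ <- _ | _] => [//|j s IH] /=; apply: lin_comp => //.
  exact: A_x_lin.
by rewrite (linZ ml) mono_gen_dA subrK.
Qed.

(* Lower t^b xi_J by derivations until one more derivation d_c gives a nonzero constant (or, in the
   Laurent case, a multiple of some t^b'); then the operators t^e xi_I d_c produce every monomial. *)
Lemma S_nonconst b J : S (dA b J) -> okm laur b -> (b != 0) || (J != set0) ->
  forall a, A_dom laur a -> S a.
Proof.
have [k] := ubnP (#|J| + (if laur then 0 else \sum_(i < m) absz (b i)))%N.
elim: k b J => // k IH b J; rewrite ltnS => kk Sb ok N.
have [J0|/set0Pn[j jJ]] := eqVneq J set0.
  have [i bi] : exists i, b i != 0.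
    by apply: ffun_neq0; move: N; rewrite J0 eqxx orbF.
  have ok' := okm_sub ok bi.
  have bz : (b i)%:~R != 0 :> C by rewrite intr_eq0.
  have E : lowA (inl i) (dA b J) = (b i)%:~R *: dA (b - eim i) set0 by rewrite J0 /= A_dt_dA.
  case: (boolP (laur || (b - eim i == 0))) => [H|].
    exact: (S_everything Sb ok' H bz E).
  rewrite negb_or => /andP[nl nb].
  have Sb' : S (dA (b - eim i) J).
    have := S_low (inl i) Sb; rewrite E J0 => /(S_scale (b i)%:~R^-1).
    by rewrite scalerA mulVf // scale1r.
  apply: (IH (b - eim i) J _ Sb' ok'); last by rewrite nb.
  apply: leq_trans kk; rewrite (negbTE nl) ltn_add2l (bigD1 i) // [in X in (_ < X)%N](bigD1 i) //=.
  rewrite -addSn leq_add //.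
    rewrite !ffunE eqxx; move: ok; rewrite /okm (negbTE nl) /= => /forallP /(_ i).
    by move: (b i) bi => x; lia.
  by apply: leq_sum => l li; rewrite !ffunE (negbTE li) subr0.
have x0 : dxi_c R j J != 0 by rewrite /dxi_c jJ signr_eq0.
have E : lowA (inr j) (dA b J) = dxi_c R j J *: dA b (J :\ j) by rewrite /= A_dx_dA.
case: (boolP ((J :\ j == set0) && (laur || (b == 0)))) => [/andP[/eqP J0 H]|H].
  by rewrite J0 in E; exact: (S_everything Sb ok H x0 E).
have Sb' : S (dA b (J :\ j)).
  have := S_low (inr j) Sb; rewrite E => /(S_scale (dxi_c R j J)^-1).
  by rewrite scalerA mulVf // scale1r.
apply: (IH b (J :\ j) _ Sb' ok).
  by apply: leq_trans kk; rewrite [in X in (_ < X)%N](cardsD1 j J) jJ add1n addSn.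
move: H; rewrite negb_and negb_or => /orP[->|/andP[_ ->]] //; by rewrite orbT.
Qed.

Lemma quotient_by_constants : (forall a, S a -> A_constants laur a) \/ (forall a, A_dom laur a -> S a).
Proof.
case: (pselect (forall a, S a -> A_constants laur a)) => [|/existsNP[a /not_implyP[Sa Na]]].
  by left.
right; have [b [J [aN N]]] : exists b J, a b J <> 0 /\ ((b != 0) || (J != set0)).
  apply: contrapT => H; apply: Na; split; first exact: S_dom.
  move=> b J aN; have := fun N => H (ex_intro _ b (ex_intro _ J (conj aN N))).
  by case: (eqVneq b 0) => [->|_]; case: (eqVneq J set0) => [->|_] //= F; case: F.
apply: (@S_nonconst b J) => //; last by apply: (S_dom Sa).2 aN.
(* Monomials are isolated by t_i d/dt_i and xi_j d/dxi_j, which are the elements [WT (eim i) set0 i]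
   and [WX 0 [set j] j] of W. *)
apply: (S_component S_lin S0 S_dom _ _ Sa aN) => [i a' Sa'|j a' Sa'].
  have ok : okm laur (eim i) by rewrite -[eim i]add0r; apply: okm_add; exact: okm0.
  suff <- : A_W (WT (eim i) set0 i) a' = A_t i (A_dt i a') by apply: S_W.
  rewrite /= /mono_gen (eq_filter (a2 := pred0)); last by move=> j; rewrite inE.
  rewrite filter_pred0 /=; move: (A_dt i a') => w.
  have : uniq (enum 'I_m) by exact: enum_uniq.
  have : i \in enum 'I_m by rewrite mem_enum.
  have id_out s : i \notin s -> foldr (fun k g => tpow (@A_t R m n k) (@A_ti R m n k) (eim i k) \o g) id s w = w.
    by elim: s => [//|k s IH] /=; rewrite inE negb_or => /andP[ik /IH ->]; rewrite ffunE eq_sym (negbTE ik).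
  elim: (enum 'I_m) => [//|k s IH]; rewrite inE /=; case: eqVneq => [<-|ik] /= is_ /andP[ks us].
    by rewrite id_out // ffunE eqxx.
  by rewrite IH // ffunE eq_sym (negbTE ik).
have ok : okm laur (0 : {ffun 'I_m -> int}) by exact: okm0.
suff <- : A_W (WX 0 [set j] j) a' = A_x j (A_dx j a') by apply: S_W.
rewrite /= /mono_gen.
have -> : [seq k <- enum 'I_n | k \in [set j]] = [:: j].
  have U : uniq [seq k <- enum 'I_n | k \in [set j]] by rewrite filter_uniq ?enum_uniq.
  apply: perm_small_eq => //; apply: uniq_perm => // k.
  by rewrite mem_filter mem_enum andbT !inE.
move: (A_dx j a') => w /=; elim: (enum 'I_m) => [//|k s IH] /=.
by rewrite IH ffunE.
Qed.

End QuotientByConstants.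

Lemma A_mod_constants_simple : (0 < m + n)%N ->
  Wsimple_quot (@Wadm m n laur) (@A_par R m n) (@A_W R m n) (@A_dom R m n laur) (@A_constants R m n laur).
Proof.
move=> mn; split; last by move=> S HS cS; exact: quotient_by_constants.
have dA1 b J : dA b J b J = 1 by rewrite /dA !eqxx.
have [mz|m0] := posnP m.
  have n0 : (0 < n)%N by rewrite mz add0n in mn.
  exists (dA 0 [set Ordinal n0]); split; first by apply: A_dom_dA; exact: okm0.
  move=> [_ /(_ 0 [set Ordinal n0])]; rewrite dA1 => /(_ (elimN eqP (oner_neq0 _))) [_ /setP /(_ (Ordinal n0))].
  by rewrite !inE eqxx.
pose i := Ordinal m0; exists (dA (eim i) set0); split.
  by apply: A_dom_dA; rewrite -[eim i]add0r; apply: okm_add; exact: okm0.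
move=> [_ /(_ (eim i) set0)]; rewrite dA1 => /(_ (elimN eqP (oner_neq0 _))) [/ffunP /(_ i)].
by rewrite !ffunE eqxx.
Qed.

End NaturalModule.

(** * Vectors annihilated by all derivations *)

Section Vacuum.
Variables (R : realType) (m n : nat) (laur : bool) (V : lmodType R[i]) (K : Kops m n V).
Hypothesis HK : is_Kmodule laur K.
Hypothesis HP : Ksimple laur K.
Local Notation C := (R[i]).
Local Notation idx := ('I_m + 'I_n)%type.
Local Notation poly := ({ffun 'I_m -> int} -> {set 'I_n} -> C).
Local Notation lbl := ({ffun 'I_m -> int} * {set 'I_n})%type.
Implicit Types (a : poly) (b : {ffun 'I_m -> int}) (J : {set 'I_n}).

Definition vacuum (u : V) := u <> 0 /\ forall c : idx, kdop K c u = 0.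

Lemma vacuum_of_iso shift : Kiso_A laur K shift -> exists u, vacuum u.
Proof.
case=> f [fl fi _ _ [fe _ fo]].
have D0 := @A_dom0 R m n laur; have D1 := @A_dom_dA R m n laur 0 set0 (@okm0 m laur).
have f0 : f 0 = 0.
  have := fl (-1) 0 0 D0 D0; have -> : fadd (fscale (-1) 0) 0 = 0 :> poly.
    by apply: poly_ext => b J; rewrite /fadd /fscale scaler0 addr0.
  by rewrite scaleN1r addNr.
(* The image of the constant 1 is the required vector. *)
exists (f (dA R 0 set0)); split=> [E|[i|j] /=].
- have := fi _ _ D1 D0; rewrite E f0 => /(_ erefl) /(congr1 (fun a : poly => a 0 set0)).
  by rewrite /dA !eqxx => /eqP; rewrite oner_eq0.
- by rewrite -(fe i _ D1).2 A_dt_dA ffunE scale0r.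
- by rewrite -(fo j _ D1).2 A_dx_dA /dxi_c inE scale0r.
Qed.

(** * The copy of A generated by a homogeneous vacuum vector *)

Section Iso.
Variables (u : V) (sg : bool).
Hypothesis u_vac : vacuum u.
Hypothesis u_par : kpar K u = (-1) ^+ sg *: u.

Let vac_dt i : kdt K i u = 0. Proof. exact: u_vac.2 (inl i). Qed.
Let vac_dx j : kdx K j u = 0. Proof. exact: u_vac.2 (inr j). Qed.

Definition msum (s : seq lbl) a : V := \sum_(p <- s) a p.1 p.2 *: mono K p.1 p.2 u.

Lemma msum_eq (s t : seq lbl) a : uniq s -> uniq t ->
  (forall b J, a b J <> 0 -> (b, J) \in s) -> (forall b J, a b J <> 0 -> (b, J) \in t) ->
  msum s a = msum t a.
Proof.
move=> us ut Hs Ht; rewrite /msum.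
have F (r : seq lbl) : \sum_(p <- r) a p.1 p.2 *: mono K p.1 p.2 u =
    \sum_(p <- [seq p <- r | a p.1 p.2 != 0]) a p.1 p.2 *: mono K p.1 p.2 u.
  rewrite big_filter [RHS]big_mkcond; apply: eq_bigr => p _.
  by case: eqVneq => [->|//]; rewrite scale0r.
rewrite F [RHS]F; apply: perm_big; apply: uniq_perm; rewrite ?filter_uniq // => -[b J].
by rewrite !mem_filter /=; case: eqVneq => //= /eqP ne; rewrite Hs ?Ht.
Qed.

(** The sum that defines the map needs a list covering the support, and [A_dom] only asserts that
    one exists. The sum does not depend on the list, so a choice function provides the map. *)
Lemma phi_ex : exists phi : poly -> V,
  forall a s, uniq s -> (forall b J, a b J <> 0 -> (b, J) \in s) -> phi a = msum s a.
Proof.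
have H a : exists v, forall s, uniq s -> (forall b J, a b J <> 0 -> (b, J) \in s) -> v = msum s a.
  case: (pselect (exists s, uniq s /\ (forall b J, a b J <> 0 -> (b, J) \in s))) => [[s [us Hs]]|N].
    by exists (msum s a) => t ut Ht; apply: msum_eq.
  by exists 0 => s us Hs; case: N; exists s.
by have [phi Hphi] := choice H; exists phi.
Qed.

Definition phi : poly -> V := projT1 (cid phi_ex).

Lemma phiE a s : uniq s -> (forall b J, a b J <> 0 -> (b, J) \in s) -> phi a = msum s a.
Proof. exact: (projT2 (cid phi_ex)). Qed.

Lemma phi_lin (c : C) a a' : A_dom laur a -> A_dom laur a' -> phi (c *: a + a') = c *: phi a + phi a'.
Proof.
move=> [[s Hs] _] [[t Ht] _]; pose r := undup (s ++ t).
have ur : uniq r by exact: undup_uniq.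
have Hr b J : (b, J) \in s \/ (b, J) \in t -> (b, J) \in r.
  by rewrite /r mem_undup mem_cat => -[->|->] //; rewrite orbT.
rewrite (@phiE a r) // => [|b J /Hs ?]; last by apply: Hr; left.
rewrite (@phiE a' r) // => [|b J /Ht ?]; last by apply: Hr; right.
rewrite (@phiE _ r) // => [|b J H]; last first.
  apply: Hr; case: (pselect (a b J = 0)) => [a0|/Hs]; last by left.
  by right; apply: Ht => a0'; apply: H; rewrite poly_addE poly_scaleE a0 a0' mulr0 addr0.
rewrite /msum scaler_sumr -big_split; apply: eq_bigr => p _ /=.
by rewrite poly_addE poly_scaleE scalerDl scalerA.
Qed.

Lemma phi_dA b J : phi (dA R b J) = mono K b J u.
Proof.
rewrite (@phiE _ [:: (b, J)]) // => [|b' J']; last first.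
  by rewrite /dA; case: andP => // -[/eqP -> /eqP ->]; rewrite inE.
by rewrite /msum big_seq1 /dA !eqxx scale1r.
Qed.

Lemma phi0 : phi 0 = 0.
Proof.
have := phi_lin (-1) (@A_dom0 R m n laur) (@A_dom0 R m n laur).
by rewrite scaler0 addr0 scaleN1r addNr.
Qed.

Lemma phiZ (c : C) a : A_dom laur a -> phi (c *: a) = c *: phi a.
Proof.
by move=> Ha; have := phi_lin c Ha (@A_dom0 R m n laur); rewrite phi0 !addr0.
Qed.

Definition domT (T : poly -> poly) := forall b J, okm laur b -> A_dom laur (T (dA R b J)).

Lemma dom_ext T : lin T -> domT T -> forall a, A_dom laur a -> A_dom laur (T a).
Proof.
move=> Tl TD; apply: A_ind => [|c b J a ok Ha IH]; first by rewrite (lin0 Tl); exact: A_dom0.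
by rewrite Tl; apply: A_dom_lin => //; exact: TD.
Qed.

Lemma intertwine T (g : V -> V) : lin T -> lin g -> domT T ->
  (forall b J, okm laur b -> phi (T (dA R b J)) = g (mono K b J u)) ->
  forall a, A_dom laur a -> phi (T a) = g (phi a).
Proof.
move=> Tl gl TD H; apply: A_ind => [|c b J a ok Ha IH].
  by rewrite (lin0 Tl) phi0 (lin0 gl).
have Hd : A_dom laur (dA R b J) by apply: A_dom_dA.
by rewrite Tl (phi_lin _ (TD _ _ ok) (dom_ext Tl TD Ha)) IH (H _ _ ok) (phi_lin _ Hd Ha) phi_dA gl.
Qed.

Lemma domT_t i : domT (@A_t R m n i).
Proof. by move=> b J ok; rewrite A_t_dA; apply: A_dom_dA; exact: okm_add. Qed.

Lemma A_domZ (c : C) a : (c != 0 -> A_dom laur a) -> A_dom laur (c *: a).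
Proof.
have [->|c0] := eqVneq c 0; first by rewrite scale0r => _; exact: A_dom0.
by move=> /(_ isT) Ha; rewrite -[_ *: _]addr0; apply: A_dom_lin => //; exact: A_dom0.
Qed.

Lemma domT_dt i : domT (@A_dt R m n i).
Proof.
move=> b J ok; rewrite A_dt_dA; apply: A_domZ; rewrite intr_eq0 => b0.
by apply: A_dom_dA; exact: okm_sub.
Qed.

Lemma domT_x j : domT (@A_x R m n j).
Proof. by move=> b J ok; rewrite A_x_dA; apply: A_domZ => _; exact: A_dom_dA. Qed.

Lemma domT_dx j : domT (@A_dx R m n j).
Proof. by move=> b J ok; rewrite A_dx_dA; apply: A_domZ => _; exact: A_dom_dA. Qed.

Lemma domT_par : domT (@A_par R m n).
Proof. by move=> b J ok; rewrite A_par_dA; apply: A_domZ => _; exact: A_dom_dA. Qed.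

Lemma domT_ti i : laur -> domT (@A_ti R m n i).
Proof. by move=> l b J ok; rewrite A_ti_dA; apply: A_dom_dA; rewrite /okm l. Qed.

Lemma phi_t i a : A_dom laur a -> phi (A_t i a) = kt K i (phi a).
Proof.
apply: (intertwine (A_t_lin _) (kt_lin HK i) (@domT_t i)) => b J ok.
by rewrite A_t_dA phi_dA (mono_ktE HK).
Qed.

Lemma phi_ti i a : laur -> A_dom laur a -> phi (A_ti i a) = kti K i (phi a).
Proof.
move=> l; apply: (intertwine (A_ti_lin _) (kti_lin HK i l) (domT_ti i l)) => b J ok.
by rewrite A_ti_dA phi_dA (mono_ktiE HK).
Qed.

Lemma phi_dt i a : A_dom laur a -> phi (A_dt i a) = kdt K i (phi a).
Proof.
apply: (intertwine (@A_dt_lin _ _ _ _) (kdt_lin HK i) (@domT_dt i)) => b J ok.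
rewrite A_dt_dA (kdt_mono HK) // vac_dt (lin0 (mono_lin HK J ok)) add0r.
have [->|b0] := eqVneq (b i) 0; first by rewrite !scale0r phi0.
by rewrite phiZ ?phi_dA //; apply: A_dom_dA; exact: okm_sub.
Qed.

Lemma phi_x j a : A_dom laur a -> phi (A_x j a) = kx K j (phi a).
Proof.
apply: (intertwine (@A_x_lin _ _ _ _) (kx_lin HK j) (@domT_x j)) => b J ok.
rewrite A_x_dA phiZ ?phi_dA; last exact: A_dom_dA.
by rewrite (kx_mono HK) //; case: ifP => // _; rewrite scale0r.
Qed.

Lemma phi_dx j a : A_dom laur a -> phi (A_dx j a) = kdx K j (phi a).
Proof.
apply: (intertwine (@A_dx_lin _ _ _ _) (kdx_lin HK j) (@domT_dx j)) => b J ok.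
rewrite A_dx_dA phiZ ?phi_dA; last exact: A_dom_dA.
by rewrite (kdx_mono HK) // vac_dx (lin0 (mono_lin HK J ok)) scaler0 add0r.
Qed.

Lemma phi_par a : A_dom laur a -> phi (A_par a) = (-1) ^+ sg *: kpar K (phi a).
Proof.
apply: (intertwine (g := fun v => (-1) ^+ sg *: kpar K v) (@A_par_lin _ _ _) _ domT_par) => [|b J ok].
  by move=> c v w; rewrite (kpar_lin HK) scalerDr !scalerA mulrC.
rewrite A_par_dA phiZ ?phi_dA; last exact: A_dom_dA.
rewrite (kpar_mono HK) // u_par (linZ (mono_lin HK J ok)) !scalerA.
by rewrite mulrC mulrA -mulrA mulrCA mulrA signC mul1r.
Qed.

(** Derivations and, for negative exponents, multiplications by t_i lead back from the monomial to a
    nonzero multiple of u. *)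
Lemma mono_vac_neq0 b J : okm laur b -> mono K b J u <> 0.
Proof.
have ok0 := @okm0 m laur.
have base k : forall J', (#|J'| <= k)%N -> mono K 0 J' u <> 0.
  elim: k => [|k IH] J'; first by rewrite leqn0 cards_eq0 => /eqP ->; rewrite mono0; exact: u_vac.1.
  have [->|/set0Pn[j jJ]] := eqVneq J' set0; first by rewrite mono0 => _; exact: u_vac.1.
  rewrite (cardsD1 j J') jJ add1n ltnS => kk E; apply: (IH (J' :\ j) kk).
  have := congr1 (kdx K j) E.
  rewrite (kdx_mono HK) // vac_dx (lin0 (mono_lin HK J' ok0)) scaler0 add0r.
  by rewrite (lin0 (kdx_lin HK j)) => /eqP; rewrite scaler_eq0 /dxi_c jJ signr_eq0 /= => /eqP.
move=> ok; have [k] := ubnP (\sum_(i < m) absz (b i))%N; elim: k b ok => // k IH b ok.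
rewrite ltnS => kk; have [->|/ffun_neq0[i bi]] := eqVneq b 0; first exact: (base #|J|).
have lt (e : {ffun 'I_m -> int}) : (absz (e i) < absz (b i))%N ->
    (forall l, l != i -> e l = b l) -> (\sum_(i < m) absz (e i) < k)%N.
  move=> ei eo; apply: leq_trans kk; rewrite (bigD1 i) // [in X in (_ < X)%N](bigD1 i) //=.
  by rewrite -addSn leq_add // leq_sum // => l li; rewrite eo.
have [pos|neg] := ltrP 0 (b i) => E.
  apply: (IH (b - eim i)); first exact: okm_sub.
    apply: lt => [|l li]; last by rewrite !ffunE (negbTE li) subr0.
    by rewrite !ffunE eqxx; move: (b i) pos => x; lia.
  have := congr1 (kdt K i) E.
  rewrite (kdt_mono HK) // vac_dt (lin0 (mono_lin HK J ok)) add0r (lin0 (kdt_lin HK i)).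
  by move=> /eqP; rewrite scaler_eq0 intr_eq0 (negbTE bi) /= => /eqP.
apply: (IH (b + eim i)); first exact: okm_add.
  apply: lt => [|l li]; last by rewrite !ffunE (negbTE li) addr0.
  by rewrite !ffunE eqxx; move: (b i) bi neg => x; lia.
by rewrite -(mono_ktE HK) // E (lin0 (kt_lin HK i)).
Qed.

(** The kernel is stable under t_i d/dt_i and xi_j d/dxi_j, so with a nonzero element it would
    contain a monomial, against [mono_vac_neq0]. *)
Lemma phi_inj0 a : A_dom laur a -> phi a = 0 -> a = 0.
Proof.
move=> Ha E; apply: poly_ext => b J; apply: contrapT => ab.
pose S a := A_dom laur a /\ phi a = 0.
have Sa : S a by [].
have SS : S (dA R b J).
  apply: (S_component (laur := laur) _ _ _ _ _ Sa ab).
  - by move=> c x y [Hx Ex] [Hy Ey]; split; [exact: A_dom_lin | rewrite phi_lin // Ex Ey scaler0 addr0].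
  - by split; [exact: A_dom0 | exact: phi0].
  - by move=> x [].
  - move=> i x [Hx Ex]; have Hd := dom_ext (@A_dt_lin _ _ _ _) (@domT_dt i) Hx.
    split; first exact: (dom_ext (A_t_lin _) (@domT_t i) Hd).
    by rewrite phi_t // phi_dt // Ex (lin0 (kdt_lin HK i)) (lin0 (kt_lin HK i)).
  - move=> j x [Hx Ex]; have Hd := dom_ext (@A_dx_lin _ _ _ _) (@domT_dx j) Hx.
    split; first exact: (dom_ext (@A_x_lin _ _ _ _) (@domT_x j) Hd).
    by rewrite phi_x // phi_dx // Ex (lin0 (kdx_lin HK j)) (lin0 (kx_lin HK j)).
case: SS => _; rewrite phi_dA; apply: mono_vac_neq0.
exact: Ha.2 ab.
Qed.

(** The image is a graded K-submodule of the simple module P and contains u. *)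
Lemma phi_surj v : exists a, A_dom laur a /\ phi a = v.
Proof.
have [_ /(_ (fun v => exists a, A_dom laur a /\ phi a = v))] := HP.
case=> [|H|]; last by apply.
  split.
  - by exists 0; split; [exact: A_dom0 | exact: phi0].
  - move=> _ _ [a [Ha <-]] [a' [Ha' <-]]; exists (1 *: a + a'); split; first exact: A_dom_lin.
    by rewrite phi_lin // scale1r.
  - move=> c _ [a [Ha <-]]; exists (c *: a); split; first exact: A_domZ.
    by rewrite phiZ.
  - move=> _ [a [Ha <-]]; have Hp := dom_ext (@A_par_lin _ _ _) domT_par Ha.
    exists ((-1) ^+ sg *: A_par a); split; first exact: A_domZ.
    by rewrite phiZ // phi_par // scalerA signC scale1r.
  split.
  - move=> i _ [a [Ha <-]]; split.
      by exists (A_t i a); rewrite phi_t //; split=> //; exact: (dom_ext (A_t_lin _) (@domT_t i) Ha).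
    by exists (A_dt i a); rewrite phi_dt //; split=> //; exact: (dom_ext (@A_dt_lin _ _ _ _) (@domT_dt i) Ha).
  - move=> l i _ [a [Ha <-]].
    by exists (A_ti i a); rewrite phi_ti //; split=> //; exact: (dom_ext (A_ti_lin _) (domT_ti i l) Ha).
  - move=> j _ [a [Ha <-]]; split.
      by exists (A_x j a); rewrite phi_x //; split=> //; exact: (dom_ext (@A_x_lin _ _ _ _) (@domT_x j) Ha).
    by exists (A_dx j a); rewrite phi_dx //; split=> //; exact: (dom_ext (@A_dx_lin _ _ _ _) (@domT_dx j) Ha).
case: (u_vac.1); apply: H; exists (dA R 0 set0); split; first by apply: A_dom_dA; exact: okm0.
by rewrite phi_dA mono0.
Qed.

Lemma iso_of_homogeneous_vacuum : Kiso_A laur K sg.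
Proof.
exists phi; split.
- by move=> c a b Ha Hb; exact: phi_lin.
- move=> a b Ha Hb E; apply/eqP; rewrite -subr_eq0; apply/eqP.
  have E' : a - b = (-1) *: b + a by rewrite scaleN1r addrC.
  by apply: phi_inj0; rewrite E'; [exact: A_dom_lin | rewrite phi_lin // E scaleN1r addNr].
- exact: phi_surj.
- move=> a Ha; rewrite phi_par //; congr (_ *: _); by case: sg; rewrite ?expr1 ?expr0.
- split.
  + by move=> i a Ha; rewrite phi_t // phi_dt.
  + by move=> l i a Ha; exact: phi_ti.
  + by move=> j a Ha; rewrite phi_x // phi_dx.
Qed.

End Iso.

Lemma iso_of_vacuum u : vacuum u -> Kiso_A laur K false \/ Kiso_A laur K true.
Proof.
move=> [u0 uv]; have pl := kpar_lin HK.
have pv c : kdop K c (kpar K u) = 0.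
  have := kpar_kd HK c u; rewrite uv (lin0 pl) => /esym /eqP.
  by rewrite scaler_eq0 signr_eq0 /= => /eqP.
(* The vector u need not be homogeneous. Twice its even part is u + [kpar K u], again killed by all
   derivations; if this is 0 then u is odd. *)
have [E|E] := pselect (u + kpar K u = 0).
  right; apply: (@iso_of_homogeneous_vacuum u true) => //.
  by rewrite expr1 scaleN1r; apply/eqP; rewrite -addr_eq0 addrC E.
left; apply: (@iso_of_homogeneous_vacuum (u + kpar K u) false); last first.
  by rewrite expr0 scale1r (linD pl) (kparK HK) addrC.
by split=> // c; rewrite (linD (kdop_lin HK c)) uv pv addr0.
Qed.

(** * The case r = 0 and lambda = 0 *)

Local Notation lam0 := (fun _ : 'I_n => 0 : C).
Local Notation form := ({set 'I_m} -> {ffun 'I_n -> int} -> V).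

(** All weights are nonnegative, so in degree 0 only the label of y(0) remains and the module is
    P. *)
Lemma FL0E (f : form) : FL 0 lam0 f -> f = del set0 0 (f set0 0).
Proof.
move=> [[_ Hv] Hd]; apply: form_ext => J mu; rewrite /del.
case: ifP => [/andP[/eqP -> /eqP ->] //|E]; apply: contrapT => f0.
have p j : 0 <= mu j.
  have Hj := (validwE _ _).1 (Hv _ _ f0) j; move: Hj.
  case: (vldP lam0 j) => [[H _]|[z [Ez H]]]; first by case: H; exists 0.
  have z0 : z = 0 by apply/eqP; rewrite -(intr_eq0 C) -Ez.
  by move/H; rewrite z0 add0r => <-.
have dg := Hd _ _ f0; have S0 : 0 <= \sum_(j < n) mu j by apply: sumr_ge0.
have S1 : \sum_(j < n) mu j = 0 by move: dg S0; move: (\sum_(j < n) mu j) => x; lia.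
have J0 : J = set0 by apply/eqP; rewrite -cards_eq0; move: dg; rewrite S1; lia.
have m0 : mu = 0.
  apply/ffunP => j; rewrite ffunE; apply/eqP.
  by move/eqP: S1; rewrite psumr_eq0 // => /allP/(_ j); rewrite mem_index_enum => /(_ isT).
by move: E; rewrite J0 m0 !eqxx.
Qed.

Lemma FL0_del (v : V) : FL 0 lam0 (del (set0 : {set 'I_m}) 0 v).
Proof.
by have := Fk_del (set0 : {set 'I_m}) v (@validw0 R n lam0); rewrite cards0 sum_ffun0 addr0.
Qed.

Lemma cana0 (c : idx) : cana lam0 c (set0, 0).
Proof.
case: c => i /=; first by rewrite inE.
by apply: cana_inr (@validw0 R n lam0) _; rewrite /coef ffunE !add0r oner_eq0.
Qed.

(** The e_c carry the label of y(0) to distinct labels, so the derivatives in D cannot cancel. For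
    odd c the vector is twisted by [kpar], which does not affect the vanishing of d_c. *)
Lemma Dop_del0 (v : V) :
  Dop K lam0 (del set0 0 v) = 0 <-> forall c : idx, kdop K c v = 0.
Proof.
split=> [E c|H].
  have [x x0 Ex] := Dop_del_addl HK (cana0 c).
  have := Ex v; rewrite E => /esym/eqP; rewrite scaler_eq0 (negbTE x0) /= => /eqP.
  case: c {Ex} => i //= /(congr1 (kpar K)).
  have := kpar_kd HK (inr i) (kpar K v); rewrite /= (kparK HK) => ->.
  by rewrite (lin0 (kpar_lin HK)) => /eqP; rewrite scaler_eq0 signr_eq0 /= => /eqP.
rewrite Dop_sum big1 // => c _; have [x x0 Ex] := eop_del HK (cana0 c).
rewrite (Ex v) (linZ (pw_lin (kdop_lin HK c))) pw_del ?(lin0 (kdop_lin HK c)) //.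
suff -> : kdop K c (kpo K (isodd c) v) = 0 by rewrite (lin0 (del_lin _ _)) scaler0.
case: c {Ex} => i /=; first exact: (H (inl i)).
have := kpar_kd HK (inr i) v; rewrite (H (inr i)) (lin0 (kpar_lin HK)) => /esym/eqP.
by rewrite scaler_eq0 signr_eq0 /= => /eqP.
Qed.

Lemma Ftil_submod (lam : 'I_n -> C) r :
  Wsubmod (Wadm laur) (Fpar K) (Fpi K lam) (FL r lam) (Ftil laur K r lam).
Proof.
have Dl := Dop_lin HK lam.
have FP := FtilP HK HP lam r.
split; [split|..].
- by move=> f /FP[].
- by apply/FP; split; [exact: Fk0 | exact: (lin0 Dl)].
- move=> f g /FP[Hf Df] /FP[Hg Dg]; apply/FP; have -> : fadd f g = 1 *: f + g by rewrite scale1r.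
  by split; [exact: (Fk_lin _ Hf Hg) | rewrite Dl Df Dg scaler0 addr0].
- move=> c f /FP[Hf Df]; apply/FP; have -> : fscale c f = c *: f + 0 by rewrite addr0.
  split; last by rewrite Dl Df (lin0 Dl) scaler0 addr0.
  by apply: (Fk_lin (lam := lam) (k := r%:Z)) => //; exact: Fk0.
- move=> f /FP[Hf Df]; apply/FP; split; first exact: (Fk_par HK Hf).
  by rewrite -(Fpar_Dop HK) Df (lin0 (Fpar_lin HK)).
- move=> x f; have [a [I [b ->]]] := XgenP x; rewrite Wadm_Xgen => ok /FP[Hf Df]; apply/FP.
  split; first exact: (Fk_Fpi HK _ _ ok Hf).
  rewrite (Fpi_closed HK) //; last by apply Hf.
  by apply: (Dop_Dop HK); apply: FM_vsupp; apply (Fk_contr HK I b ok Hf).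
Qed.

(** [Ftil] consists of the vectors killed by all derivations and is never the whole module, while
    the quotient by it is simple. So simplicity means that only 0 is such a vector, that is, P is
    neither A nor Pi(A). *)
Lemma FL0_simple : (0 < m + n)%N ->
  Wsimple (Wadm laur) (Fpar K) (Fpi K lam0) (FL 0 lam0)
   <-> (~ Kiso_A laur K false /\ ~ Kiso_A laur K true).
Proof.
move=> mn; have Hr : 0%N <> m \/ ~ (forall j : 'I_n, lam0 j = -1).
  case: (m) mn => [|k] mn; last by left.
  right => /(_ (Ordinal mn)) /eqP; rewrite eq_sym oppr_eq0 oner_eq0 //.
have FP := FtilP HK HP lam0 0.
split=> [[_ simp]|[N1 N2]].
  suff nv u : ~ vacuum u.
    by split=> /vacuum_of_iso[u /nv].
  move=> [u0 uv]; have Dl := Dop_lin HK lam0.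
  have Fu : Ftil laur K 0 lam0 (del set0 0 u) by apply/FP; split; [exact: FL0_del | exact/Dop_del0].
  case: (simp _ (Ftil_submod lam0 0)) => [H|H].
    by apply: u0; rewrite -(del_self (set0 : {set 'I_m}) (0 : {ffun 'I_n -> int}) u) (H _ Fu).
  have [f [Hf Df]] := FL_not_closed HK HP (leq0n m) Hr.
  by apply: Df; have /FP[] := H _ Hf.
have [[f [Hf Nf]] Hq] := quotient_simple HK HP (leq0n m) Hr.
have F0 g : Ftil laur K 0 lam0 g -> g = 0.
  move=> /FP[Hg Dg]; rewrite (FL0E Hg); move: Dg; rewrite {1}(FL0E Hg) => /Dop_del0 Hv.
  suff -> : g set0 0 = 0 by rewrite (lin0 (del_lin _ _)).
  by apply: contrapT => g0; have [] := @iso_of_vacuum (g set0 0).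
split.
  exists f; split=> // f0; apply: Nf; rewrite f0; apply/FP; split; first exact: Fk0.
  exact: lin0 (Dop_lin HK lam0).
move=> S HS; case: (Hq S HS) => [g /F0 -> |H|]; last by right.
  by case: HS => [[]].
by left => g /H /F0.
Qed.

End Vacuum.

Theorem theorem4p8 (R : realType) (m n : nat) (laur : bool)
    (V : lmodType R[i]) (K : Kops m n V)
    (HK : is_Kmodule laur K) (HP : Ksimple laur K)
    (r : nat) (lam : 'I_n -> R[i]) :
  (0 < m + n)%N -> (r <= m)%N -> (r <> m -> forall j, lam j = 0) ->
  [/\ (* (1) *)
      (r <> m \/ ~ (forall j, lam j = -1)) ->
        forall f, Ftil laur K r lam f <-> (FL r lam f /\ Fsigma K lam f = fz),
      (* (2) *)
      (r <> m \/ ~ (forall j, lam j = -1)) ->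
        Wsimple_quot (Wadm laur) (Fpar K) (Fpi K lam) (FL r lam) (Ftil laur K r lam),
      (* (3) *)
      (r <> 0%N \/ ~ (forall j, lam j = 0)) ->
        Wsimple (Wadm laur) (Fpar K) (Fpi K lam) (Fr K r lam),
      (* (4) *)
      (Wsimple (Wadm laur) (Fpar K) (Fpi K (fun _ => 0)) (FL 0 (fun _ => 0))
         <-> (~ Kiso_A laur K false /\ ~ Kiso_A laur K true)) /\
      Wsimple_quot (Wadm laur) (@A_par R m n) (@A_W R m n) (@A_dom R m n laur) (@A_constants R m n laur) &
      (* (5) *)
      (r = m /\ (forall j, lam j = -1)) ->
        (Wsimple (Wadm laur) (Fpar K) (Fpi K lam) (FL m lam) <-> Pspan K) /\
        (~ Pspan K -> Wtrivial_quot (Wadm laur) (Fpi K lam) (FL m lam) (Fr K m lam))].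
Proof.
move=> mn rm _; split.
- move=> _ f; split=> [/(FtilP HK HP)[Hf Df]|[Hf Df]].
    by split=> //; rewrite (Fsigma_Dop HK) //; exact: FM_vsupp Hf.1.
  apply/(FtilP HK HP); split=> //; rewrite -(Fsigma_Dop HK) //; exact: FM_vsupp Hf.1.
- by move=> H; apply: (quotient_simple HK HP).
- by move=> H; apply: (Fr_simple HK HP).
- split; first exact: FL0_simple HK HP mn.
  exact: A_mod_constants_simple.
- move=> [_ lt]; split; first by apply: (top_simple HK HP).
  by move=> _; apply: (top_trivial HK HP).
Qed.
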